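(* The $\mathcal{T}$-consistency problem for the tile set $\mathcal{T}=\{t_1,t_2\}$ with $t_1=\{(0,0)\}$ (a $1\times 1$ cell) and $t_2=\{(0,0),(0,1),(1,0),(1,1)\}$ (a $2\times 2$ square) is $\mathbb{NP}$-complete.
   Context: A tile is a finite subset of $\mathbb{Z}^2$ containing $(0,0)$, its center, which is its upper-left corner; coordinates are (row, column). For $(i,j)\in\mathbb{Z}^2$, $(i,j)+t=\{(i+i',j+j'):(i',j')\in t\}$. Fix a finite list of tiles $\mathcal{T}=(t_1,\dots,t_h)$; the index $k$ is the type of $t_k$. Tiles may only be translated. A $\mathcal{T}$-tiling of the grid $\mathbb{Z}_n\times\mathbb{Z}_n=\{0,\dots,n-1\}^2$ is a finite set $T\subseteq \mathbb{Z}_n\times\mathbb{Z}_n\times\{1,\dots,h\}$ such that the sets $(i,j)+t_k$, $(i,j,k)\in T$, are pairwise disjoint and contained in the grid (the tiling need not cover the grid). Its projections are $r,c\in\mathbb{N}^{n\times h}$ with $r_{i,k}=|\{j:(i,j,k)\in T\}|$ and $c_{j,k}=|\{i:(i,j,k)\in T\}|$. The $\mathcal{T}$-consistency problem: given $n$ and $r,c\in\mathbb{N}^{n\times h}$, decide whether a $\mathcal{T}$-tiling of the $n\times n$ grid with projections $r,c$ exists. *)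

(* Defs.v *)
From HB Require Import structures.
From mathcomp Require Import all_boot all_order all_algebra finmap.
Set Implicit Arguments.
Unset Strict Implicit.
Unset Printing Implicit Defensive.
Import Order.TTheory GRing.Theory Num.Theory.

(** * Deterministic multi-tape Turing machines and NP-completeness *)

Inductive move := MoveLeft | Stay | MoveRight.

Definition shift (m : move) : int :=
  match m with MoveLeft => (-1)%R | Stay => 0%R | MoveRight => 1%R end.

(* The tape alphabet consists of the blank [None], the input letters, the
   output letters and the machine's own work symbols. *)
Definition tape_symbol (Sigma Delta work : finType) : finType :=
  option (Sigma + (Delta + work))%type.

(* There are [tm_tapes.+1] tapes: tape [ord0] is the input tape and tape
   [ord_max] the output tape (they coincide for single-tape machines).  From the
   current state and the scanned symbols, [tm_delta] returns [None] to halt, or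
   the new state and, for each tape, the symbol to write and the head move. *)
Record tm (Sigma Delta : finType) := TM {
  tm_tapes : nat;
  tm_work : finType;
  tm_state : finType;
  tm_start : tm_state;
  tm_delta : tm_state ->
    {ffun 'I_tm_tapes.+1 -> tape_symbol Sigma Delta tm_work} ->
    option (tm_state *
      {ffun 'I_tm_tapes.+1 -> tape_symbol Sigma Delta tm_work * move})
}.

Section Execution.
Variables (Sigma Delta : finType) (M : tm Sigma Delta).

Definition symbol : finType := tape_symbol Sigma Delta (tm_work M).

(* Tapes are infinite in both directions. *)
Definition content := int -> symbol.

Record config := Config {
  cfg_state : tm_state M;
  cfg_head : 'I_(tm_tapes M).+1 -> int;
  cfg_content : 'I_(tm_tapes M).+1 -> content
}.

(* The tape with [w] in cells 0, ..., size w - 1 and blanks elsewhere. *)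
Definition content_of (w : seq symbol) : content :=
  fun z => if z is Posz i then nth None w i else None.

Definition input_symbol (a : Sigma) : symbol := Some (inl a).
Definition output_symbol (b : Delta) : symbol := Some (inr (inl b)).

Definition init (x : seq Sigma) : config :=
  Config (tm_start M) (fun _ => 0%R)
    (fun i => content_of (if i == ord0 then map input_symbol x else [::])).

Definition action (c : config) :=
  tm_delta (cfg_state c) [ffun i => cfg_content c i (cfg_head c i)].

Definition halted (c : config) : Prop := action c = None.

(* Halted configurations are left unchanged. *)
Definition step (c : config) : config :=
  if action c is Some (q, a) then
    Config q (fun i => (cfg_head c i + shift (a i).2)%R)
      (fun i z => if z == cfg_head c i then (a i).1 else cfg_content c i z)
  else c.

Definition output_is (c : config) (y : seq Delta) : Prop :=
  cfg_content c ord_max =1 content_of (map output_symbol y).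

Definition computes_within (x : seq Sigma) (y : seq Delta) (t : nat) : Prop :=
  let c := iter t step (init x) in halted c /\ output_is c y.

End Execution.

Definition polytime (Sigma Delta : finType) (f : seq Sigma -> seq Delta) :=
  exists (M : tm Sigma Delta) (p : {poly nat}),
    forall x, computes_within M x (f x) p.[size x]%R.

Definition language (Sigma : finType) := seq Sigma -> Prop.

(* The pair of an input [x] and a certificate [u] is the word [x u] over the
   disjoint union of their alphabets, so that both can be recovered. *)
Definition pair_word (Sigma : finType) (x : seq Sigma) (u : seq bool) :
  seq (Sigma + bool)%type := map inl x ++ map inr u.

Definition in_NP (Sigma : finType) (L : language Sigma) : Prop :=
  exists (V : seq (Sigma + bool)%type -> bool) (p : {poly nat}),
    polytime (fun w => [:: V w]) /\
    forall x, L x <->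
      exists u : seq bool, (size u <= p.[size x]%R)%N /\ V (pair_word x u).

Definition poly_reducible (Sigma Delta : finType)
    (L : language Sigma) (L' : language Delta) : Prop :=
  exists f : seq Sigma -> seq Delta,
    polytime f /\ forall x, L x <-> L' (f x).

Definition NP_hard (Delta : finType) (L : language Delta) : Prop :=
  forall (Sigma : finType) (L' : language Sigma),
    in_NP L' -> poly_reducible L' L.

Definition NP_complete (Delta : finType) (L : language Delta) : Prop :=
  in_NP L /\ NP_hard L.

(** * Tilings and their projections *)

Record tile := Tile {
  tile_cells :> {fset int * int};
  tile_origin : ((0, 0)%R : int * int) \in tile_cells;
  tile_upper_left :
    forall p : int * int, p \in tile_cells -> (0 <= p.1)%R && (0 <= p.2)%R
}.

Definition translate (i j : int) (t : {fset int * int}) : {fset int * int} :=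
  [fset (i + p.1, j + p.2)%R | p in t]%fset.

Definition in_grid (n : nat) (p : int * int) : bool :=
  [&& (0 <= p.1)%R, (p.1 < n%:Z)%R, (0 <= p.2)%R & (p.2 < n%:Z)%R].

Section Tilings.
Variables (h : nat) (tiles : h.-tuple tile) (n : nat).

Definition placed (a : 'I_n * 'I_n * 'I_h) : {fset int * int} :=
  translate (nat_of_ord a.1.1)%:Z (nat_of_ord a.1.2)%:Z (tnth tiles a.2).

Definition is_tiling (T : {set 'I_n * 'I_n * 'I_h}) : Prop :=
  (forall a b, a \in T -> b \in T -> a != b ->
     [disjoint placed a & placed b]%fset) /\
  (forall a p, a \in T -> p \in placed a -> in_grid n p).

Definition row_projection (T : {set 'I_n * 'I_n * 'I_h}) : 'M[nat]_(n, h) :=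
  \matrix_(i, k) #|[set j | (i, j, k) \in T]|.

Definition col_projection (T : {set 'I_n * 'I_n * 'I_h}) : 'M[nat]_(n, h) :=
  \matrix_(j, k) #|[set i | (i, j, k) \in T]|.

Definition consistent (r c : 'M[nat]_(n, h)) : Prop :=
  exists T : {set 'I_n * 'I_n * 'I_h},
    [/\ is_tiling T, row_projection T = r & col_projection T = c].

End Tilings.

(* Binary notation, least significant bit first; 0 is written [:: false]. *)
Definition binary (m : nat) : seq bool :=
  [seq odd (m %/ 2 ^ i) | i <- iota 0 (trunc_log 2 m).+1].

Definition entries (n h : nat) (A : 'M[nat]_(n, h)) : seq nat :=
  [seq A i k | i <- enum 'I_n, k <- enum 'I_h].

(* An instance is written as n followed by the entries of r and of c, row by
   row, all in binary and each terminated by the separator [None]. *)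
Definition encode (n h : nat) (r c : 'M[nat]_(n, h)) : seq (option bool) :=
  flatten [seq rcons (map Some (binary m)) None
          | m <- n :: entries r ++ entries c].

Definition consistency_problem (h : nat) (tiles : h.-tuple tile) :
  language (option bool) :=
  fun w => exists (n : nat) (r c : 'M[nat]_(n, h)),
    w = encode r c /\ consistent tiles r c.

Definition cell_cells : {fset int * int} := [fset (0, 0)%R]%fset.

Definition square_cells : {fset int * int} :=
  [fset (0, 0)%R; (0, 1)%R; (1, 0)%R; (1, 1)%R]%fset.

Fact cell_origin : ((0, 0)%R : int * int) \in cell_cells.
Proof. by rewrite inE. Qed.

Fact cell_upper_left (p : int * int) :
  p \in cell_cells -> (0 <= p.1)%R && (0 <= p.2)%R.
Proof. by rewrite inE => /eqP->. Qed.

Fact square_origin : ((0, 0)%R : int * int) \in square_cells.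
Proof. by rewrite !inE. Qed.

Fact square_upper_left (p : int * int) :
  p \in square_cells -> (0 <= p.1)%R && (0 <= p.2)%R.
Proof. by rewrite !inE -!orbA => /or4P[] /eqP->. Qed.

Definition cell_tile : tile := Tile cell_origin cell_upper_left.

Definition square_tile : tile := Tile square_origin square_upper_left.

(* Main.v *)
(* Squares and cells placed at even coordinates colour the 2 x 2 blocks of the
   grid with two colours A (square) and B (cell), so hardness is proved for
   row and column sums of two-coloured matrices.  Sums that are extremal for
   an ordered labelling of rows and columns force A above and B below a
   staircase; what remains free is a chain of stages, each carrying a 0/1
   vector on N coordinates.  Consecutive stages are linked by N x N blocks
   whose sums only allow the vector to move up in the dominance order.  The
   coordinates are grouped in pairs (x, not x), and the sums at both ends of
   the chain make every pair complementary, so that along the chain a variable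
   can only change from false to true.  Two test rows in every stage check
   that a given set of coordinates is not entirely 1.  If all clauses with
   positive literals come first and the purely negative ones last, the drift
   is harmless and the chain decides satisfiability.

   Such clauses describe the computation tableaux of a polynomial-time verifier:
   each tableau site has some value, and no window carries a forbidden tuple.
   For the running times, functions are written in a language whose only
   iteration is the bounded sum; its values are polynomially bounded by
   construction and it compiles to counter machines, hence to Turing machines
   in which a counter is the head position on a tape with a marked origin. *)

(* Projections give only linear equations, so every rigid feature has to come from extremality. For
   labels [al] on rows and [be] on columns, the sum of ([be j] - [al i]) * ([a i j] - [[al i] <
   [be j]]) over all cells is determined by the projections and has no positive term; when the
   prescribed sums make it zero, only cells with equal labels remain free. In colour A the labels
   pair the rows of stage k with the columns of stage k, in colour B with the columns of stage k -
   1; these two kinds of blocks alternate along the chain. A free block yields only inequalities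
   between suffix sums; they become equations at even positions because the two ends of the chain
   have the same suffix sums there. A test works by counting: with v the vector and S the tested
   set, the two test rows hold v + S entries of colour A per column, but the second row is given
   only |S| - 1 of them, whereas v = 1 on all of S would put both rows on S. Tests can thus only say
   that not all of S is 1, so a clause is tested on the negations of its literals. *)
Require Import Defs.
From HB Require Import structures.
From mathcomp Require Import all_boot all_order all_algebra finmap zify.
From Stdlib Require Import FunctionalExtensionality.
Set Implicit Arguments.
Unset Strict Implicit.
Unset Printing Implicit Defensive.
Import Order.TTheory GRing.Theory Num.Theory.

(** * Counter machines and their simulation *)

Section CounterMachine.
Variables (Sigma Delta : finType).

Inductive instr :=
  | Inc of nat | Dec of nat | Jz of nat & nat | Jmp of nat
  | InRight | InLeft | Jin of option Sigma & nat | Emit of Delta.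

Record cstate := CState {
  pc : nat; regs : nat -> nat; ipos : int; outw : seq Delta }.

Definition upd (R : nat -> nat) (c v : nat) : nat -> nat :=
  fun i => if i == c then v else R i.

Definition read (x : seq Sigma) (z : int) : option Sigma :=
  if z is Posz i then onth x i else None.

Definition cexec (x : seq Sigma) (ins : instr) (s : cstate) : cstate :=
  let: CState p R z w := s in
  match ins with
  | Inc c => CState p.+1 (upd R c (R c).+1) z w
  | Dec c => CState p.+1 (upd R c (R c).-1) z w
  | Jz c q => CState (if R c == 0 then q else p.+1) R z w
  | Jmp q => CState q R z w
  | InRight => CState p.+1 R (z + 1)%R w
  | InLeft => CState p.+1 R (z - 1)%R w
  | Jin a q => CState (if read x z == a then q else p.+1) R z w
  | Emit b => CState p.+1 R z (rcons w b)
  end.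

Definition cstep (C : seq instr) (x : seq Sigma) (s : cstate) : cstate :=
  if onth C (pc s) is Some ins then cexec x ins s else s.

Definition reg_of (ins : instr) : nat :=
  match ins with Inc c | Dec c | Jz c _ => c | _ => 0 end.

Section Simulation.
Variable C : seq instr.

Definition nregs : nat := (\max_(ins <- C) reg_of ins).+1.

Lemma reg_of_lt p ins : onth C p = Some ins -> reg_of ins < nregs.
Proof.
rewrite /nregs ltnS; elim: C p => [|a D IH] [|p] //=.
- by case=> <-; rewrite big_cons leq_maxl.
- by move/IH => h; rewrite big_cons (leq_trans h) ?leq_maxr.
Qed.

Notation sym := (tape_symbol Sigma Delta unit).
Definition mark : sym := Some (inr (inr tt)).

(** [None] is an additional initial state, in which the marks are written. Addresses are clipped to
    [size C], where there is no instruction, so a jump out of the code halts. *)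
Definition cm_state : finType := option 'I_(size C).+1.

Definition goto (p : nat) : cm_state := Some (inord (minn p (size C))).

Definition cm_next (ins : instr) (p : nat) (s : {ffun 'I_nregs.+2 -> sym}) :=
  match ins with
  | Jz c q => if s (inord c.+1) == mark then q else p.+1
  | Jmp q => q
  | Jin a q => if s ord0 == omap inl a then q else p.+1
  | _ => p.+1
  end.

Definition cm_move (ins : instr) (s : {ffun 'I_nregs.+2 -> sym})
    (i : 'I_nregs.+2) : move :=
  match ins with
  | Inc c => if i == c.+1 :> nat then MoveRight else Stay
  | Dec c => if (i == c.+1 :> nat) && (s i != mark) then MoveLeft else Stay
  | InRight => if i == 0 :> nat then MoveRight else Stay
  | InLeft => if i == 0 :> nat then MoveLeft else Stay
  | Emit _ => if i == nregs.+1 :> nat then MoveRight else Stay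
  | _ => Stay
  end.

Definition cm_write (ins : instr) (s : {ffun 'I_nregs.+2 -> sym})
    (i : 'I_nregs.+2) : sym :=
  if ins is Emit b then
    if i == nregs.+1 :> nat then Some (inr (inl b)) else s i
  else s i.

Definition cm_delta (q : cm_state) (s : {ffun 'I_nregs.+2 -> sym}) :
    option (cm_state * {ffun 'I_nregs.+2 -> sym * move}) :=
  match q with
  | None => Some (goto 0, [ffun i : 'I_nregs.+2 =>
      (if (i == 0 :> nat) || (i == nregs.+1 :> nat) then s i else mark, Stay)])
  | Some p =>
    if onth C p is Some ins then
      Some (goto (cm_next ins p s),
            [ffun i => (cm_write ins s i, cm_move ins s i)])
    else None
  end.

Definition cm : tm Sigma Delta := @TM Sigma Delta nregs.+1 unit cm_state None cm_delta.

(* A register is stored as the head position of its tape, whose only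
   non-blank cell is the mark at the origin. *)
Definition tape_head (s : cstate) (i : nat) : int :=
  if i == 0 then ipos s
  else if i == nregs.+1 then Posz (size (outw s)) else Posz (regs s i.-1).

Definition tape_content (x : seq Sigma) (s : cstate) (i : nat) (z : int) : sym :=
  if i == 0 then content_of (M := cm) (map (input_symbol cm) x) z
  else if i == nregs.+1 then content_of (M := cm) (map (output_symbol cm) (outw s)) z
  else if z == 0%R then mark else None.

Definition sim (x : seq Sigma) (c : config cm) (s : cstate) : Prop :=
  [/\ cfg_state c = goto (pc s),
      forall i, cfg_head c i = tape_head s i
    & forall i z, cfg_content c i z = tape_content x s i z].

Lemma onth_goto p : onth C (@inord (size C) (minn p (size C))) = onth C p.
Proof.
rewrite inordK ?ltnS ?geq_minr //; case: (leqP p (size C)) => [//|h].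
by rewrite !onth_default // ltnW.
Qed.

Lemma content_of_rcons (w : seq Delta) b z :
  content_of (M := cm) (map (output_symbol cm) (rcons w b)) z =
  if z == Posz (size w) then Some (inr (inl b))
  else content_of (M := cm) (map (output_symbol cm) w) z.
Proof.
case: z => //= i; rewrite map_rcons nth_rcons size_map eqz_nat.
by case: ltngtP => // h; rewrite nth_default // size_map ltnW.
Qed.

Lemma content_of_read (x : seq Sigma) z :
  content_of (M := cm) (map (input_symbol cm) x) z = omap inl (read x z).
Proof. by case: z => //= i; elim: x i => [|a x IH] [|i] //=; exact: IH. Qed.

Lemma omap_inl_eq (T U : eqType) (a b : option T) :
  (omap inl a == omap inl b :> option (T + U)) = (a == b).
Proof. by case: a b => [a|] [b|]. Qed.

(** Each instruction costs exactly one machine step: a register changes by at most one, and it is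
    zero exactly when the head of its tape scans the mark. *)
Lemma sim_step x c s : sim x c s -> sim x (step c) (cstep C x s).
Proof.
case=> hq hh hc; rewrite /step /action /cstep hq /= onth_goto.
case e: (onth C (pc s)) => [ins|]; last by split.
have lt_r := reg_of_lt e.
have lt_p : pc s < size C by rewrite -onthTE e.
set f := [ffun _ => _].
have fE i : f i = tape_content x s i (tape_head s i) by rewrite ffunE hc hh.
have rE cc : cc < nregs -> f (inord cc.+1) = if regs s cc == 0 then mark else None.
  move=> h; rewrite fE inordK ?ltnS 1?ltnW // /tape_content /tape_head /=.
  by rewrite eqSS ltn_eqF.
have mE (i : 'I_nregs.+2) cc : i = cc.+1 :> nat -> cc < nregs ->
    (f i == mark) = (regs s cc == 0).
  move=> hi h; have -> : i = inord cc.+1 by apply: val_inj; rewrite /= inordK -?hi.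
  by rewrite rE //; case: (regs s cc == 0).
have ltc (i : 'I_nregs.+2) cc : i = cc.+1 :> nat -> cc < nregs ->
    (i == 0 :> nat) = false /\ (i == nregs.+1 :> nat) = false.
  by move=> -> h; split=> //; rewrite eqSS ltn_eqF.
have f0 : f ord0 = omap inl (read x (ipos s)).
  by rewrite fE /tape_content /tape_head /= content_of_read.
rewrite inordK ?ltnS ?geq_minr // (minn_idPl (ltnW lt_p)).
clearbody f; split => [|i|i z] /=.
- congr goto; case: s {hq hh hc fE mE ltc lt_p e} lt_r f0 rE => p R z w /=.
  case: ins => //= [cc q lt_r _ ->//|a q _ ->]; first by case: (R cc == 0).
  by rewrite omap_inl_eq.
- rewrite ffunE hh /=.
  case: s {hq hh hc f0 fE rE e lt_p} lt_r mE => p R z w /= lt_r mE.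
  case: ins lt_r => [cc|cc|cc q|q|||a q|b] //= lt_r;
    rewrite /tape_head /= ?addr0 //.
  + case: (@nat_of_ord nregs.+2 i =P cc.+1) => [hi|hi]; rewrite /upd /=.
      by have [-> ->] := ltc _ _ hi lt_r; rewrite hi /= eqxx /=; lia.
    case: eqP => [_|i0]; first by rewrite addr0.
    by case: eqP => [_|_]; rewrite ?addr0 //; case: eqP => [|_]; rewrite /=; lia.
  + case: (@nat_of_ord nregs.+2 i =P cc.+1) => [hi|hi] /=; rewrite /upd /=.
      have [-> ->] := ltc _ _ hi lt_r; rewrite (mE _ _ hi) // hi /= eqxx /=.
      by case: eqP => /=; lia.
    case: eqP => [_|i0]; first by rewrite addr0.
    by case: eqP => [_|_]; rewrite ?addr0 //; case: eqP => [|_]; rewrite /=; lia.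
  + by case: eqP => //=; rewrite addr0.
  + by case: eqP => //=; rewrite addr0.
  + case: (@nat_of_ord nregs.+2 i =P nregs.+1) => [->|_] /=; rewrite ?size_rcons ?addr0 //; lia.
- rewrite hh ffunE /=.
  have wE : (if z == tape_head s i then f i else cfg_content c i z) =
      tape_content x s i z by rewrite fE hc; case: eqP => [->|].
  case: s {hq hh hc f0 fE rE mE e lt_p} lt_r wE => p R z0 w /= lt_r wE.
  case: ins lt_r => [cc|cc|cc q|q|||a q|b] //= lt_r.
  rewrite /tape_content /= content_of_rcons; move: wE.
  rewrite /tape_content /tape_head /=.
  case: (@nat_of_ord nregs.+2 i =P nregs.+1) => [-> /=|//]; by case: ifP.
Qed.

Lemma sim_init x : sim x (step (init cm x)) (CState 0 (fun _ => 0) 0%R [::]).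
Proof.
rewrite /step /action /=; split => [//|i|i z] /=.
- by rewrite ffunE /= addr0 /tape_head; do 2?case: ifP.
- rewrite !ffunE /= /tape_content /=.
  have -> : (i == ord0) = (i == 0 :> nat) by [].
  case: (i == 0 :> nat) => /=; first by case: eqP => [->|].
  case: (i == nregs.+1 :> nat) => /=; first by case: eqP => [->|].
  by case: eqP => // _; case: z => //= k; rewrite nth_nil.
Qed.

Lemma step_halted (c : config cm) : halted c -> step c = c.
Proof. by rewrite /halted /step => ->. Qed.

(** The inequality is strict to pay for the step that writes the marks; any time left over is idled
    away in the halted configuration. *)
Lemma cm_computes x t t' R z w :
  iter t (cstep C x) (CState 0 (fun _ => 0) 0%R [::]) = CState (size C) R z w ->
  t < t' -> computes_within cm x w t'.
Proof.
move=> ht lt_t.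
have hs : sim x (iter t.+1 (@step _ _ cm) (init cm x)) (CState (size C) R z w).
  rewrite -ht; elim: t {lt_t ht} => [|t IH]; first exact: sim_init.
  by rewrite iterS [X in sim _ _ X]iterS; exact: sim_step.
have hh : halted (iter t.+1 (@step _ _ cm) (init cm x)).
  by case: hs => hq _ _; rewrite /halted /action hq /= onth_goto onth_default.
rewrite /computes_within.
have -> : iter t' (@step _ _ cm) (init cm x) = iter t.+1 (@step _ _ cm) (init cm x).
  rewrite -(subnK lt_t) iterD; elim: (t' - t.+1) => //= k ->.
  exact: step_halted hh.
split=> // z'; case: hs => _ _ hc; rewrite hc.
by rewrite /tape_content /= eqxx.
Qed.

End Simulation.
End CounterMachine.

(** * A language of bounded sums and its compilation *)

Section Language.
Arguments onth : simpl never.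
Variables (Sigma Delta : finType).

(* An expression has a value and emits a word; [Sum e1 e2] binds a variable
   (de Bruijn index 0 in [e2]) ranging over the numbers below the value of
   [e1].  Values are polynomially bounded by construction. *)
Inductive expr :=
  | Var of nat | Cst of nat | Size | In of option Sigma & expr
  | Plus of expr & expr | Minus of expr & expr | Sum of expr & expr | Out of Delta.

Fixpoint value (e : expr) (x : seq Sigma) (rho : seq nat) : nat :=
  match e with
  | Var i => nth 0 rho i
  | Cst n => n
  | Size => size x
  | In a e => onth x (value e x rho) == a
  | Plus e1 e2 => value e1 x rho + value e2 x rho
  | Minus e1 e2 => value e1 x rho - value e2 x rho
  | Sum e1 e2 => \sum_(i < value e1 x rho) value e2 x (nat_of_ord i :: rho)
  | Out _ => 0
  end.

Fixpoint wrd (e : expr) (x : seq Sigma) (rho : seq nat) : seq Delta :=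
  match e with
  | Var _ | Cst _ | Size => [::]
  | In _ e => wrd e x rho
  | Plus e1 e2 | Minus e1 e2 => wrd e1 x rho ++ wrd e2 x rho
  | Sum e1 e2 => wrd e1 x rho ++
      flatten [seq wrd e2 x (i :: rho) | i <- iota 0 (value e1 x rho)]
  | Out b => [:: b]
  end.

Notation instr := (instr Sigma Delta).
Notation Inc := (Inc Sigma Delta).
Notation Dec := (Dec Sigma Delta).
Notation Jz := (Jz Sigma Delta).
Notation Jmp := (Jmp Sigma Delta).
Notation InRight := (InRight Sigma Delta).
Notation InLeft := (InLeft Sigma Delta).

(** Jumps are absolute, hence the address [p]; the exit [p + size body + 3] lies just behind the
    test, the decrement, the body and the jump back. *)
Definition loop (c : nat) (body : seq instr) (p : nat) : seq instr :=
  Jz c (p + size body + 3) :: Dec c :: body ++ [:: Jmp p].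

Lemma size_loop c body p : size (loop c body p) = size body + 3.
Proof. by rewrite /= size_cat /= !addnS addn0. Qed.

(* [vs] lists the registers of the variables, the value is added to register
   [dst], and the registers from [d] on are scratch, zero before and after;
   [p] is the address of the first instruction. *)
Fixpoint comp (e : expr) (vs : seq nat) (d dst p : nat) : seq instr :=
  match e with
  | Var i =>
    if onth vs i is Some v then
      loop v [:: Inc d; Inc dst] p ++ loop d [:: Inc v] (p + 5)
    else [::]
  | Cst n => nseq n (Inc dst)
  | Size => [:: Jin Delta None (p + 5); Inc dst; Inc d; InRight; Jmp p]
            ++ loop d [:: InLeft] (p + 5)
  | In a e =>
    let c := comp e vs d.+1 d p in
    let q := p + size c in
    c ++ loop d [:: Inc d.+1; InRight] q ++
    [:: Jin Delta a (q + 7); Jmp (q + 8); Inc dst] ++ loop d.+1 [:: InLeft] (q + 8)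
  | Plus e1 e2 =>
    let c := comp e1 vs d dst p in c ++ comp e2 vs d dst (p + size c)
  | Minus e1 e2 =>
    let c1 := comp e1 vs d.+1 d p in
    let q1 := p + size c1 in
    let c2 := comp e2 vs d.+2 d.+1 q1 in
    let q2 := q1 + size c2 in
    c1 ++ c2 ++ loop d.+1 [:: Jz d (q2 + 4); Dec d] q2
       ++ loop d [:: Inc dst] (q2 + 5)
  | Sum e1 e2 =>
    let c1 := comp e1 vs d.+1 d p in
    let q1 := p + size c1 in
    let c2 := comp e2 (d.+1 :: vs) d.+2 dst (q1 + 2) in
    c1 ++ loop d (c2 ++ [:: Inc d.+1]) q1 ++ loop d.+1 [::] (q1 + size c2 + 4)
  | Out b => [:: Emit Sigma b]
  end.

(** Here [m] bounds the input length and all variables. The variable bound by a [Sum] stays below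
    [vbound e1 m], which explains the enlarged bound for the body. *)
Fixpoint vbound (e : expr) (m : nat) : nat :=
  match e with
  | Var _ | Size => m
  | Cst n => n
  | In _ _ => 1
  | Plus e1 e2 => vbound e1 m + vbound e2 m
  | Minus e1 e2 => vbound e1 m
  | Sum e1 e2 => vbound e1 m * vbound e2 (m + vbound e1 m)
  | Out _ => 0
  end.

(** A round of [loop] costs its body plus three instructions. The factor 9 is one pass with five
    instructions per round followed by a restoring pass with four; each pass ends with one more
    test. *)
Fixpoint tbound (e : expr) (m : nat) : nat :=
  match e with
  | Var _ => m * 9 + 2
  | Cst n => n
  | Size => m * 9 + 2
  | In _ e => tbound e m + (vbound e m * 9 + 4)
  | Plus e1 e2 => tbound e1 m + tbound e2 m
  | Minus e1 e2 => tbound e1 m + tbound e2 m + (vbound e2 m * 5 + vbound e1 m * 4 + 2)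
  | Sum e1 e2 => tbound e1 m +
      (vbound e1 m * (tbound e2 (m + vbound e1 m) + 7) + 2)
  | Out _ => 1
  end.

Definition is_poly (f : nat -> nat) : Prop :=
  exists p : {poly nat}, forall m, f m = p.[m]%R.

Lemma is_poly_cst n : is_poly (fun=> n).
Proof. by exists (n%:P)%R => m; rewrite hornerC. Qed.

Lemma is_poly_id : is_poly id.
Proof. by exists 'X%R => m; rewrite hornerX. Qed.

Lemma is_polyD f g : is_poly f -> is_poly g -> is_poly (fun m => f m + g m).
Proof. by move=> [p hp] [q hq]; exists (p + q)%R => m; rewrite hornerD hp hq. Qed.

Lemma is_polyM f g : is_poly f -> is_poly g -> is_poly (fun m => f m * g m).
Proof. by move=> [p hp] [q hq]; exists (p * q)%R => m; rewrite hornerM hp hq. Qed.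

Lemma is_poly_comp f g : is_poly f -> is_poly g -> is_poly (fun m => f (g m)).
Proof. by move=> [p hp] [q hq]; exists (p \Po q)%R => m; rewrite horner_comp hp hq. Qed.

Lemma is_poly_vbound e : is_poly (vbound e).
Proof.
elim: e => [n|n||a e IH|e1 IH1 e2 IH2|e1 IH1 e2 IH2|e1 IH1 e2 IH2|b] //=;
  try exact: is_poly_cst; try exact: is_poly_id; first exact: is_polyD.
by apply: is_polyM => //; apply: is_poly_comp => //; apply: is_polyD => //; exact: is_poly_id.
Qed.

Lemma is_poly_tbound e : is_poly (tbound e).
Proof.
have hv := is_poly_vbound.
elim: e => [n|n||a e IH|e1 IH1 e2 IH2|e1 IH1 e2 IH2|e1 IH1 e2 IH2|b] //=;
  repeat first [exact: is_poly_cst | exact: is_poly_id | exact: hv | by []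
    | apply: is_polyD | apply: is_polyM
    | apply: (@is_poly_comp (tbound e2) (fun m => m + vbound e1 m)) ].
Qed.

Lemma is_poly_mono f : is_poly f -> {homo f : m n / m <= n}.
Proof.
move=> [p hp] m n le_mn; rewrite !hp !horner_coef leq_sum // => i _.
apply: leq_mul => //; rewrite !natrXE.
by case: (nat_of_ord i) => // k; rewrite leq_exp2r.
Qed.

(** * Correctness and running time of the compiled code *)

Fixpoint code_at (C : seq instr) (p : nat) (I : seq instr) : Prop :=
  if I is a :: I' then onth C p = Some a /\ code_at C p.+1 I' else True.

Lemma code_at_cat C p I J :
  code_at C p (I ++ J) <-> code_at C p I /\ code_at C (p + size I) J.
Proof.
elim: I p => [|a I IH] p /=; first by rewrite addn0; split=> [|[]].
by rewrite IH addSnnS; split=> [[? []]|[[]]].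
Qed.

Lemma code_at_self (I J : seq instr) : code_at (J ++ I) (size J) I.
Proof.
elim: I J => [|a I IH] J //=; split; first by rewrite onth_cat ltnn subnn.
by rewrite -cat_rcons -(size_rcons J a); exact: IH.
Qed.

Definition reach C x b (s s' : cstate Delta) : Prop :=
  exists2 t, t <= b & iter t (@cstep Sigma Delta C x) s = s'.

Lemma reach_refl C x b s : reach C x b s s.
Proof. by exists 0. Qed.

Lemma reach_trans C x b1 b2 b s1 s2 s3 :
  reach C x b1 s1 s2 -> reach C x b2 s2 s3 -> b1 + b2 <= b -> reach C x b s1 s3.
Proof.
move=> [t1 h1 e1] [t2 h2 e2] hb; exists (t2 + t1); last by rewrite iterD e1.
by rewrite addnC (leq_trans _ hb) ?leq_add.
Qed.

Lemma reach_step C x b p R z w s2 ins :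
  onth C p = Some ins -> reach C x b (cexec x ins (CState p R z w)) s2 ->
  reach C x b.+1 (CState p R z w) s2.
Proof. by move=> hC [t h e]; exists t.+1 => //; rewrite iterSr /cstep hC. Qed.

Lemma upd_id (R : nat -> nat) c : upd R c (R c) = R.
Proof. by apply: functional_extensionality => i; rewrite /upd; case: eqP => [->|]. Qed.

(** [R i], [z i] and [w i] are the registers, the input head and the output after [i] rounds. The
    body is entered with [c] already decremented, hence the [upd] in its hypothesis. *)
Lemma reach_loop C x c body p n b (R : nat -> nat -> nat) z w :
  code_at C p (loop c body p) ->
  (forall i, i <= n -> R i c = n - i) ->
  (forall i, i < n -> reach C x b
     (CState p.+2 (upd (R i) c (n - i.+1)) (z i) (w i))
     (CState (p + 2 + size body) (R i.+1) (z i.+1) (w i.+1))) ->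
  reach C x (n * (b + 3) + 1) (CState p (R 0) (z 0) (w 0))
        (CState (p + size body + 3) (R n) (z n) (w n)).
Proof.
move=> /= [hJz [hDec /code_at_cat [_ /= [hJmp _]]]] hc hb.
elim: n R z w hc hb => [|n IH] R z w hc hb.
  rewrite mul0n add0n; apply: reach_step hJz _.
  by rewrite /= hc //; exact: reach_refl.
rewrite mulSn -addnA; apply: reach_trans (leqnn _); last first.
  apply: (IH (fun i => R i.+1) (fun i => z i.+1) (fun i => w i.+1)).
    by move=> i hi; rewrite hc.
  by move=> i hi; have := hb i.+1 hi; rewrite subSS.
rewrite addnC; apply: reach_step hJz _; rewrite /= hc // subn0 /=.
apply: reach_step hDec _; rewrite /= hc // subn0 /=.
have h0 := hb 0 (ltn0Sn _); rewrite subn1 /= in h0.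
apply: (reach_trans (b2 := 1) h0); last by rewrite addn1.
apply: (reach_step (b := 0) (ins := Jmp p)); last exact: reach_refl.
by rewrite addn2; exact: hJmp.
Qed.

Lemma map_upd (R : nat -> nat) c v vs :
  c \notin vs -> map (upd R c v) vs = map R vs.
Proof.
by move=> h; apply/eq_in_map => i hi; rewrite /upd; case: eqP hi h => // -> ->.
Qed.

Lemma value_bound e x rho m : size x <= m -> all (leq^~ m) rho ->
  value e x rho <= vbound e m.
Proof.
move=> hx; elim: e rho m hx => [n|n||a e IH|e1 IH1 e2 IH2|e1 IH1 e2 IH2|e1 IH1 e2 IH2|b]
  rho m hx hr //=.
- case: (ltnP n (size rho)) => h; last by rewrite nth_default.
  exact: (allP hr) _ (mem_nth _ h).
- exact: leq_b1.
- by rewrite leq_add ?IH1 ?IH2.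
- by rewrite (leq_trans (leq_subr _ _)) ?IH1.
have h1 := IH1 _ _ hx hr.
apply: (@leq_trans (\sum_(i < value e1 x rho) vbound e2 (m + vbound e1 m))).
  apply: leq_sum => i _; apply: IH2; first exact: leq_trans (leq_addr _ _).
  rewrite /= (leq_trans (ltnW (ltn_ord i))) ?(leq_trans h1) ?leq_addl //=.
  by apply: sub_all hr => j hj; exact: leq_trans (leq_addr _ _).
by rewrite sum_nat_const card_ord leq_mul2r h1 orbT.
Qed.

Lemma reach_to C x b s p R z w p' R' z' w' :
  reach C x b s (CState p R z w) -> p = p' -> R =1 R' -> z = z' -> w = w' ->
  reach C x b s (CState p' R' z' w').
Proof. by move=> h <- /functional_extensionality <- <- <-. Qed.

Lemma code_at_body C c body p :
  code_at C p (loop c body p) -> code_at C p.+2 body.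
Proof. by move=> /= [_ [_ /code_at_cat []]]. Qed.

Lemma reach_loopE C x c body p n b (R : nat -> nat -> nat) z w R0 z0 w0 q R1 z1 w1 :
  code_at C p (loop c body p) ->
  (forall i, i <= n -> R i c = n - i) ->
  (forall i, i < n -> reach C x b
     (CState p.+2 (upd (R i) c (n - i.+1)) (z i) (w i))
     (CState (p + 2 + size body) (R i.+1) (z i.+1) (w i.+1))) ->
  R 0 =1 R0 -> R n =1 R1 -> z 0 = z0 -> z n = z1 -> w 0 = w0 -> w n = w1 ->
  p + size body + 3 = q ->
  reach C x (n * (b + 3) + 1) (CState p R0 z0 w0) (CState q R1 z1 w1).
Proof.
move=> h1 h2 h3 /functional_extensionality <- /functional_extensionality <-.
by move=> <- <- <- <- <-; exact: (reach_loop h1 h2 h3).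
Qed.

Opaque loop.

Ltac updE := move=> j; rewrite /upd; repeat (case: eqP => ?); subst; lia.

(** Three conventions make the statement inductive: the input head comes back to cell 0, scratch
    registers come back to 0, and the value is added to [dst] instead of replacing it. The last one
    lets the body of a [Sum] accumulate directly into the register of the sum. *)
Lemma comp_ok e C x m vs d dst p R w :
  code_at C p (comp e vs d dst p) -> all (ltn^~ d) vs -> dst < d ->
  dst \notin vs -> (forall c, d <= c -> R c = 0) ->
  size x <= m -> all (leq^~ m) (map R vs) ->
  reach C x (tbound e m) (CState p R 0%R w)
    (CState (p + size (comp e vs d dst p))
       (upd R dst (R dst + value e x (map R vs))) 0%R (w ++ wrd e x (map R vs))).
Proof.
elim: e m vs d dst p R w => [n|n||a e IH|e1 IH1 e2 IH2|e1 IH1 e2 IH2|e1 IH1 e2 IH2|b]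
  m vs d dst p R w hC hvs hd hdst hR hx hm.
- rewrite /= cats0 in hC *; case e: (onth vs n) hC => [v|] hC; last first.
    rewrite nth_default ?addn0 ?upd_id; first exact: reach_refl.
    by rewrite size_map leqNgt -onthTE e.
  have hv : v \in vs by apply/onthP; exists n.
  have ltv : v < d by exact: (allP hvs).
  have nev : v <> dst by move=> ev; rewrite -ev hv in hdst.
  have -> : nth 0 (map R vs) n = R v.
    by rewrite -odflt_onth onth_map e.
  have lem : R v <= m by apply: (allP hm); exact: map_f.
  have Rd : R d = 0 by exact: hR.
  rewrite size_cat !size_loop /=; case/code_at_cat: hC => h1 h2.
  rewrite size_loop /= in h2.
  (* Reading a register destroys it: this loop drains [v] into both [d] and [dst], and the next one
     refills [v] from [d]. *)
  have b1 : reach C x (R v * (2 + 3) + 1) (CState p R 0%R w) (CState (p + 2 + 3)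
      (upd (upd (upd R v 0) d (R v)) dst (R dst + R v)) 0%R w).
    pose Rf i := upd (upd (upd R v (R v - i)) d i) dst (R dst + i).
    apply: (reach_loopE (n := R v) (R := Rf) (z := fun=> 0%R)
      (w := fun=> w) h1) => //.
    + by move=> i hi; rewrite /Rf /upd; do ?case: eqP => //; lia.
    + move=> i hi; case: (code_at_body h1) => [i1 [i2 _]].
      apply: reach_step i1 _; apply: reach_step i2 _.
      apply: reach_to (reach_refl _ _ _ _) _ _ _ _ => //=; first lia.
      rewrite /Rf; updE.
    + rewrite /Rf; updE.
    + rewrite /Rf; updE.
  have b2 : reach C x (R v * (1 + 3) + 1)
      (CState (p + 5) (upd (upd (upd R v 0) d (R v)) dst (R dst + R v)) 0%R w)
      (CState (p + 5 + 1 + 3) (upd R dst (R dst + R v)) 0%R w).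
    pose Rf i := upd (upd (upd R v i) d (R v - i)) dst (R dst + R v).
    apply: (reach_loopE (n := R v) (R := Rf) (z := fun=> 0%R)
      (w := fun=> w) h2) => //.
    + by move=> i hi; rewrite /Rf /upd; do ?case: eqP => //; lia.
    + move=> i hi; case: (code_at_body h2) => [i1 _].
      apply: reach_step i1 _.
      apply: reach_to (reach_refl _ _ _ _) _ _ _ _ => //=; first lia.
      rewrite /Rf; updE.
    + rewrite /Rf; updE.
    + rewrite /Rf; updE.
  apply: reach_trans (reach_to b1 _ _ _ _) (reach_to b2 _ _ _ _) _ => //; lia.
- rewrite /= cats0 size_nseq in hC *; elim: n p R hC {hR hm} => [|n IH] p R hC /=.
    by rewrite !addn0 upd_id; exact: reach_refl.
  case: hC => i1 hC; apply: reach_step i1 _ => /=.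
  apply: reach_to (IH _ _ hC) _ _ _ _ => //; first lia.
  updE.
- rewrite /= cats0 in hC *; case: hC => [i1 [i2 [i3 [i4 [i5 h2]]]]].
  rewrite [p.+4.+1](_ : _ = p + 5) in h2; last lia.
  have Rd : R d = 0 by exact: hR.
  (* Induction on the number [k] of unread letters, with [y] the part already read. The second
     count, kept in [d], later brings the head home. *)
  have b1 k y : x = y ++ drop (size y) x -> size x = size y + k ->
     reach C x (k * 5 + 1)
      (CState p (upd (upd R dst (R dst + size y)) d (size y)) (Posz (size y)) w)
      (CState (p + 5) (upd (upd R dst (R dst + size x)) d (size x)) (Posz (size x)) w).
    elim: k y => [|k IHk] y ey sz.
      rewrite mul0n; apply: reach_step i1 _; rewrite /= sz addn0 onth_default ?sz ?addn0 //=.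
      exact: reach_refl.
    have : size (drop (size y) x) = k.+1 by rewrite size_drop sz addKn.
    case ed: (drop (size y) x) => [|a t] // [st].
    rewrite ed in ey.
    have rd : onth x (size y) = Some a by rewrite ey onth_cat ltnn subnn.
    apply: reach_step i1 _; rewrite /= rd /=.
    apply: reach_step i2 _; apply: reach_step i3 _; apply: reach_step i4 _.
    apply: reach_step i5 _ => /=.
    have := IHk (rcons y a); rewrite size_rcons => h.
    have e2 : upd (upd R dst (R dst + (size y).+1)) d (size y).+1 =
      upd (upd (upd (upd R dst (R dst + size y)) d (size y)) dst
        (upd (upd R dst (R dst + size y)) d (size y) dst).+1) d
        (upd (upd (upd R dst (R dst + size y)) d (size y)) dst
        (upd (upd R dst (R dst + size y)) d (size y) dst).+1 d).+1.
      by apply: functional_extensionality; updE.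
    rewrite -e2 (_ : (Posz (size y) + 1)%R = Posz (size y).+1); last lia.
    apply: h; last lia.
    rewrite [X in drop _ X]ey -[X in drop _ X]cat_rcons drop_size_cat ?size_rcons //.
    by rewrite cat_rcons.
  have b2 : reach C x (size x * (1 + 3) + 1)
      (CState (p + 5) (upd (upd R dst (R dst + size x)) d (size x)) (Posz (size x)) w)
      (CState (p + 5 + 1 + 3) (upd R dst (R dst + size x)) 0%R w).
    pose Rf i := upd (upd R dst (R dst + size x)) d (size x - i).
    apply: (reach_loopE (n := size x) (R := Rf) (z := fun i => (Posz (size x) - Posz i)%R)
      (w := fun=> w) h2) => //.
    + by move=> i hi; rewrite /Rf /upd; do ?case: eqP => //; lia.
    + move=> i hi; case: (code_at_body h2) => [j1 _].
      apply: reach_step j1 _.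
      apply: reach_to (reach_refl _ _ _ _) _ _ _ _ => //=; try lia.
      rewrite /Rf; updE.
    + rewrite /Rf; updE.
    + rewrite /Rf; updE.
    + lia.
    + lia.
  have b0 := b1 (size x) [::] (esym (drop0 _)) erefl.
  rewrite /= addn0 upd_id -Rd upd_id Rd in b0.
  apply: reach_trans b0 (reach_to b2 _ _ _ _) _ => //; rewrite ?size_loop /=; lia.
- rewrite /= in hC *.
  set c := comp e vs d.+1 d p in hC *; set v := value e x _.
  set q := p + size c in hC *.
  case/code_at_cat: hC => h0 /code_at_cat [h1]; rewrite size_loop /=.
  case=> [i1 [i2 [i3 h2]]].
  rewrite [(_ + _).+3](_ : _ = q + 8) in h2; last lia.
  have Rd : R d = 0 by exact: hR.
  have Rd1 : R d.+1 = 0 by exact/hR/leqnSn.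
  have hvs1 : all (ltn^~ d.+1) vs by apply: sub_all hvs => j; exact: ltnW.
  have ndv : d \notin vs by apply/negP => /(allP hvs); rewrite /= ltnn.
  have b0 := IH m vs d.+1 d p R w h0 hvs1 (ltnSn _) ndv (fun c hc => hR c (ltnW hc)) hx hm.
  rewrite -/c -/q -/v Rd add0n in b0; set w' := w ++ _ in b0 *.
  have lev : v <= vbound e m by exact: value_bound.
  (* While [d] drives the head to cell [v], [d.+1] records the way back. *)
  have b1 : reach C x (v * (2 + 3) + 1) (CState q (upd R d v) 0%R w')
      (CState (q + 5) (upd R d.+1 v) (Posz v) w').
    pose Rf i := upd (upd R d (v - i)) d.+1 i.
    apply: (reach_loopE (n := v) (R := Rf) (z := Posz) (w := fun=> w') h1) => //.
    + by move=> i hi; rewrite /Rf /upd; do ?case: eqP => //; lia.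
    + move=> i hi; case: (code_at_body h1) => [j1 [j2 _]].
      apply: reach_step j1 _; apply: reach_step j2 _.
      apply: reach_to (reach_refl _ _ _ _) _ _ _ _ => //=; try lia.
      rewrite /Rf; updE.
    + rewrite /Rf; updE.
    + rewrite /Rf; updE.
    + rewrite /=; lia.
  have b2 : reach C x 2 (CState (q + 5) (upd R d.+1 v) (Posz v) w')
      (CState (q + 8) (upd (upd R d.+1 v) dst (R dst + (onth x v == a))) (Posz v) w').
    apply: reach_step i1 _ => /=; case: (onth x v == a).
      rewrite [q + 7](_ : _ = (q + 5).+2); last lia.
      apply: reach_step i3 _; apply: reach_to (reach_refl _ _ _ _) _ _ _ _ => //=; first lia.
      updE.
    apply: reach_step i2 _; apply: reach_to (reach_refl _ _ _ _) _ _ _ _ => //=.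
    updE.
  have b3 : reach C x (v * (1 + 3) + 1)
      (CState (q + 8) (upd (upd R d.+1 v) dst (R dst + (onth x v == a))) (Posz v) w')
      (CState (q + 12) (upd R dst (R dst + (onth x v == a))) 0%R w').
    pose Rf i := upd (upd R dst (R dst + (onth x v == a))) d.+1 (v - i).
    apply: (reach_loopE (n := v) (R := Rf) (z := fun i => (Posz v - Posz i)%R)
      (w := fun=> w') h2) => //.
    + by move=> i hi; rewrite /Rf /upd; do ?case: eqP => //; lia.
    + move=> i hi; case: (code_at_body h2) => [j1 _].
      apply: reach_step j1 _.
      apply: reach_to (reach_refl _ _ _ _) _ _ _ _ => //=; try lia.
      rewrite /Rf; updE.
    + rewrite /Rf; updE.
    + rewrite /Rf; updE.
    + lia.
    + lia.
    + rewrite /=; lia.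
  apply: reach_trans b0 (reach_trans b1 (reach_trans b2 (reach_to b3 _ _ _ _) (leqnn _)) (leqnn _)) _ => //.
    by rewrite /q !size_cat /= !size_loop /=; lia.
  by lia.
- rewrite /= in hC *; case/code_at_cat: hC => h1 h2.
  have b1 := IH1 _ _ _ _ _ _ w h1 hvs hd hdst hR hx hm.
  have hm2 : map (upd R dst (R dst + value e1 x (map R vs))) vs = map R vs by exact: map_upd.
  have hR2 c : d <= c -> upd R dst (R dst + value e1 x (map R vs)) c = 0.
    by move=> hc; rewrite /upd; case: eqP => [ec|_]; [lia|exact: hR].
  have := IH2 m _ _ _ _ _ (w ++ wrd e1 x (map R vs)) h2 hvs hd hdst hR2 hx.
  rewrite hm2 => /(_ hm) b2.
  apply: reach_trans b1 (reach_to b2 _ _ _ _) (leqnn _) => //.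
  + by rewrite size_cat addnA.
  + updE.
  + by rewrite catA.
- rewrite /= in hC *.
  set c1 := comp e1 vs d.+1 d p in hC *; set q1 := p + size c1 in hC *.
  set c2 := comp e2 vs d.+2 d.+1 q1 in hC *; set q2 := q1 + size c2 in hC *.
  set v1 := value e1 x _; set v2 := value e2 x _.
  case/code_at_cat: hC => h1 /code_at_cat [h2 /code_at_cat [h3]].
  rewrite size_loop /= -/q1 -/q2 => h4.
  have Rd : R d = 0 by exact: hR.
  have Rd1 : R d.+1 = 0 by exact/hR/leqnSn.
  have hvs1 : all (ltn^~ d.+1) vs by apply: sub_all hvs => j; exact: ltnW.
  have hvs2 : all (ltn^~ d.+2) vs by apply: sub_all hvs1 => j; exact: ltnW.
  have ndv : d \notin vs by apply/negP => /(allP hvs); rewrite /= ltnn.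
  have ndv1 : d.+1 \notin vs by apply/negP => /(allP hvs1); rewrite /= ltnn.
  have b1 := IH1 m vs d.+1 d p R w h1 hvs1 (ltnSn _) ndv (fun c hc => hR c (ltnW hc)) hx hm.
  rewrite -/c1 -/q1 -/v1 Rd add0n in b1; set w1 := w ++ _ in b1.
  have hR2 c : d.+2 <= c -> upd R d v1 c = 0.
    by move=> hc; rewrite /upd; case: eqP => [ec|_]; [lia|apply: hR; lia].
  have hm2 : map (upd R d v1) vs = map R vs by exact: map_upd.
  have := IH2 m vs d.+2 d.+1 q1 (upd R d v1) w1 h2 hvs2 (ltnSn _) ndv1 hR2 hx.
  rewrite hm2 => /(_ hm) b2; rewrite -/c2 -/q2 -/v2 in b2.
  have lev1 : v1 <= vbound e1 m by exact: value_bound.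
  have lev2 : v2 <= vbound e2 m by exact: value_bound.
  set w2 := w1 ++ _ in b2.
  (* Truncated subtraction: each unit of [d.+1] removes one from [d], and is skipped once [d] is
     zero. *)
  have b3 : reach C x (v2 * (2 + 3) + 1)
      (CState q2 (upd (upd R d v1) d.+1 v2) 0%R w2)
      (CState (q2 + 5) (upd R d (v1 - v2)) 0%R w2).
    pose Rf i := upd (upd R d (v1 - i)) d.+1 (v2 - i).
    apply: (reach_loopE (n := v2) (R := Rf) (z := fun=> 0%R) (w := fun=> w2) h3) => //.
    + by move=> i hi; rewrite /Rf /upd; do ?case: eqP => //; lia.
    + move=> i hi; case: (code_at_body h3) => [j1 [j2 _]].
      apply: reach_step j1 _ => /=; case: eqP => [|_].
        rewrite /Rf /upd /= eqxx ltn_eqF // => e0.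
        apply: reach_to (reach_refl _ _ _ _) _ _ _ _ => //=; try lia.
        updE.
      apply: reach_step j2 _; apply: reach_to (reach_refl _ _ _ _) _ _ _ _ => //=; try lia.
      rewrite /Rf; updE.
    + rewrite /Rf; updE.
    + rewrite /Rf; updE.
    + rewrite /=; lia.
  have b4 : reach C x ((v1 - v2) * (1 + 3) + 1)
      (CState (q2 + 5) (upd R d (v1 - v2)) 0%R w2)
      (CState (q2 + 9) (upd R dst (R dst + (v1 - v2))) 0%R w2).
    pose Rf i := upd (upd R dst (R dst + i)) d (v1 - v2 - i).
    apply: (reach_loopE (n := v1 - v2) (R := Rf) (z := fun=> 0%R) (w := fun=> w2) h4) => //.
    + by move=> i hi; rewrite /Rf /upd; do ?case: eqP => //; lia.
    + move=> i hi; case: (code_at_body h4) => [j1 _].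
      apply: reach_step j1 _.
      apply: reach_to (reach_refl _ _ _ _) _ _ _ _ => //=; try lia.
      rewrite /Rf; updE.
    + rewrite /Rf; updE.
    + rewrite /Rf; updE.
    + rewrite /=; lia.
  apply: reach_trans b1 (reach_trans (reach_to b2 _ _ _ _)
     (reach_trans b3 (reach_to b4 _ _ _ _) (leqnn _)) (leqnn _)) _ => //.
  + updE.
  + by rewrite !size_cat !size_loop /= /q2 /q1; lia.
  + by rewrite /w2 /w1 catA.
  + by lia.
- rewrite /= in hC *.
  set c1 := comp e1 vs d.+1 d p in hC *; set q1 := p + size c1 in hC *.
  set c2 := comp e2 _ _ _ _ in hC *; set rho := map R vs.
  set v1 := value e1 x _.
  case/code_at_cat: hC => h1 /code_at_cat [h2]; rewrite size_loop size_cat /= -/q1.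
  rewrite [q1 + _](_ : _ = q1 + size c2 + 4); last lia.
  move=> h3; have h2' := h2; move/code_at_body/code_at_cat: h2' => [hb [j1 _]].
  have Rd : R d = 0 by exact: hR.
  have Rd1 : R d.+1 = 0 by exact/hR/leqnSn.
  have hvs1 : all (ltn^~ d.+1) vs by apply: sub_all hvs => j; exact: ltnW.
  have hvs2 : all (ltn^~ d.+2) vs by apply: sub_all hvs1 => j; exact: ltnW.
  have ndv : d \notin vs by apply/negP => /(allP hvs); rewrite /= ltnn.
  have ndv1 : d.+1 \notin vs by apply/negP => /(allP hvs1); rewrite /= ltnn.
  have b1 := IH1 m vs d.+1 d p R w h1 hvs1 (ltnSn _) ndv (fun c hc => hR c (ltnW hc)) hx hm.
  rewrite -/c1 -/q1 -/rho -/v1 Rd add0n in b1; set w1 := w ++ _ in b1.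
  have lev1 : v1 <= vbound e1 m by exact: value_bound.
  set m2 := m + vbound e1 m.
  (* [V i] and [W i] are the partial sum and the output after [i] rounds. Register [d] counts the
     rounds down, while [d.+1] counts them up and serves as the bound variable. *)
  pose V i := \sum_(j < i) value e2 x (nat_of_ord j :: rho).
  pose W i := w1 ++ flatten [seq wrd e2 x (j :: rho) | j <- iota 0 i].
  have b2 : reach C x (v1 * (tbound e2 m2 + 1 + 3) + 1) (CState q1 (upd R d v1) 0%R w1)
      (CState (q1 + size c2 + 4) (upd (upd R d.+1 v1) dst (R dst + V v1)) 0%R (W v1)).
    pose Rf i := upd (upd (upd R d (v1 - i)) d.+1 i) dst (R dst + V i).
    apply: (reach_loopE (n := v1) (R := Rf) (z := fun=> 0%R) (w := W) h2) => //.
    + by move=> i hi; rewrite /Rf /upd; do ?case: eqP => //; lia.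
    + move=> i hi; rewrite size_cat /=.
      set R' := upd _ _ _.
      have hm' : map R' (d.+1 :: vs) = i :: rho.
        rewrite /= /R' /Rf !map_upd //; congr (_ :: _); rewrite /upd.
        by do ?case: eqP => //; lia.
      have hR' c : d.+2 <= c -> R' c = 0.
        move=> hc; rewrite /R' /Rf /upd; do ?(case: eqP => [?|_]; first lia).
        by apply: hR; lia.
      have hd2 : dst < d.+2 by lia.
      have := IH2 m2 (d.+1 :: vs) d.+2 dst (q1 + 2) R' (W i) _ _ hd2 _ hR'.
      rewrite -/c2 hm' => H.
      apply: (reach_trans (b2 := 1)); last exact: leqnn.
        rewrite -addn2; apply: H.
        * by rewrite addn2.
        * by rewrite /= leqnn.
        * by rewrite inE negb_or hdst andbT; lia.
        * by rewrite /m2; lia.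
        * rewrite /= /m2; apply/andP; split; first lia.
          by apply: sub_all hm => k hk; rewrite (leq_trans hk) ?leq_addr.
      apply: reach_step; first by rewrite addn2; exact: j1.
      apply: reach_to (reach_refl _ _ _ _) _ _ _ _ => //=; first lia.
      * have VS : V i.+1 = V i + value e2 x (i :: rho) by rewrite /V big_ord_recr.
        rewrite /R' /Rf VS; updE.
      * by rewrite /W -addn1 iotaD map_cat flatten_cat /= cats0 catA.
    + rewrite /Rf /V; move=> j; rewrite big_ord0; move: j; updE.
    + rewrite /Rf; updE.
    + by rewrite /W /= cats0.
    + rewrite size_cat /=; lia.
  have b3 : reach C x (v1 * (0 + 3) + 1)
      (CState (q1 + size c2 + 4) (upd (upd R d.+1 v1) dst (R dst + V v1)) 0%R (W v1))
      (CState (q1 + size c2 + 4 + 0 + 3) (upd R dst (R dst + V v1)) 0%R (W v1)).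
    pose Rf i := upd (upd R d.+1 (v1 - i)) dst (R dst + V v1).
    apply: (reach_loopE (n := v1) (R := Rf) (z := fun=> 0%R) (w := fun=> W v1) h3) => //.
    + by move=> i hi; rewrite /Rf /upd; do ?case: eqP => //; lia.
    + move=> i hi.
      apply: reach_to (reach_refl _ _ _ _) _ _ _ _ => //=; first lia.
      rewrite /Rf; updE.
    + rewrite /Rf; updE.
    + rewrite /Rf; updE.
  apply: reach_trans b1 (reach_trans b2 (reach_to b3 _ _ _ _) (leqnn _)) _ => //.
  + by rewrite !size_cat !size_loop size_cat /= /q1; lia.
  + by rewrite /W /w1 catA.
  + have : v1 * (tbound e2 m2 + 7) <= vbound e1 m * (tbound e2 m2 + 7).
      by rewrite leq_mul2r lev1 orbT.
    by rewrite -/m2; lia.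
- rewrite /= in hC *; case: hC => i1 _; apply: reach_step i1 _.
  apply: reach_to (reach_refl _ _ _ _) _ _ _ _ => //=; first lia.
    by move=> j; rewrite addn0 upd_id.
  by rewrite cats1.
Qed.

Transparent loop.

Theorem polytime_wrd (e : expr) : polytime (fun x => wrd e x [::]).
Proof.
have [p hp] := is_poly_tbound e.
pose C := comp e [::] 1 0 0.
exists (cm C), (p + 1)%R => x.
have hC : code_at C 0 C by exact: (code_at_self C [::]).
have [t le_t ht] : reach C x (tbound e (size x)) (CState 0 (fun=> 0) 0%R [::])
  (CState (0 + size C) (upd (fun=> 0) 0 (0 + value e x [::])) 0%R (wrd e x [::])).
  by apply: (@comp_ok e C x (size x) [::] 1 0 0 (fun=> 0) [::] hC).
apply: cm_computes ht _.
by rewrite hornerD hornerC -hp -[(_ + _)%R]/(_ + _) addn1 ltnS.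
Qed.

End Language.

(** * Definable numbers, predicates and words *)

Definition nsum (n : nat) (f : nat -> nat) : nat := \sum_(i < n) f i.
Definition ball (n : nat) (P : nat -> bool) : bool := all P (iota 0 n).
Definition bex (n : nat) (P : nat -> bool) : bool := has P (iota 0 n).
Definition nflat (T : Type) (n : nat) (W : nat -> seq T) : seq T :=
  flatten [seq W i | i <- iota 0 n].

Lemma nsumS n f : nsum n.+1 f = nsum n f + f n.
Proof. by rewrite /nsum big_ord_recr. Qed.

Lemma nsum0 f : nsum 0 f = 0.
Proof. exact: big_ord0. Qed.

Lemma eq_nsum n f g : (forall i, i < n -> f i = g i) -> nsum n f = nsum n g.
Proof. by move=> h; apply: eq_bigr => i _; exact: h. Qed.

Lemma ballP n (P : nat -> bool) : reflect (forall i, i < n -> P i) (ball n P).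
Proof.
by apply: (iffP allP) => h i; [move=> hi|rewrite mem_iota => hi];
  apply: h; rewrite ?mem_iota.
Qed.

Lemma bexP n (P : nat -> bool) : reflect (exists2 i, i < n & P i) (bex n P).
Proof.
by apply: (iffP hasP) => -[i hi hP]; exists i => //; rewrite mem_iota in hi *.
Qed.

Lemma ball_nsum n P : ball n P = (nsum n (fun i => ~~ P i) == 0).
Proof.
rewrite /nsum sum_nat_eq0; apply/ballP/forallP => /= h i.
  by rewrite h.
by move=> hi; have := h (Ordinal hi); rewrite eqb0 negbK.
Qed.

Section Closure.
Variable Sigma : finType.
Implicit Types (F G : seq Sigma -> seq nat -> nat).
Implicit Types (A B : seq Sigma -> seq nat -> bool).

(** With output alphabet [void] the expression emits nothing, so after a change of alphabet it can
    serve as a bound or a test inside any emitting expression without disturbing the word. *)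
Definition cnat F : Prop :=
  exists e : expr Sigma void, forall x r, value e x r = F x r.
Definition cbool B : Prop := cnat (fun x r => B x r : nat).
Definition cword (Delta : finType) (W : seq Sigma -> seq nat -> seq Delta) : Prop :=
  exists e : expr Sigma Delta, forall x r, wrd e x r = W x r.

Lemma cnat_ext F G : F =2 G -> cnat F -> cnat G.
Proof. by move=> h [e he]; exists e => x r; rewrite he. Qed.

Lemma cbool_ext A B : A =2 B -> cbool A -> cbool B.
Proof. by move=> h; apply: cnat_ext => x r; rewrite h. Qed.

(** Weakening for de Bruijn indices: the renamed expression ignores entry [k] of the environment. *)
Fixpoint ren D (k : nat) (e : expr Sigma D) : expr Sigma D :=
  match e with
  | Var i => Var _ _ (if i < k then i else i.+1)
  | Cst n => Cst _ _ n
  | Size => Size _ _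
  | In a e => In a (ren k e)
  | Plus e1 e2 => Plus (ren k e1) (ren k e2)
  | Minus e1 e2 => Minus (ren k e1) (ren k e2)
  | Sum e1 e2 => Sum (ren k e1) (ren k.+1 e2)
  | Out b => Out _ b
  end.

Lemma value_ren D k (e : expr Sigma D) x r :
  value (ren k e) x r = value e x (take k r ++ drop k.+1 r).
Proof.
elim: e k r => [i|n||a e IH|e1 IH1 e2 IH2|e1 IH1 e2 IH2|e1 IH1 e2 IH2|b] k r //=;
  rewrite ?IH ?IH1 ?IH2 //.
  rewrite nth_cat size_take nth_drop.
  case: (ltnP i k) => hi; case: (ltnP k (size r)) => hk.
  - by rewrite hi nth_take.
  - case: ltnP => h; first by rewrite nth_take.
    by rewrite !nth_default //; lia.
  - by rewrite ltnNge hi /=; congr nth; lia.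
  - by rewrite ltnNge (leq_trans hk hi) /= !nth_default //; lia.
by apply: eq_bigr => i _; rewrite IH2.
Qed.

Lemma wrd_ren D k (e : expr Sigma D) x r :
  wrd (ren k e) x r = wrd e x (take k r ++ drop k.+1 r).
Proof.
elim: e k r => [i|n||a e IH|e1 IH1 e2 IH2|e1 IH1 e2 IH2|e1 IH1 e2 IH2|b] k r //=;
  rewrite ?IH ?IH1 ?IH2 //.
by rewrite value_ren; congr (_ ++ flatten _); apply: eq_map => i; rewrite IH2.
Qed.

Fixpoint recast (D D' : finType) (f : D -> expr Sigma D') (e : expr Sigma D) : expr Sigma D' :=
  match e with
  | Var i => Var _ _ i
  | Cst n => Cst _ _ n
  | Size => Size _ _
  | In a e => In a (recast f e)
  | Plus e1 e2 => Plus (recast f e1) (recast f e2)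
  | Minus e1 e2 => Minus (recast f e1) (recast f e2)
  | Sum e1 e2 => Sum (recast f e1) (recast f e2)
  | Out b => f b
  end.

Lemma value_recast (D D' : finType) (f : D -> expr Sigma D') e x r :
  (forall b x r, value (f b) x r = 0) -> value (recast f e) x r = value e x r.
Proof.
move=> h; elim: e r => [i|n||a e IH|e1 IH1 e2 IH2|e1 IH1 e2 IH2|e1 IH1 e2 IH2|b] r //=;
  rewrite ?IH ?IH1 ?IH2 //.
by apply: eq_bigr => i _.
Qed.

Lemma wrd_recast_void (D' : finType) (f : void -> expr Sigma D') e x r :
  wrd (recast f e) x r = [::].
Proof.
elim: e r => [i|n||a e IH|e1 IH1 e2 IH2|e1 IH1 e2 IH2|e1 IH1 e2 IH2|[]] r //=;
  rewrite ?IH1 ?IH2 //.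
by elim: (iota _ _) => //= i s ->; rewrite IH2.
Qed.

Lemma cnat_value D (e : expr Sigma D) : cnat (value e).
Proof. by exists (recast (fun=> Cst _ _ 0) e) => x r; rewrite value_recast. Qed.

Lemma cnat_pure D F : cnat F -> exists e : expr Sigma D,
  forall x r, value e x r = F x r /\ wrd e x r = [::].
Proof.
move=> [e he]; exists (recast (of_void _) e) => x r.
by rewrite wrd_recast_void value_recast //; case.
Qed.

Lemma cnat_ren k F : cnat F -> cnat (fun x r => F x (take k r ++ drop k.+1 r)).
Proof. by move=> [e he]; exists (ren k e) => x r; rewrite value_ren. Qed.

Lemma cnat_lift F : cnat F -> cnat (fun x r => F x (behead r)).
Proof. by move/(cnat_ren 0); apply: cnat_ext => x r; rewrite take0 drop1. Qed.

Lemma cnat_nth i : cnat (fun x r => nth 0 r i).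
Proof. by exists (Var _ _ i). Qed.

Lemma cnat_cst n : cnat (fun x r => n).
Proof. by exists (Cst _ _ n). Qed.

Lemma cnat_size : cnat (fun x r => size x).
Proof. by exists (Size _ _). Qed.

Lemma cnat_add F G : cnat F -> cnat G -> cnat (fun x r => F x r + G x r).
Proof. by move=> [e he] [f hf]; exists (Plus e f) => x r /=; rewrite he hf. Qed.

Lemma cnat_sub F G : cnat F -> cnat G -> cnat (fun x r => F x r - G x r).
Proof. by move=> [e he] [f hf]; exists (Minus e f) => x r /=; rewrite he hf. Qed.

Lemma cnat_succ F : cnat F -> cnat (fun x r => (F x r).+1).
Proof.
by move=> h; apply: cnat_ext (cnat_add h (cnat_cst 1)) => x r; rewrite addn1.
Qed.

Lemma cnat_sum F (G : seq Sigma -> seq nat -> nat -> nat) :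
  cnat F -> cnat (fun x r => G x (behead r) (nth 0 r 0)) ->
  cnat (fun x r => nsum (F x r) (G x r)).
Proof.
move=> [e he] [f hf]; exists (Sum e f) => x r /=; rewrite he.
by apply: eq_bigr => i _; rewrite hf.
Qed.

Lemma cnat_mul F G : cnat F -> cnat G -> cnat (fun x r => F x r * G x r).
Proof.
move=> hF hG; have := cnat_sum (G := fun x r _ => G x r) hF (cnat_lift hG).
by apply: cnat_ext => x r; rewrite /nsum sum_nat_const card_ord.
Qed.

Lemma cbool_in a F : cnat F -> cbool (fun x r => onth x (F x r) == a).
Proof. by move=> [e he]; exists (In a e) => x r /=; rewrite he. Qed.

Lemma cbool_cst b : cbool (fun x r => b).
Proof. exact: cnat_cst. Qed.

Lemma cbool_neg B : cbool B -> cbool (fun x r => ~~ B x r).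
Proof.
by move=> h; apply: cnat_ext (cnat_sub (cnat_cst 1) h) => x r; case: (B x r).
Qed.

Lemma cbool_and A B : cbool A -> cbool B -> cbool (fun x r => A x r && B x r).
Proof.
by move=> hA hB; apply: cnat_ext (cnat_mul hA hB) => x r; rewrite mulnb.
Qed.

Lemma cbool_or A B : cbool A -> cbool B -> cbool (fun x r => A x r || B x r).
Proof.
move=> hA hB; apply: cbool_ext (cbool_neg (cbool_and (cbool_neg hA) (cbool_neg hB))).
by move=> x r; rewrite negb_and !negbK.
Qed.

Lemma cbool_imp A B : cbool A -> cbool B -> cbool (fun x r => A x r ==> B x r).
Proof.
move=> hA hB; apply: cbool_ext (cbool_or (cbool_neg hA) hB) => x r.
by rewrite implybE.
Qed.

Lemma cbool_leq F G : cnat F -> cnat G -> cbool (fun x r => F x r <= G x r).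
Proof.
move=> hF hG; apply: cnat_ext (cnat_sub (cnat_cst 1) (cnat_sub hF hG)) => x r.
by rewrite /leq; case: (F x r - G x r).
Qed.

Lemma cbool_eq F G : cnat F -> cnat G -> cbool (fun x r => F x r == G x r).
Proof.
move=> hF hG; apply: cbool_ext (cbool_and (cbool_leq hF hG) (cbool_leq hG hF)).
by move=> x r; rewrite eqn_leq.
Qed.

Lemma cnat_if B F G : cbool B -> cnat F -> cnat G ->
  cnat (fun x r => if B x r then F x r else G x r).
Proof.
move=> hB hF hG.
apply: cnat_ext (cnat_add (cnat_mul hB hF) (cnat_mul (cbool_neg hB) hG)) => x r.
by case: (B x r); rewrite /= ?mul1n ?mul0n ?addn0.
Qed.

Lemma cbool_if B A1 A2 : cbool B -> cbool A1 -> cbool A2 ->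
  cbool (fun x r => if B x r then A1 x r else A2 x r).
Proof.
by move=> hB h1 h2; apply: cnat_ext (cnat_if hB h1 h2) => x r; case: (B x r).
Qed.

Lemma cbool_ball F (P : seq Sigma -> seq nat -> nat -> bool) :
  cnat F -> cbool (fun x r => P x (behead r) (nth 0 r 0)) ->
  cbool (fun x r => ball (F x r) (P x r)).
Proof.
move=> hF hP.
have h := cnat_sum (G := fun x r i => ~~ P x r i) hF (cbool_neg hP).
apply: cbool_ext (cbool_eq h (cnat_cst 0)) => x r; by rewrite ball_nsum.
Qed.

Lemma cbool_bex F (P : seq Sigma -> seq nat -> nat -> bool) :
  cnat F -> cbool (fun x r => P x (behead r) (nth 0 r 0)) ->
  cbool (fun x r => bex (F x r) (P x r)).
Proof.
move=> hF hP.
have h := cbool_ball (P := fun x r i => ~~ P x r i) hF (cbool_neg hP).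
apply: cbool_ext (cbool_neg h) => x r; rewrite /ball /bex -has_predC.
by apply: eq_has => i /=; rewrite negbK.
Qed.

Lemma cbool_odd F : cnat F -> cbool (fun x r => odd (F x r)).
Proof.
move=> hF.
have h : cbool (fun x r => bex (F x r) (fun i => i + i + 1 == F x r)).
  apply: (cbool_bex (P := fun x r i => i + i + 1 == F x r)) => //.
  apply: cbool_eq; last exact: cnat_lift.
  by do !apply: cnat_add; try exact: cnat_cst; exact: cnat_nth.
apply: cbool_ext h => x r; apply/bexP/idP => [[i _ /eqP <-]|ho].
  by rewrite addn1 /= addnn odd_double.
by exists (F x r)./2; [|apply/eqP]; have := odd_double_half (F x r); rewrite ho; lia.
Qed.

Lemma cnat_div F G : cnat F -> cnat G -> cnat (fun x r => F x r %/ G x r).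
Proof.
move=> hF hG.
(* The quotient counts the positive multiples of the divisor up to the dividend; the guard gives the
   value 0 for division by 0. *)
have h : cnat (fun x r => nsum (F x r) (fun i => (0 < G x r) && (i.+1 * G x r <= F x r))).
  apply: (cnat_sum (G := fun x r i => (0 < G x r) && (i.+1 * G x r <= F x r) : nat)) => //.
  apply: cbool_and; first by apply: cbool_leq; [exact: cnat_cst | exact: cnat_lift].
  apply: cbool_leq; last exact: cnat_lift.
  by apply: cnat_mul; [apply: cnat_succ; exact: cnat_nth | exact: cnat_lift].
apply: cnat_ext h => x r; case: (posnP (G x r)) => [->|hg].
  by rewrite divn0 /nsum big1.
transitivity (nsum (F x r) (fun i => i < F x r %/ G x r)).
  by apply: eq_nsum => i _; rewrite leq_divRL.
have le_q : F x r %/ G x r <= F x r by exact: leq_div.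
rewrite /nsum -(big_mkord xpredT (fun i => nat_of_bool (i < F x r %/ G x r))).
rewrite (big_cat_nat (leq0n _) le_q) /= [X in _ + X]big1_seq ?addn0; last first.
  by move=> i; rewrite /= mem_index_iota => /andP[h1 _]; rewrite ltnNge h1.
rewrite (eq_big_nat _ _ (F2 := fun=> 1)); last by move=> i /andP[_ ->].
by rewrite sum_nat_const_nat subn0 muln1.
Qed.

Lemma cnat_mod F G : cnat F -> cnat G -> cnat (fun x r => F x r %% G x r).
Proof.
move=> hF hG; apply: cnat_ext (cnat_sub hF (cnat_mul (cnat_div hF hG) hG)) => x r.
by rewrite {1}(divn_eq (F x r) (G x r)) addKn.
Qed.

(** Below a constant bound any predicate is a finite disjunction of equalities. This is how the
    transition function of an arbitrary machine enters the expressions. *)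
Lemma cbool_table (h : nat -> bool) n F : cnat F ->
  cbool (fun x r => (F x r < n) && h (F x r)).
Proof.
move=> hF; elim: n => [|n IH]; first exact: cbool_cst.
have h1 := cbool_and (cbool_eq hF (cnat_cst n)) (cbool_cst (h n)).
apply: cbool_ext (cbool_or IH h1) => x r.
by rewrite ltnS [in RHS]leq_eqVlt; case: (F x r =P n) => [->|_] /=; rewrite ?ltnn ?orbF.
Qed.

Lemma cbool_all (T : Type) (s : seq T) (P : T -> seq Sigma -> seq nat -> bool) :
  (forall a, cbool (P a)) -> cbool (fun x r => all (fun a => P a x r) s).
Proof.
by move=> h; elim: s => [|a s IH] /=; [exact: cbool_cst | exact: cbool_and].
Qed.

Lemma cnat_poly (p : {poly nat}) F : cnat F -> cnat (fun x r => p.[F x r]%R).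
Proof.
move=> hF; elim/poly_ind: p => [|p c IH].
  by apply: cnat_ext (cnat_cst 0) => x r; rewrite horner0.
by apply: cnat_ext (cnat_add (cnat_mul IH hF) (cnat_cst c)) => x r; rewrite hornerMXaddC.
Qed.

Section Words.
Variable Delta : finType.
Implicit Types (W : seq Sigma -> seq nat -> seq Delta).

Lemma cword_ext W W' : W =2 W' -> cword W -> cword W'.
Proof. by move=> h [e he]; exists e => x r; rewrite he. Qed.

Lemma cword_emit b : @cword Delta (fun x r => [:: b]).
Proof. by exists (Out _ b). Qed.

Lemma cword_cat W W' : cword W -> cword W' -> cword (fun x r => W x r ++ W' x r).
Proof. by move=> [e he] [f hf]; exists (Plus e f) => x r /=; rewrite he hf. Qed.

Lemma cword_flat F (W : seq Sigma -> seq nat -> nat -> seq Delta) :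
  cnat F -> cword (fun x r => W x (behead r) (nth 0 r 0)) ->
  cword (fun x r => nflat (F x r) (W x r)).
Proof.
move=> /(cnat_pure Delta) [e he] [f hf]; exists (Sum e f) => x r /=.
have [-> ->] := he x r; congr flatten; apply: eq_map => i; exact: hf.
Qed.

Lemma cword_lift W : cword W -> cword (fun x r => W x (behead r)).
Proof.
by move=> [e he]; exists (ren 0 e) => x r; rewrite wrd_ren take0 drop1.
Qed.

Lemma cword_if B W W' : cbool B -> cword W -> cword W' ->
  cword (fun x r => if B x r then W x r else W' x r).
Proof.
move=> hB hW hW'.
have h1 := cword_flat (W := fun x r _ => W x r) hB (cword_lift hW).
have h2 := cword_flat (W := fun x r _ => W' x r) (cbool_neg hB) (cword_lift hW').
apply: cword_ext (cword_cat h1 h2) => x r.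
by case: (B x r); rewrite /nflat /= ?cats0.
Qed.

Lemma polytime_cword W : cword W -> polytime (fun x => W x [::]).
Proof.
move=> [e he]; have [M [p h]] := polytime_wrd e; exists M, p => x.
by rewrite -he; exact: h.
Qed.

Lemma size_nflat n (f : nat -> seq Delta) :
  size (nflat n f) = nsum n (fun i => size (f i)).
Proof.
rewrite /nflat; elim: n => [|n IH]; first by rewrite nsum0.
by rewrite nsumS -addn1 iotaD map_cat flatten_cat size_cat IH /= cats0.
Qed.

Lemma onth_nflat n (f : nat -> seq Delta) p a :
  (onth (nflat n f) p == Some a) =
  bex n (fun i => (nsum i (fun j => size (f j)) <= p) &&
    (onth (f i) (p - nsum i (fun j => size (f j))) == Some a)).
Proof.
elim: n => [|n IH]; first by rewrite /nflat onth0n.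
rewrite /bex -addn1 iotaD has_cat /= orbF -/(bex n _) -IH add0n.
rewrite {1}/nflat iotaD map_cat flatten_cat onth_cat /= cats0 add0n -/(nflat n f) size_nflat.
case: leqP => h /=; last by rewrite orbF.
by rewrite [onth (nflat n f) p]onth_default // size_nflat.
Qed.

Lemma cnat_size_wrd (e : expr Sigma Delta) : cnat (fun x r => size (wrd e x r)).
Proof.
elim: e => [i|n||a e IH|e1 IH1 e2 IH2|e1 IH1 e2 IH2|e1 IH1 e2 IH2|b] /=;
  try exact: cnat_cst; try exact: IH.
- by apply: cnat_ext (cnat_add IH1 IH2) => x r; rewrite size_cat.
- by apply: cnat_ext (cnat_add IH1 IH2) => x r; rewrite size_cat.
have [f hf] := IH2; have [g hg] := cnat_value e1.
have h : cnat (fun x r => nsum (value e1 x r) (fun i => size (wrd e2 x (i :: r)))).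
  by exists (Sum g f) => x r /=; rewrite hg; apply: eq_bigr => i _; rewrite hf.
apply: cnat_ext (cnat_add IH1 h) => x r.
by rewrite size_cat -[flatten _]/(nflat _ _) size_nflat.
Qed.

(** Structural recursion: the lengths of the earlier pieces, themselves definable, locate the piece
    that contains the position. A program can thus compare its input with a long word without
    storing that word. *)
Lemma cbool_onth_wrd (e : expr Sigma Delta) a F : cnat F ->
  cbool (fun x r => onth (wrd e x r) (F x r) == Some a).
Proof.
elim: e F => [i|n||c e IH|e1 IH1 e2 IH2|e1 IH1 e2 IH2|e1 IH1 e2 IH2|b] F hF /=.
- by apply: cbool_ext (cbool_cst false) => x r; rewrite onth0n.
- by apply: cbool_ext (cbool_cst false) => x r; rewrite onth0n.
- by apply: cbool_ext (cbool_cst false) => x r; rewrite onth0n.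
- exact: IH.
- have sz := cnat_size_wrd e1.
  apply: cbool_ext (cbool_if (cbool_leq (cnat_succ hF) sz) (IH1 _ hF) (IH2 _ (cnat_sub hF sz))).
  by move=> x r; rewrite onth_cat; case: ifP.
- have sz := cnat_size_wrd e1.
  apply: cbool_ext (cbool_if (cbool_leq (cnat_succ hF) sz) (IH1 _ hF) (IH2 _ (cnat_sub hF sz))).
  by move=> x r; rewrite onth_cat; case: ifP.
- have sz := cnat_size_wrd e1; have sz2 := cnat_size_wrd e2.
  (* The environment is [j :: i :: r], with [i] the piece under test; the body must see [j] and skip
     [i], hence a renaming at index 1. *)
  have hpre : cnat (fun x r => nsum (nth 0 r 0) (fun j => size (wrd e2 x (j :: behead r)))).
    have [f hf] := cnat_ren 1 sz2; exists (Sum (Var _ _ 0) f) => x r /=.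
    have E (j : nat) : take 1 (j :: r) ++ drop 2 (j :: r) = j :: behead r.
      by case: (r) => [|k s] //=; rewrite drop0.
    by apply: eq_bigr => i _; rewrite hf E.
  have hG := cnat_sub hF sz.
  have hat := IH2 _ (cnat_sub (cnat_lift hG) hpre).
  have hP := cbool_and (cbool_leq hpre (cnat_lift hG)) hat.
  have h : cbool (fun x r => bex (value e1 x r) (fun i =>
     (nsum i (fun j => size (wrd e2 x (j :: r))) <= F x r - size (wrd e1 x r)) &&
     (onth (wrd e2 x (i :: r)) (F x r - size (wrd e1 x r) -
         nsum i (fun j => size (wrd e2 x (j :: r)))) == Some a))).
    have [g hg] := cnat_value e1; have [f hf] := hP.
    have h : cnat (fun x r => nsum (value e1 x r) (fun i => value f x (i :: r))).
      by exists (Sum g f) => x r /=; rewrite hg.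
    apply: cbool_ext (cbool_neg (cbool_eq h (cnat_cst 0))) => x r.
    rewrite /bex -[X in _ = X]negbK; congr (~~ _); rewrite -all_predC.
    rewrite -[all _ _]/(ball _ _) ball_nsum; congr (_ == 0); apply: eq_nsum => i _.
    by rewrite hf /= negbK.
  apply: cbool_ext (cbool_if (cbool_leq (cnat_succ hF) sz) (IH1 _ hF) h).
  by move=> x r; rewrite onth_cat; case: ifP => _ //; rewrite -[flatten _]/(nflat _ _) onth_nflat.
- apply: cbool_ext (cbool_and (cbool_eq hF (cnat_cst 0)) (cbool_cst (b == a))) => x r.
  by case: (F x r) => [|k] //=; rewrite ?onth0n //.
Qed.

Lemma cnat_size_word W : cword W -> cnat (fun x r => size (W x r)).
Proof. by move=> [e he]; apply: cnat_ext (cnat_size_wrd e) => x r; rewrite he. Qed.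

Lemma cbool_onth_word W a F : cword W -> cnat F ->
  cbool (fun x r => onth (W x r) (F x r) == Some a).
Proof.
by move=> [e he] hF; apply: cbool_ext (cbool_onth_wrd e a hF) => x r; rewrite he.
Qed.

End Words.
End Closure.

(** * From tilings to two-coloured matrices *)

Local Notation tiles := [tuple cell_tile; square_tile].

Lemma ord2P (k : 'I_2) : k = ord0 \/ k = lift ord0 ord0.
Proof. by case: k => [[|[|k]] h] //; [left|right]; apply: val_inj. Qed.

(** The index of a tile is its side length minus one, so both tiles are described by offsets up to
    the index. *)
Lemma placedP n (q : 'I_n * 'I_n * 'I_2) (p : int * int) :
  reflect (exists u v : nat, [/\ u <= q.2, v <= q.2 & p = (Posz (q.1.1 + u), Posz (q.1.2 + v))])
          (p \in placed tiles q).
Proof.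
case: q => [[i j] k]; rewrite /placed /translate /=.
apply: (iffP (imfsetP _ _ _ _)).
  case=> [[u v]] /= h ->; case: (ord2P k) h => ->.
    by rewrite (tnth_nth cell_tile) /= inE => /eqP[-> ->]; exists 0, 0; rewrite !addn0 !addr0.
  rewrite (tnth_nth cell_tile) /= !inE -!orbA => /or4P[] /eqP[-> ->].
  - by exists 0, 0; rewrite !addn0 !addr0.
  - by exists 0, 1; rewrite !addn0 !addr0.
  - by exists 1, 0; rewrite !addn0 !addr0.
  - by exists 1, 1.
case=> u [v [hu hv ->]]; exists (Posz u, Posz v) => //=.
case: (ord2P k) hu hv => ->; rewrite (tnth_nth cell_tile) /=.
  by rewrite !leqn0 => /eqP-> /eqP->; rewrite inE.
by case: u v => [|[|u]] [|[|v]] // _ _; rewrite !inE.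
Qed.

Lemma nsum_double M f : nsum M.*2 f = nsum M (fun j => f j.*2 + f j.*2.+1).
Proof. by elim: M => [|M IH]; rewrite ?nsum0 // doubleS !nsumS IH addnA. Qed.

Lemma nsum_eq0 n f : nsum n f = 0 -> forall i, i < n -> f i = 0.
Proof.
move=> /eqP; rewrite /nsum sum_nat_eq0 => /forallP h i hi.
by have /= /eqP := h (Ordinal hi).
Qed.

Section Coarse.
Variables (M : nat) (ra rb ca cb : nat -> nat).

(* Squares and cells whose corners have even coordinates fall into distinct
   2 x 2 blocks, so they are a partial colouring of the M x M blocks. *)
Definition coarse_sums (f g : nat -> nat) : 'M[nat]_(M.*2, 2) :=
  \matrix_(i, k) if odd i then 0 else if k == ord0 then g i./2 else f i./2.

Definition coarse (a b : nat -> nat -> bool) : Prop :=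
  [/\ forall i j, i < M -> j < M -> ~~ (a i j && b i j),
      forall i, i < M -> nsum M (fun j => a i j) = ra i /\ nsum M (fun j => b i j) = rb i
    & forall j, j < M -> nsum M (fun i => a i j) = ca j /\ nsum M (fun i => b i j) = cb j].

(** Odd rows and columns have sum 0 for both types, which forces all corners to even coordinates.
    Tiles then conflict only when a square and a cell share a block. Index 1 is the square, colour
    [a]; index 0 is the cell, colour [b]. *)
Lemma consistent_coarse :
  consistent tiles (coarse_sums ra rb) (coarse_sums ca cb) <-> exists a b, coarse a b.
Proof.
split=> [[T [[hdis _] hr hc]]|[a [b [hab hr hc]]]].
  pose t (i j k : nat) := [exists q in T, [&& q.1.1 == i :> nat, q.1.2 == j :> nat & q.2 == k :> nat]].
  have tE (i j : 'I_M.*2) (k : 'I_2) : t i j k = ((i, j, k) \in T).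
    apply/exists_inP/idP => [[[[i' j'] k'] h /= /and3P[/eqP hi /eqP hj /eqP hk]]|h].
      by rewrite -(val_inj hi) -(val_inj hj) -(val_inj hk).
    by exists (i, j, k) => //=; rewrite !eqxx.
  have rE (i : 'I_M.*2) (k : 'I_2) : nsum M.*2 (fun j => t i j k) = coarse_sums ra rb i k.
    rewrite -hr mxE -sum1dep_card big_mkcond /nsum; apply: eq_bigr => j _.
    by rewrite tE; case: ifP.
  have cE (j : 'I_M.*2) (k : 'I_2) : nsum M.*2 (fun i => t i j k) = coarse_sums ca cb j k.
    rewrite -hc mxE -sum1dep_card big_mkcond /nsum; apply: eq_bigr => i _.
    by rewrite tE; case: ifP.
  have ltd i : i < M -> i.*2 < M.*2 by rewrite ltn_double.
  have ltd1 i : i < M -> i.*2.+1 < M.*2 by rewrite -doubleS leq_double.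
  have t0r i j (k : 'I_2) : i < M.*2 -> j < M -> t i j.*2.+1 k = false.
    move=> hi hj; have := cE (Ordinal (ltd1 _ hj)) k; rewrite mxE /= odd_double /=.
    by move/nsum_eq0 => /(_ i hi); case: (t _ _ _).
  have t0c i j (k : 'I_2) : j < M.*2 -> i < M -> t i.*2.+1 j k = false.
    move=> hj hi; have := rE (Ordinal (ltd1 _ hi)) k; rewrite mxE /= odd_double /=.
    by move/nsum_eq0 => /(_ j hj); case: (t _ _ _).
  have rE2 i (k : 'I_2) : i < M -> nsum M (fun j => t i.*2 j.*2 k) = if k == ord0 then rb i else ra i.
    move=> hi; have := rE (Ordinal (ltd _ hi)) k; rewrite mxE /= odd_double doubleK => <-.
    by rewrite nsum_double; apply: eq_nsum => j hj; rewrite t0r ?addn0 // ltd.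
  have cE2 j (k : 'I_2) : j < M -> nsum M (fun i => t i.*2 j.*2 k) = if k == ord0 then cb j else ca j.
    move=> hj; have := cE (Ordinal (ltd _ hj)) k; rewrite mxE /= odd_double doubleK => <-.
    by rewrite nsum_double; apply: eq_nsum => i hi; rewrite t0c ?addn0 // ltd.
  exists (fun i j => t i.*2 j.*2 1), (fun i j => t i.*2 j.*2 0); split.
  - move=> i j hi hj; apply/negP => /andP[h1 h0].
    have := tE (Ordinal (ltd _ hi)) (Ordinal (ltd _ hj)) (lift ord0 ord0).
    have := tE (Ordinal (ltd _ hi)) (Ordinal (ltd _ hj)) ord0.
    rewrite /= h1 h0 => /esym m0 /esym m1.
    have /fdisjointP := hdis _ _ m0 m1 ltac:(by rewrite xpair_eqE andbF).
    move=> /(_ (Posz i.*2, Posz j.*2)) H.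
    have p0 : (Posz i.*2, Posz j.*2) \in placed tiles (Ordinal (ltd _ hi), Ordinal (ltd _ hj), ord0).
      by apply/placedP; exists 0, 0; rewrite !addn0.
    have p1 : (Posz i.*2, Posz j.*2) \in placed tiles (Ordinal (ltd _ hi), Ordinal (ltd _ hj), lift ord0 ord0).
      by apply/placedP; exists 0, 0; rewrite !addn0.
    by move: (H p0); rewrite p1.
  - by move=> i hi; rewrite (rE2 i (lift ord0 ord0)) // (rE2 i ord0).
  - by move=> j hj; rewrite (cE2 j (lift ord0 ord0)) // (cE2 j ord0).
pose t (i j k : nat) := [&& ~~ odd i, ~~ odd j & if k == 0 then b i./2 j./2 else a i./2 j./2].
pose T := [set q : 'I_M.*2 * 'I_M.*2 * 'I_2 | t q.1.1 q.1.2 q.2].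
have ltM i : i < M.*2 -> i./2 < M by lia.
exists T; split.
- split.
    move=> [[i j] k] [[i' j'] k']; rewrite !inE /t /=.
    move=> /and3P[oi oj h] /and3P[oi' oj' h'] ne.
    apply/fdisjointP => p /placedP [u [v [/= hu hv ->]]]; apply/negP.
    move=> /placedP [u' [v' [/= hu' hv' [e1 e2]]]].
    have lk := ltn_ord k; have lk' := ltn_ord k'.
    have ei : i = i' by apply: val_inj => /=; lia.
    have ej : j = j' by apply: val_inj => /=; lia.
    subst i' j'.
    have := hab i./2 j./2 (ltM _ (ltn_ord i)) (ltM _ (ltn_ord j)).
    by case: (ord2P k) (ord2P k') ne h h' => -> [] ->; rewrite ?eqxx //= => _ -> ->.
  move=> [[i j] k] p; rewrite !inE /t /= => /and3P[oi oj _] /placedP [u [v [/= hu hv ->]]].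
  have lk := ltn_ord k; have li := ltn_ord i; have lj := ltn_ord j.
  by rewrite /in_grid /= !ltz_nat; lia.
- apply/matrixP => i k; rewrite !mxE -sum1dep_card big_mkcond.
  transitivity (nsum M.*2 (fun j => t i j k)).
    by rewrite /nsum; apply: eq_bigr => j _; rewrite inE /=; case: (t _ _ _).
  rewrite nsum_double /t; case: (boolP (odd i)) => oi /=.
    by rewrite /nsum big1.
  have [h1 h2] := hr _ (ltM _ (ltn_ord i)).
  transitivity (nsum M (fun j => if k == 0 :> nat then b i./2 j else a i./2 j)).
    by apply: eq_nsum => j _; rewrite /= odd_double /= doubleK addn0.
  by case: (ord2P k) => ->.
- apply/matrixP => j k; rewrite !mxE -sum1dep_card big_mkcond.
  transitivity (nsum M.*2 (fun i => t i j k)).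
    by rewrite /nsum; apply: eq_bigr => i _; rewrite inE /=; case: (t _ _ _).
  rewrite nsum_double /t; case: (boolP (odd j)) => oj /=.
    by rewrite /nsum big1 // => i _; rewrite !andbF.
  have [h1 h2] := hc _ (ltM _ (ltn_ord j)).
  transitivity (nsum M (fun i => if k == 0 :> nat then b i j./2 else a i j./2)).
    by apply: eq_nsum => i _; rewrite /= odd_double /= doubleK addn0.
  by case: (ord2P k) => ->.
Qed.

End Coarse.

(** * Forced staircases and dominance *)

Lemma nsumD n f g : nsum n (fun i => f i + g i) = nsum n f + nsum n g.
Proof. exact: big_split. Qed.

Lemma nsumMl n c f : nsum n (fun i => c * f i) = c * nsum n f.
Proof. by rewrite /nsum big_distrr. Qed.

Lemma nsum_cst n c : nsum n (fun=> c) = n * c.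
Proof. by rewrite /nsum sum_nat_const card_ord. Qed.

Lemma nsum_exchange n m (f : nat -> nat -> nat) :
  nsum n (fun i => nsum m (f i)) = nsum m (fun j => nsum n (f^~ j)).
Proof. exact: exchange_big. Qed.

Lemma nsum_only n k f : k < n -> (forall l, l < n -> l != k -> f l = 0) -> nsum n f = f k.
Proof.
move=> hk h; rewrite /nsum (bigD1 (Ordinal hk)) //= big1 ?addn0 // => i hi.
by apply: h => //; rewrite -val_eqE in hi.
Qed.

Lemma nsum_zero n f : (forall l, l < n -> f l = 0) -> nsum n f = 0.
Proof. by move=> h; rewrite /nsum big1 // => i _; exact: h. Qed.

Lemma leq_nsum n f g : (forall i, i < n -> f i <= g i) -> nsum n f <= nsum n g.
Proof. by move=> h; apply: leq_sum => i _; exact: h. Qed.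

Lemma nsumSl n f : nsum n.+1 f = f 0 + nsum n (fun i => f i.+1).
Proof. by rewrite /nsum big_ord_recl. Qed.

Lemma nsum_rev n f : nsum n f = nsum n (fun i => f (n - i.+1)).
Proof. by rewrite /nsum (reindex_inj rev_ord_inj). Qed.

Lemma nsum_block K W f :
  nsum (K * W) f = nsum K (fun l => nsum W (fun j => f (l * W + j))).
Proof.
elim: K => [|K IH]; first by rewrite !nsum0.
rewrite nsumS -IH mulSn addnC {IH}; elim: W (K * W) => [|W IH] m.
  by rewrite addn0 nsum0 addn0.
by rewrite addnS !nsumS addnA -IH.
Qed.

Lemma nsum_full n (f : nat -> bool) : nsum n f = n -> forall i, i < n -> f i.
Proof.
move=> h i hi; apply: contraTT isT => nf.
have : nsum n f + nsum n (fun j => ~~ f j) = n.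
  rewrite -nsumD -[RHS]muln1 -nsum_cst; apply: eq_nsum => j _; by case: (f j).
rewrite h => /eqP; rewrite -[X in _ == X]addn0 eqn_add2l => /eqP.
by move=> /nsum_eq0 /(_ i hi); rewrite (negbTE nf).
Qed.

Lemma nsum_ltn n i : i <= n -> nsum n (fun j => j < i) = i.
Proof.
elim: n i => [|n IH] i; first by rewrite leqn0 => /eqP->; rewrite nsum0.
rewrite leq_eqVlt nsumS => /orP[/eqP->|hi]; last by rewrite IH //; lia.
rewrite -[X in _ = X]addn1; congr (_ + _); last by rewrite ltnSn.
rewrite -[RHS](IH n (leqnn n)); apply: eq_nsum => j hj; lia.
Qed.

Lemma nsum_gtn n j : j < n -> nsum n (fun i => j < i) = n.-1 - j.
Proof.
move=> hj; have : nsum n (fun i => j < i) + nsum n (fun i => i < j.+1) = n.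
  rewrite -nsumD -[RHS]muln1 -nsum_cst; apply: eq_nsum => i _; lia.
by rewrite nsum_ltn //; lia.
Qed.

Lemma nsum_pred1 n d (c : bool) : (c -> d < n) -> nsum n (fun j => c && (j == d)) = c.
Proof.
case: c => [/(_ isT) hd|_]; last by rewrite nsum_zero.
rewrite (nsum_only hd) /= ?eqxx // => l _ /negbTE -> //.
Qed.

Lemma nsum_neg n (f : nat -> bool) : nsum n (fun j => ~~ f j) = n - nsum n (fun j => f j).
Proof.
have : nsum n (fun j => f j) + nsum n (fun j => ~~ f j) = n; last by lia.
by rewrite -nsumD -[RHS]muln1 -nsum_cst; apply: eq_nsum => i _; case: (f i).
Qed.

Section Forced.
Variables (M : nat) (al be rho sig : nat -> nat) (a : nat -> nat -> bool).
Hypothesis hrow : forall i, i < M ->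
  nsum M (fun j => a i j) = nsum M (fun j => al i < be j) + rho i.
Hypothesis hcol : forall j, j < M ->
  nsum M (fun i => a i j) = nsum M (fun i => al i < be j) + sig j.
Hypothesis hbal : nsum M (fun j => be j * sig j) = nsum M (fun i => al i * rho i).

(* The weighted sum of (be j - al i) * (a i j - [al i < be j]) vanishes while
   none of its terms is positive. *)
Lemma forced i j : i < M -> j < M ->
  (al i < be j -> a i j) /\ (be j < al i -> a i j = false).
Proof.
move=> hi hj.
pose D i j := if al i < be j then (be j - al i) * (~~ a i j) else (al i - be j) * a i j.
have h0 : nsum M (fun i => nsum M (D i)) = 0.
  pose L i j : nat := al i < be j.
  (* The weighted identity of one cell, with negative terms moved across so as to stay in [nat]; [D]
     is the defect that must vanish. *)
  have e i' j' : be j' * a i' j' + al i' * L i' j' + D i' j' = al i' * a i' j' + be j' * L i' j'.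
    by rewrite /D /L; case: ltnP => h; case: (a i' j') => /=; lia.
  have e1 : nsum M (fun i => nsum M (fun j => be j * a i j)) =
      nsum M (fun i => nsum M (fun j => be j * L i j)) + nsum M (fun j => be j * sig j).
    rewrite nsum_exchange [X in _ = X + _]nsum_exchange -nsumD; apply: eq_nsum => j' hj'.
    by rewrite !nsumMl hcol // mulnDr.
  have e2 : nsum M (fun i => nsum M (fun j => al i * a i j)) =
      nsum M (fun i => nsum M (fun j => al i * L i j)) + nsum M (fun i => al i * rho i).
    rewrite -nsumD; apply: eq_nsum => i' hi'.
    by rewrite !nsumMl hrow // mulnDr.
  have : nsum M (fun i => nsum M (fun j => be j * a i j + al i * L i j + D i j)) =
         nsum M (fun i => nsum M (fun j => al i * a i j + be j * L i j)).
    by apply: eq_nsum => i' _; apply: eq_nsum => j' _.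
  have sp f g : nsum M (fun i => nsum M (fun j => f i j + g i j)) =
    nsum M (fun i => nsum M (f i)) + nsum M (fun i => nsum M (g i)).
    by rewrite -nsumD; apply: eq_nsum => i' _; rewrite nsumD.
  rewrite !sp e1 e2 hbal; lia.
have := nsum_eq0 (nsum_eq0 h0 hi) hj; rewrite /D.
by case: ltnP => h; case: (a i j) => //=; rewrite ?muln1 => e; split; lia.
Qed.

(** Once the staircase is accounted for, the surplus of a row can only sit on cells of equal labels;
    these are the blocks that carry information. *)
Lemma forced_row i : i < M -> nsum M (fun j => (be j == al i) && a i j) = rho i.
Proof.
move=> hi; apply/eqP; rewrite -(eqn_add2l (nsum M (fun j => al i < be j))) -hrow //.
rewrite -nsumD; apply/eqP; apply: eq_nsum => j hj; have [h1 h2] := forced hi hj.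
by case: (ltngtP (al i) (be j)) h1 h2 => //= h; [move=> /(_ isT) ->|move=> _ /(_ isT) ->].
Qed.

Lemma forced_col j : j < M -> nsum M (fun i => (be j == al i) && a i j) = sig j.
Proof.
move=> hj; apply/eqP; rewrite -(eqn_add2l (nsum M (fun i => al i < be j))) -hcol //.
rewrite -nsumD; apply/eqP; apply: eq_nsum => i hi; have [h1 h2] := forced hi hj.
by case: (ltngtP (al i) (be j)) h1 h2 => //= h; [move=> /(_ isT) ->|move=> _ /(_ isT) ->].
Qed.

End Forced.

Definition suf (N m : nat) (f : nat -> nat) : nat := \sum_(m <= i < N) f i.

Lemma sufD N m f g : suf N m (fun i => f i + g i) = suf N m f + suf N m g.
Proof. exact: big_split. Qed.

Lemma suf_cst N m c : suf N m (fun=> c) = (N - m) * c.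
Proof. by rewrite /suf sum_nat_const_nat. Qed.

Lemma eq_suf N m f g : (forall i, i < N -> f i = g i) -> suf N m f = suf N m g.
Proof. by move=> h; apply: eq_big_nat => i /andP[_]; exact: h. Qed.

Lemma leq_suf N m f g : (forall i, i < N -> f i <= g i) -> suf N m f <= suf N m g.
Proof.
move=> h; rewrite /suf big_nat [X in _ <= X]big_nat; apply: leq_sum => i /andP[_].
exact: h.
Qed.

Lemma suf_rec N m f : m < N -> suf N m f = f m + suf N m.+1 f.
Proof. by move=> h; rewrite /suf big_ltn. Qed.

Lemma nsum_suf N f : nsum N f = suf N 0 f.
Proof. by rewrite /nsum /suf big_mkord. Qed.

Lemma suf_id N m : m <= N ->
  suf N m (fun i => i) = (N - m) * m + suf N m (fun j => N.-1 - j).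
Proof.
move=> h; rewrite -suf_cst [X in _ = _ + X]/suf big_nat_rev -/(suf N m _) -sufD.
rewrite /suf big_nat [RHS]big_nat; apply: eq_bigr => i /andP[]; lia.
Qed.

(** Count the ones in the rows from [m] on: at most m(N - m) lie in columns before [m], and the
    others are bounded by the sums of the columns from [m] on. By [suf_id] the main terms [i] and
    [N.-1 - j] differ by exactly m(N - m) and cancel, leaving the corrections. *)
Lemma dominance N m (e : nat -> nat -> bool) (x y X Y : nat -> nat) : m <= N ->
  (forall i, i < N -> nsum N (fun j => e i j) + x i = i + X i) ->
  (forall j, j < N -> nsum N (fun i => e i j) + y j = (N.-1 - j) + Y j) ->
  suf N m X + suf N m y <= suf N m x + suf N m Y.
Proof.
move=> hm hr hc.
have h1 : suf N m (fun i => nsum N (fun j => e i j)) + suf N m x =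
  suf N m (fun i => i) + suf N m X by rewrite -!sufD; exact: eq_suf.
have h2 : suf N m (fun j => nsum N (fun i => e i j)) + suf N m y =
  suf N m (fun j => N.-1 - j) + suf N m Y by rewrite -!sufD; exact: eq_suf.
have hi := suf_id hm.
suff : suf N m (fun i => nsum N (fun j => e i j)) <=
       (N - m) * m + suf N m (fun j => nsum N (fun i => e i j)) by lia.
have -> : suf N m (fun j => nsum N (fun i => e i j)) =
          nsum N (fun i => suf N m (fun j => e i j)) by exact: exchange_big.
apply: (@leq_trans (suf N m (fun i => m + suf N m (fun j => e i j)))).
  apply: leq_suf => i _; rewrite nsum_suf /suf (big_cat_nat (leq0n m) hm) /= leq_add2r.
  rewrite -[X in _ <= X]subn0 -[X in _ <= X]muln1 -sum_nat_const_nat.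
  by apply: leq_sum => j _; exact: leq_b1.
rewrite sufD suf_cst leq_add2l nsum_suf /suf.
by rewrite [X in _ <= X](big_cat_nat (leq0n m) hm) /= leq_addl.
Qed.

(** * The gadget: a chain of stages testing one clause each *)

Definition flat (W : nat) (T : Type) (f : nat -> nat -> T) (i : nat) : T := f (i %/ W) (i %% W).

Lemma flatE W T (f : nat -> nat -> T) k i : i < W -> flat W f (k * W + i) = f k i.
Proof.
move=> h; have W0 : 0 < W by exact: leq_trans h.
by rewrite /flat divnMDl // divn_small // addn0 modnMDl modn_small.
Qed.

Lemma nsum3 n N (g : nat -> nat -> nat) :
  nsum n (fun l => nsum N.+2 (g l)) =
  nsum n (fun l => nsum N (g l)) + nsum n (g^~ N) + nsum n (g^~ N.+1).
Proof. by rewrite -!nsumD; apply: eq_nsum => l _; rewrite !nsumS. Qed.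

Lemma ltn_block K W k i : k <= K -> i < W -> k * W + i < K.+1 * W.
Proof.
move=> hk hi; rewrite mulSn addnC -addSn leq_add //.
by rewrite leq_mul2r hk orbT.
Qed.

Section Blocks.
Variables (K W : nat) (al be rho sig : nat -> nat -> nat) (a0 : nat -> nat -> bool).
Notation M := (K.+1 * W).
Hypothesis hrow : forall i, i < M -> nsum M (fun j => a0 i j) =
  nsum M (fun j => flat W al i < flat W be j) + flat W rho i.
Hypothesis hcol : forall j, j < M -> nsum M (fun i => a0 i j) =
  nsum M (fun i => flat W al i < flat W be j) + flat W sig j.
Hypothesis hbal : nsum K.+1 (fun l => nsum W (fun j => be l j * sig l j)) =
  nsum K.+1 (fun k => nsum W (fun i => al k i * rho k i)).

Let a k i l j := a0 (k * W + i) (l * W + j).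

Lemma flat_bal : nsum M (fun j => flat W be j * flat W sig j) =
  nsum M (fun i => flat W al i * flat W rho i).
Proof.
rewrite !nsum_block.
transitivity (nsum K.+1 (fun l => nsum W (fun j => be l j * sig l j))).
  by apply: eq_nsum => l _; apply: eq_nsum => j hj; rewrite !flatE.
by rewrite hbal; apply: eq_nsum => l _; apply: eq_nsum => j hj; rewrite !flatE.
Qed.

Lemma block_forced k i l j : k <= K -> i < W -> l <= K -> j < W ->
  (al k i < be l j -> a k i l j) /\ (be l j < al k i -> a k i l j = false).
Proof.
move=> hk hi hl hj.
have := forced hrow hcol flat_bal (ltn_block hk hi) (ltn_block hl hj).
by rewrite !flatE.
Qed.

Lemma block_row k i : k <= K -> i < W ->
  nsum K.+1 (fun l => nsum W (fun j => (be l j == al k i) && a k i l j)) = rho k i.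
Proof.
move=> hk hi; have := forced_row hrow hcol flat_bal (ltn_block hk hi).
rewrite nsum_block [in RHS]flatE // => <-.
by apply: eq_nsum => l _; apply: eq_nsum => j hj; rewrite !flatE.
Qed.

Lemma block_col l j : l <= K -> j < W ->
  nsum K.+1 (fun k => nsum W (fun i => (be l j == al k i) && a k i l j)) = sig l j.
Proof.
move=> hl hj; have := forced_col hrow hcol flat_bal (ltn_block hl hj).
rewrite nsum_block [in RHS]flatE // => <-.
by apply: eq_nsum => k _; apply: eq_nsum => i hi; rewrite !flatE.
Qed.

(** Label 0 is minimal: rows of larger label are forced to avoid the column, and rows of label 0 are
    counted by its surplus. This disposes of the columns that carry 0 only as a default label. *)
Lemma block_zero k i l j : k <= K -> i < W -> l <= K -> j < W ->
  be l j = 0 -> sig l j = 0 -> a k i l j = false.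
Proof.
move=> hk hi hl hj b0 s0; have := block_col hl hj; rewrite s0 b0.
move/nsum_eq0/(_ k hk)/nsum_eq0/(_ i hi).
have [_] := block_forced hk hi hl hj; rewrite b0.
by case: (al k i) => [_|n ->] //=; case: (a k i l j).
Qed.

End Blocks.

Definition lit (X : nat -> bool) (j : nat) : bool :=
  if odd j then ~~ X j./2 else X j./2.

Section Gadget.
Variables (K J : nat) (S : nat -> nat -> bool).
Notation N := (J.*2).
Notation W := (J.*2.+2).
Notation M := (K.+1 * J.*2.+2).

Definition clause_size (k : nat) : nat := nsum N (fun j => S k j).

(* Row (k, i) is R_k,i for i < N and the two test rows of stage k for i = N and
   i = N + 1; column (l, j) is C_l,j for j < N, the link column c_l for j = N
   and unused for j = N + 1.  Colour A (squares) must fill the cells with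
   [alA < beA] and colour B (single cells) those with [alB < beB]; the free
   cells of a row contain [rhoA] and [rhoB] tiles. *)
Definition alA (k i : nat) : nat := k.
Definition beA (l j : nat) : nat := if (l < K) && (j <= N) then l else 0.
Definition rhoA (k i : nat) : nat :=
  if i < N then if k == 0 then i + ~~ odd i else if k < K then i.+1 else 0
  else if k < K then if i == N then J.+1 else (clause_size k).-1 else 0.
Definition sigA (l j : nat) : nat :=
  if l < K then
    if j < N then N - j + S l j else if (j == N) && (0 < l) then J else 0
  else 0.
Definition alB (k i : nat) : nat :=
  if i < N then K - k else if k < K then K.-1 - k else K.
Definition beB (l j : nat) : nat :=
  if j < N then K.-1 - l else if (j == N) && (0 < l) then K - l else 0.
Definition rhoB (k i : nat) : nat :=
  if i < N then if k == 0 then 0 else if k < K then i.+1 else i + ~~ odd i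
  else if k < K then if i == N then J.-1 else N - (clause_size k).-1 else 0.
Definition sigB (l j : nat) : nat :=
  if l < K then
    if j < N then N - j + ~~ S l j else if (j == N) && (0 < l) then J else 0
  else 0.

Definition row_sum (al be rho : nat -> nat -> nat) (i : nat) : nat :=
  nsum M (fun j => flat W al i < flat W be j) + flat W rho i.
Definition col_sum (al be sig : nat -> nat -> nat) (j : nat) : nat :=
  nsum M (fun i => flat W al i < flat W be j) + flat W sig j.

Definition gadget (a b : nat -> nat -> bool) : Prop :=
  coarse M (row_sum alA beA rhoA) (row_sum alB beB rhoB)
           (col_sum alA beA sigA) (col_sum alB beB sigB) a b.

Hypothesis K0 : 0 < K.
Hypothesis J0 : 0 < J.
Hypothesis S0 : forall k, k < K -> 0 < clause_size k.

(** * Balance of the weighted surpluses *)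

Lemma clause_size_le k : clause_size k <= N.
Proof.
rewrite -[X in _ <= X]muln1 -nsum_cst; apply: leq_nsum => i _; exact: leq_b1.
Qed.

Lemma nsum_tri n : nsum n (fun j => n - j) = nsum n (fun i => i.+1).
Proof. by rewrite nsum_rev; apply: eq_nsum => i hi; lia. Qed.

(** Balance holds stage by stage: [J] in the link column and |S| in the other columns match [J.+1]
    and |S| - 1 in the test rows, which needs S nonempty. The exceptional sums of stage 0 have
    weight 0. *)
Lemma balanceA : nsum K.+1 (fun l => nsum W (fun j => beA l j * sigA l j)) =
  nsum K.+1 (fun k => nsum W (fun i => alA k i * rhoA k i)).
Proof.
apply: eq_nsum => k _; rewrite !nsumS /beA /sigA /alA /rhoA !ltnn !eqxx leqnn.
have -> : (N.+1 == N) = false by lia.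
have -> : (N.+1 < N) = false by lia.
case: (ltnP k K) => hk /=; last first.
  rewrite !muln0 !nsum_zero // => i hi; rewrite ?hi ?muln0 //.
  have -> : (k == 0) = false by lia.
  by rewrite muln0.
case: (posnP k) => [->|k0].
  by rewrite !mul0n !nsum_zero // => i hi; rewrite ?if_same mul0n.
have e1 : nsum N (fun j => (if j <= N then k else 0) * (if j < N then N - j + S k j else J * (j == N))) =
   k * nsum N (fun j => N - j) + k * clause_size k.
  rewrite -!nsumMl -nsumD; apply: eq_nsum => j hj; rewrite hj (ltnW hj); lia.
have e2 : nsum N (fun i => k * (if i < N then i.+1 else if i == N then J.+1 else (clause_size k).-1)) =
   k * nsum N (fun i => i.+1).
  by rewrite -nsumMl; apply: eq_nsum => j hj; rewrite hj.
rewrite (eq_nsum (g := fun j => (if j <= N then k else 0) * (if j < N then N - j + S k j else J * (j == N)))); last first.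
  by move=> i hi; rewrite hi.
rewrite e1 e2 nsum_tri; have := S0 hk; nia.
Qed.

(** The label [K.-1 - l] is shared by the columns C_l, the rows R_{l+1}, the test rows of stage [l]
    and the link column of stage [l.+1]. Both sides are therefore regrouped by label before being
    compared. *)
Lemma balanceB : nsum K.+1 (fun l => nsum W (fun j => beB l j * sigB l j)) =
  nsum K.+1 (fun k => nsum W (fun i => alB k i * rhoB k i)).
Proof.
pose TN := nsum N (fun i => i.+1).
transitivity (nsum K (fun l => (K.-1 - l) * (TN + N - clause_size l + J))).
  transitivity (nsum K (fun l => (K.-1 - l) * (TN + N - clause_size l)) +
                nsum K (fun l => if 0 < l then (K - l) * J else 0)).
    rewrite nsumS [X in _ + X]nsum_zero ?addn0; last first.
      by move=> j _; rewrite /sigB ltnn muln0.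
    rewrite -nsumD; apply: eq_nsum => l hl; rewrite !nsumS /beB /sigB hl ltnn eqxx /=.
    have -> : (N.+1 == N) = false by lia.
    have -> : (N.+1 < N) = false by lia.
    rewrite /= muln0 addn0; congr (_ + _); last by case: (0 < l).
    have -> : TN + N - clause_size l = nsum N (fun j => N - j + ~~ S l j).
      have : clause_size l + nsum N (fun j => ~~ S l j) = N.
        rewrite -nsumD -[RHS]muln1 -nsum_cst; apply: eq_nsum => j _; by case: (S l j).
      by rewrite nsumD nsum_tri -/TN; lia.
    by rewrite -nsumMl; apply: eq_nsum => j hj; rewrite hj.
  have -> : nsum K (fun l => if 0 < l then (K - l) * J else 0) = nsum K (fun l => (K.-1 - l) * J).
    case: (K) K0 => // K' _; rewrite nsumSl /= add0n nsumS subnn mul0n addn0.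
    by apply: eq_nsum => l hl; congr (_ * _); lia.
  by rewrite -nsumD; apply: eq_nsum => l _; rewrite -mulnDr.
transitivity (nsum K.+1 (fun k => (K - k) * (if 0 < k then TN else 0)) +
   nsum K.+1 (fun k => (K.-1 - k) * (if k < K then J + N - clause_size k else 0))).
  rewrite nsumSl muln0 add0n [in X in _ = _ + X]nsumS ltnn muln0 addn0 -nsumD.
  apply: eq_nsum => k hk; rewrite hk; have := clause_size_le k.
  have -> : K - k.+1 = K.-1 - k by lia.
  by move=> h; rewrite -mulnDr; congr (_ * _); lia.
rewrite -nsumD; apply: eq_nsum => k hk; rewrite ltnS in hk.
rewrite !nsumS /alB /rhoB ltnn eqxx /=.
have -> : (N.+1 == N) = false by lia.
have -> : (N.+1 < N) = false by lia.
rewrite -addnA; congr (_ + _).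
  case: (ltnP k K) => hkK; last first.
    have -> : k = K by lia.
    rewrite subnn mul0n [in RHS]nsum_zero // => i hi; by rewrite hi mul0n.
  case: posnP => [->|k0].
    by rewrite muln0 nsum_zero // => i hi; rewrite hi muln0.
  by rewrite /TN -nsumMl; apply: eq_nsum => i hi; rewrite hi.
case: ltnP => hkK; last by rewrite !muln0.
have := clause_size_le k; have := S0 hkK.
by rewrite -mulnDr => h1 h2; congr (_ * _); lia.
Qed.

(** * Soundness: reading variables off a solution of the gadget *)

Section Soundness.
Variables a0 b0 : nat -> nat -> bool.
Hypothesis sol : gadget a0 b0.

Let a k i l j := a0 (k * W + i) (l * W + j).
Let b k i l j := b0 (k * W + i) (l * W + j).

Let rowA i : i < M -> nsum M (fun j => a0 i j) = row_sum alA beA rhoA i.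
Proof. by case: sol => _ h _ /h[]. Qed.
Let rowB i : i < M -> nsum M (fun j => b0 i j) = row_sum alB beB rhoB i.
Proof. by case: sol => _ h _ /h[]. Qed.
Let colA j : j < M -> nsum M (fun i => a0 i j) = col_sum alA beA sigA j.
Proof. by case: sol => _ _ h /h[]. Qed.
Let colB j : j < M -> nsum M (fun i => b0 i j) = col_sum alB beB sigB j.
Proof. by case: sol => _ _ h /h[]. Qed.

Let fA := block_forced rowA colA balanceA.
Let fB := block_forced rowB colB balanceB.
Let zA := block_zero rowA colA balanceA.
Let zB := block_zero rowB colB balanceB.

Lemma excl k i l j : k <= K -> i < W -> l <= K -> j < W -> a k i l j + b k i l j <= 1.
Proof.
move=> hk hi hl hj; case: sol => h _ _.
have := h _ _ (ltn_block hk hi) (ltn_block hl hj); rewrite -/(a k i l j) -/(b k i l j).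
by case: (a k i l j); case: (b k i l j).
Qed.

Let NW : N < W. Proof. by []. Qed.
Let N1W : N.+1 < W. Proof. by []. Qed.
Let iW i : i < N -> i < W. Proof. by move=> h; rewrite !ltnS ltnW // ltnW. Qed.

(** The columns sharing the label [k] are those of stage [k] and, for [k] equal to 0, the columns
    labelled 0 by default; the latter have no surplus and are empty. *)
Lemma full_rowA k i : k < K -> i < W ->
  nsum N (fun j => a k i k j) + a k i k N = rhoA k i.
Proof.
move=> hk hi; have hk' := ltnW hk.
have sg l j : l <= K -> j < W -> beA l j = k -> (l != k) || (j == N.+1) -> a k i l j = false.
  move=> hl hj hb hlk; apply: zA => //.
    by move: hb hlk; rewrite /beA; case: ifP => // /andP[h1 h2] ->; rewrite eqxx /=; lia.
  move: hb hlk; rewrite /beA /sigA; case: (ltnP l K) => //= hlK.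
  case: (leqP j N) => [hjN -> | hjN]; first by rewrite eqxx /=; lia.
  have -> : (j < N) = false by lia.
  by have -> : (j == N) = false by lia.
have := block_row rowA colA balanceA hk' hi.
rewrite nsum3 [X in _ + X]nsum_zero ?addn0; last first.
  by move=> l hl; case: eqP => //= e; rewrite -/(a _ _ _ _) sg ?eqxx ?orbT //.
rewrite (@nsum_only K.+1 k) //; last first.
  move=> l hl ne; apply: nsum_zero => j hj; case: eqP => //= e.
  by rewrite -/(a _ _ _ _) sg ?ne // iW.
rewrite (@nsum_only K.+1 k) //; last first.
  by move=> l hl ne; case: eqP => //= e; rewrite -/(a _ _ _ _) sg ?ne //.
move=> <-; congr (_ + _); last by rewrite /beA hk leqnn eqxx.
by apply: eq_nsum => j hj; rewrite /beA hk ltnW // eqxx.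
Qed.

Lemma full_colA l j : l < K -> j <= N ->
  nsum N (fun i => a l i l j) + a l N l j + a l N.+1 l j = sigA l j.
Proof.
move=> hl hj; have hj' : j < W by lia.
have be1 : beA l j = l by rewrite /beA hl hj.
have := block_col rowA colA balanceA (ltnW hl) hj'; rewrite be1 /alA.
rewrite nsum3 !(@nsum_only K.+1 l) ?eqxx //; try exact: ltnW.
- by move=> k hk ne; rewrite eq_sym (negbTE ne).
- by move=> k hk ne; rewrite eq_sym (negbTE ne).
- by move=> k hk ne; apply: nsum_zero => i _; rewrite eq_sym (negbTE ne).
Qed.

Lemma full_rowB k i : k < K -> N <= i < W ->
  nsum N (fun j => b k i k j) + b k i k.+1 N = rhoB k i.
Proof.
move=> hk /andP[hNi hi]; have hk' := ltnW hk.
have al1 : alB k i = K.-1 - k by rewrite /alB ltnNge hNi hk.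
have := block_row rowB colB balanceB hk' hi; rewrite al1.
have d0 l : l <= K -> beB l N.+1 = 0 /\ sigB l N.+1 = 0.
  move=> hl; rewrite /beB /sigB.
  have -> : (N.+1 == N) = false by lia.
  have -> : (N.+1 < N) = false by lia.
  by case: ifP.
rewrite nsum3 [X in _ + X]nsum_zero ?addn0; last first.
  by move=> l hl; have [h1 h2] := d0 l hl; rewrite zB // andbF.
rewrite (@nsum_only K.+1 k) //; last first.
  move=> l hl ne; apply: nsum_zero => j hj; rewrite /beB hj.
  case: (ltnP l K) => hlK.
    by have -> : (K.-1 - l == K.-1 - k) = false by lia.
  rewrite zB ?andbF //; first exact: iW.
    by rewrite /beB hj; lia.
  by rewrite /sigB ltnNge hlK.
rewrite (@nsum_only K.+1 k.+1) //; last first.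
  move=> l hl ne; rewrite /beB ltnn eqxx /=; case: posnP => [l0|l0].
    rewrite zB ?andbF //; first by rewrite /beB ltnn eqxx l0.
    by rewrite /sigB ltnn eqxx l0 /= if_same.
  case: (ltnP l K) => hlK.
    by have -> : (K - l == K.-1 - k) = false by lia.
  rewrite zB ?andbF //; first by rewrite /beB ltnn eqxx l0 /=; lia.
  by rewrite /sigB ltnNge hlK.
move=> <-; congr (_ + _).
  by apply: eq_nsum => j hj; rewrite /beB hj eqxx.
rewrite /beB ltnn eqxx /=.
by have -> : (K - k.+1 == K.-1 - k) = true by lia.
Qed.

(** The labels of colour B are shifted so that R_k meets the columns of the previous stage; this is
    the only link from one stage to the next. *)
Lemma full_rowBR k i : 0 < k <= K -> i < N ->
  nsum N (fun j => b k i k.-1 j) + b k i k N = rhoB k i.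
Proof.
move=> /andP[k0 hk] hi; have hiW := iW hi.
have al1 : alB k i = K - k by rewrite /alB hi.
have := block_row rowB colB balanceB hk hiW; rewrite al1.
have d0 l : l <= K -> beB l N.+1 = 0 /\ sigB l N.+1 = 0.
  move=> hl; rewrite /beB /sigB.
  have -> : (N.+1 == N) = false by lia.
  have -> : (N.+1 < N) = false by lia.
  by case: ifP.
rewrite nsum3 [X in _ + X]nsum_zero ?addn0; last first.
  by move=> l hl; have [h1 h2] := d0 l hl; rewrite zB // andbF.
rewrite (@nsum_only K.+1 k.-1); [|lia|]; last first.
  move=> l hl ne; apply: nsum_zero => j hj; rewrite /beB hj.
  case: (ltnP l K) => hlK.
    by have -> : (K.-1 - l == K - k) = false by lia.
  rewrite zB ?andbF //; first exact: iW.
    by rewrite /beB hj; lia.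
  by rewrite /sigB ltnNge hlK.
rewrite (@nsum_only K.+1 k) //; last first.
  move=> l hl ne; rewrite /beB ltnn eqxx /=; case: posnP => [l0|l0].
    rewrite zB ?andbF //; first by rewrite /beB ltnn eqxx l0.
    by rewrite /sigB ltnn eqxx l0 /= if_same.
  by have -> : (K - l == K - k) = false by lia.
move=> <-; congr (_ + _).
  apply: eq_nsum => j hj; rewrite /beB hj.
  by have -> : (K.-1 - k.-1 == K - k) = true by lia.
by rewrite /beB ltnn eqxx k0 eqxx.
Qed.

Lemma full_colB l j : l < K -> j < N ->
  nsum N (fun i => b l.+1 i l j) + b l N l j + b l N.+1 l j = sigB l j.
Proof.
move=> hl hj; have hj' : j < W by exact: iW.
have be1 : beB l j = K.-1 - l by rewrite /beB hj.
have := block_col rowB colB balanceB (ltnW hl) hj'; rewrite be1.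
rewrite nsum3 (@nsum_only K.+1 l.+1) //; last first.
  move=> k hk ne; apply: nsum_zero => i hi; rewrite /alB hi.
  by have -> : (K.-1 - l == K - k) = false by lia.
rewrite !(@nsum_only K.+1 l) //; try exact: ltnW.
- move=> <-; congr (_ + _ + _).
  + apply: eq_nsum => i hi; rewrite /alB hi.
    by have -> : (K.-1 - l == K - l.+1) = true by lia.
  + by rewrite /alB ltnn hl eqxx.
  + rewrite /alB; have -> : (N.+1 < N) = false by lia.
    by rewrite hl eqxx.
- move=> k hk ne; rewrite /alB.
  have -> : (N.+1 < N) = false by lia.
  by case: ltnP => h; [have -> : (K.-1 - l == K.-1 - k) = false by lia
    | have -> : (K.-1 - l == K) = false by lia].
- move=> k hk ne; rewrite /alB ltnn.
  by case: ltnP => h; [have -> : (K.-1 - l == K.-1 - k) = false by lia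
    | have -> : (K.-1 - l == K) = false by lia].
Qed.

Lemma full_colBc l : 0 < l < K ->
  nsum N (fun i => b l i l N) + b l.-1 N l N + b l.-1 N.+1 l N = J.
Proof.
move=> /andP[l0 hl].
have be1 : beB l N = K - l by rewrite /beB ltnn eqxx l0.
have := block_col rowB colB balanceB (ltnW hl) NW; rewrite be1.
rewrite /sigB hl ltnn eqxx l0 /=.
rewrite nsum3 (@nsum_only K.+1 l) //; last first.
- move=> k hk ne; apply: nsum_zero => i hi; rewrite /alB hi.
  by have -> : (K - l == K - k) = false by lia.
- exact: ltnW.
rewrite !(@nsum_only K.+1 l.-1); try lia.
- move=> h; rewrite -[RHS]h; congr (_ + _ + _).
  + by apply: eq_nsum => i hi; rewrite /alB hi eqxx.
  + rewrite /alB ltnn; have -> : l.-1 < K by lia.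
    by have -> : (K - l == K.-1 - l.-1) = true by lia.
  + rewrite /alB.
    have -> : (N.+1 < N) = false by lia.
    have -> : l.-1 < K by lia.
    by have -> : (K - l == K.-1 - l.-1) = true by lia.
- move=> k hk ne; rewrite /alB.
  have -> : (N.+1 < N) = false by lia.
  by case: ltnP => h; [have -> : (K - l == K.-1 - k) = false by lia
    | have -> : (K - l == K) = false by lia].
- move=> k hk ne; rewrite /alB ltnn.
  by case: ltnP => h; [have -> : (K - l == K.-1 - k) = false by lia
    | have -> : (K - l == K) = false by lia].
Qed.

Definition nA k j : nat := a k N k j + a k N.+1 k j.

Lemma link0A i : i < W -> a 0 i 0 N = false.
Proof. by move=> hi; apply: zA => //; rewrite /beA /sigA ?ltnn ?eqxx ?if_same //= if_same. Qed.

(** For positive [k] the cell belongs to the forced staircase of colour B, as [K.-1 - k] < [K - k],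
    so it cannot be A. For [k] equal to 0 the link column has no surplus in A. *)
Lemma test_linkA k i : k < K -> N <= i < W -> a k i k N = false.
Proof.
move=> hk /andP[hN hi]; case: (posnP k) => [->|k0]; first exact: link0A.
have hk' := ltnW hk; have [h _] := fB hk' hi hk' NW.
have {h} : b k i k N.
  have iN : (i < N) = false by rewrite ltnNge hN.
  by apply: h; rewrite /alB /beB ltnn eqxx k0 iN hk /=; lia.
by have := excl hk' hi hk' NW; case: (b k i k N); case: (a k i k N).
Qed.

(** Here the staircase of colour A occupies the cell, except in the last stage, where the next link
    column is empty in B. *)
Lemma test_linkB k i : k < K -> N <= i < W -> b k i k.+1 N = false.
Proof.
move=> hk /andP[hN hi]; have hk' := ltnW hk.
case: (ltnP k.+1 K) => hk1; last first.
  apply: zB => //; first by rewrite /beB ltnn eqxx /=; lia.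
  by rewrite /sigB ltnNge hk1.
have [h _] := fA hk' hi (ltnW hk1) NW.
have {h} : a k i k.+1 N by apply: h; rewrite /alA /beA hk1 leqnn.
by have := excl hk' hi (ltnW hk1) NW; case: (b k i k.+1 N); case: (a k i k.+1 N).
Qed.

Lemma filled (f g : nat -> bool) n : nsum n (fun j => f j) + nsum n (fun j => g j) = n ->
  (forall j, j < n -> f j + g j <= 1) -> forall j, j < n -> f j + g j = 1.
Proof.
move=> h h1 j hj.
have H : forall j, j < n -> f j || g j.
  apply: nsum_full; rewrite -[RHS]h -nsumD; apply: eq_nsum => i hi.
  by have := h1 i hi; case: (f i); case: (g i).
by have := H j hj; have := h1 j hj; case: (f j); case: (g j).
Qed.

(** No surplus is spent on link columns, and the surpluses of the two colours in a test row add up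
    to the number [N] of its free cells. *)
Lemma test_filled k i j : k < K -> N <= i < W -> j < N -> a k i k j + b k i k j = 1.
Proof.
move=> hk hi hj; have /andP[hN hiW] := hi; have hk' := ltnW hk.
apply: (@filled (a k i k) (b k i k) N) => //.
  have := full_rowA hk hiW; have := full_rowB hk hi.
  rewrite test_linkA // test_linkB // !addn0 => -> ->.
  have iN : (i < N) = false by rewrite ltnNge hN.
  rewrite /rhoA /rhoB iN hk /=; have := clause_size_le k; have := S0 hk.
  by case: eqP => _; lia.
by move=> l hl; apply: excl => //; exact: iW.
Qed.

(** Each colour puts [J] tiles on the [N] cells where R_k meets its link column. The A entries there
    form the vector that enters the stage, and the B entries its complement. *)
Lemma link_filled k i : 0 < k < K -> i < N -> a k i k N + b k i k N = 1.
Proof.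
move=> hk hi; have /andP[k0 kK] := hk; have hk' := ltnW kK.
apply: (@filled (fun i => a k i k N) (fun i => b k i k N) N) => //.
  have hB := full_colBc hk.
  have -> : nsum N (fun i => a k i k N) = J.
    have := full_colA kK (leqnn N); rewrite /sigA kK ltnn eqxx k0 /=.
    by rewrite !test_linkA ?leqnn ?leqnSn // !addn0.
  have t i' : N <= i' < W -> b k.-1 i' k N = false.
    by move=> h; rewrite -[in X in b _ _ X _](prednK k0); apply: test_linkB => //; lia.
  by rewrite !t ?leqnn ?leqnSn // !addn0 in hB; rewrite hB addnn.
by move=> l hl; apply: excl => //; exact: iW.
Qed.

Lemma suf_bool_compl m (f : nat -> nat) c (g : nat -> nat) :
  (forall i, i < N -> f i + g i = c) -> suf N m f + suf N m g = (N - m) * c.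
Proof. by move=> h; rewrite -sufD -suf_cst; exact: eq_suf. Qed.

(** In the A block of stage [k] a row lacks its link entry and a column lacks its test entries, so
    [dominance] bounds [nA k] minus [S k] by the vector in the link column of stage [k]. *)
Lemma nA_dom k m : 0 < k < K -> m <= N ->
  suf N m (nA k) <= suf N m (fun i => a k i k N) + suf N m (fun j => S k j).
Proof.
move=> hk hm; have /andP[k0 kK] := hk.
have := @dominance N m (fun i j => a k i k j) (fun i => a k i k N) (nA k)
  (fun=> 1) (fun j => 1 + S k j) hm.
rewrite sufD !suf_cst => H.
suff : (N - m) * 1 + suf N m (nA k) <= suf N m (fun i => a k i k N) +
  ((N - m) * 1 + suf N m (fun j => S k j)) by lia.
apply: H.
  move=> i hi; rewrite full_rowA ?iW // /rhoA hi kK.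
  have -> : (k == 0) = false by lia.
  by rewrite addn1.
move=> j hj; rewrite /nA addnA full_colA //; last exact: ltnW.
by rewrite /sigA kK hj; lia.
Qed.

(** Stage 0 has no link vector, but its row sums i + [i even] are those left by a vector that is 1
    exactly on odd coordinates: the chain starts as if every variable were false. *)
Lemma nA_dom0 m : m <= N ->
  suf N m (fun i => ~~ odd i) + suf N m (nA 0) <= (N - m) + suf N m (fun j => S 0 j).
Proof.
move=> hm.
have := @dominance N m (fun i j => a 0 i 0 j) (fun=> 0) (nA 0)
  (fun i => ~~ odd i) (fun j => 1 + S 0 j) hm.
rewrite sufD !suf_cst muln0 muln1 add0n; apply.
  move=> i hi; have := full_rowA K0 (iW hi); rewrite link0A ?iW // !addn0 => ->.
  by rewrite /rhoA hi.
move=> j hj; rewrite /nA addnA full_colA //; last exact: ltnW.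
by rewrite /sigA K0 hj; lia.
Qed.

Let nB k j : nat := b k N k j + b k N.+1 k j.

Let nAB k m : k < K -> suf N m (nA k) + suf N m (nB k) = (N - m) * 2.
Proof.
move=> hk; apply: suf_bool_compl => j hj.
have i1 : N <= N < W by lia.
have i2 : N <= N.+1 < W by lia.
by have := test_filled hk i1 hj; have := test_filled hk i2 hj; rewrite /nA /nB; lia.
Qed.

(** Colour B holds the complements, 2 - [nA] in the test rows and 1 minus the link vector, so
    [dominance] for the B block gives the inequality in the other direction, now against the link
    vector of the next stage. *)
Lemma nB_dom k m : k.+1 < K -> m <= N ->
  suf N m (fun i => a k.+1 i k.+1 N) + suf N m (fun j => S k j) <= suf N m (nA k).
Proof.
move=> hk hm; have kK := ltnW hk.
have := @dominance N m (fun i j => b k.+1 i k j) (fun i => b k.+1 i k.+1 N) (nB k)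
  (fun=> 1) (fun j => 1 + ~~ S k j) hm.
have e1 := nAB m kK.
have e2 : suf N m (fun i => a k.+1 i k.+1 N) + suf N m (fun i => b k.+1 i k.+1 N) = (N - m) * 1.
  by apply: suf_bool_compl => i hi; apply: link_filled; rewrite ?hk.
have e3 : suf N m (fun j => S k j) + suf N m (fun j => ~~ S k j) = (N - m) * 1.
  by apply: suf_bool_compl => i hi; case: (S k i).
rewrite sufD !suf_cst => H.
suff : (N - m) * 1 + suf N m (nB k) <=
   suf N m (fun i => b k.+1 i k.+1 N) + ((N - m) * 1 + suf N m (fun j => ~~ S k j)) by lia.
apply: H.
  by move=> i hi; have := @full_rowBR k.+1 i (ltnW hk) hi; rewrite /rhoB hi hk addn1.
move=> j hj; rewrite /nB addnA full_colB //.
by rewrite /sigB kK hj; lia.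
Qed.

(** The rows R_K have no link entry; their sums i + [i even] act as an outgoing vector that is 1
    exactly on even coordinates, with every variable true. *)
Lemma nB_domK m : m <= N ->
  suf N m (fun i => ~~ odd i) + suf N m (fun j => S K.-1 j) <= suf N m (nA K.-1).
Proof.
move=> hm; have kK : K.-1 < K by lia.
have := @dominance N m (fun i j => b K i K.-1 j) (fun=> 0) (nB K.-1)
  (fun i => ~~ odd i) (fun j => 1 + ~~ S K.-1 j) hm.
have e1 := nAB m kK.
have e3 : suf N m (fun j => S K.-1 j) + suf N m (fun j => ~~ S K.-1 j) = (N - m) * 1.
  by apply: suf_bool_compl => i hi; case: (S _ i).
rewrite sufD !suf_cst => H.
suff : suf N m (fun i => ~~ odd i) + suf N m (nB K.-1) <=
   (N - m) * 0 + ((N - m) * 1 + suf N m (fun j => ~~ S K.-1 j)) by lia.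
apply: H.
  move=> i hi; have := @full_rowBR K i; rewrite K0 leqnn /= => /(_ isT hi).
  have -> : b K i K N = false.
    apply: zB => //; rewrite ?iW //; first by rewrite /beB ltnn eqxx K0 subnn.
    by rewrite /sigB ltnn.
  move=> ->; rewrite /rhoB hi ltnn.
  by have -> : (K == 0) = false by lia.
move=> j hj; have := @full_colB K.-1 j kK hj; rewrite prednK // => h.
by rewrite /nB addnA h /sigB kK hj; lia.
Qed.

Lemma suf_even q : q <= J -> suf N q.*2 (fun i => ~~ odd i) = J - q.
Proof.
suff h d : d <= J -> suf N (J - d).*2 (fun i => ~~ odd i) = d.
  by move=> hq; have := h (J - q) (leq_subr _ _); rewrite subKn.
elim: d => [_|d IH hd]; first by rewrite subn0 /suf big_geq.
rewrite suf_rec; last lia.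
rewrite suf_rec; last lia.
have -> : (J - d.+1).*2.+2 = (J - d).*2 by lia.
by rewrite IH /= ?odd_double //=; lia.
Qed.

Lemma suf_odd q : q < J -> suf N q.*2.+1 (fun i => ~~ odd i) = J - q.+1.
Proof.
move=> hq; rewrite suf_rec; last lia.
by rewrite -doubleS suf_even //= odd_double.
Qed.

Lemma gadget_sound : exists X : nat -> nat -> bool,
  (forall k q, k.+1 < K -> q < J -> X k q -> X k.+1 q) /\
  (forall k, k < K -> exists2 j, j < N & S k j && ~~ lit (X k) j).
Proof.
(* [F k] gives the suffix sums of the vector of stage [k]; the truncated subtraction is exact by the
   lower bounds from colour B. The link vectors lie between consecutive [F], whence [Fdec]. *)
pose F k m := suf N m (nA k) - suf N m (fun j => S k j).
have FS k m : k < K -> m <= N -> suf N m (nA k) = F k m + suf N m (fun j => S k j).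
  move=> hk hm; rewrite /F subnK //; case: (ltnP k.+1 K) => hk1.
    exact: leq_trans (leq_addl _ _) (nB_dom hk1 hm).
  have -> : k = K.-1 by lia.
  exact: leq_trans (leq_addl _ _) (nB_domK hm).
have Fdec k m : k.+1 < K -> m <= N -> F k.+1 m <= F k m.
  move=> hk hm; have := nA_dom (k := k.+1) hk hm; have := nB_dom hk hm.
  have := FS k.+1 m hk hm; have := FS k m (ltnW hk) hm; lia.
have Fle k m : k < K -> m <= N -> F k m <= F 0 m.
  elim: k => // k IH hk hm; exact: leq_trans (Fdec _ _ hk hm) (IH (ltnW hk) hm).
have Fge k m : k < K -> m <= N -> F K.-1 m <= F k m.
  move=> hk hm; have [d ->] : exists d, k = K.-1 - d by exists (K.-1 - k); lia.
  elim: d => [|d IH]; first by rewrite subn0.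
  case: (ltnP d K.-1) => hd; last by have -> : K.-1 - d.+1 = K.-1 - d by lia.
  apply: leq_trans IH _; have -> : K.-1 - d = (K.-1 - d.+1).+1 by lia.
  by apply: Fdec => //; lia.
(* At even positions the two ends have equal suffix sums, so all stages agree there and each pair of
   coordinates has sum 1. *)
have E2 k q : k < K -> q <= J -> F k q.*2 = J - q.
  move=> hk hq; have hm : q.*2 <= N by lia.
  have := Fle _ _ hk hm; have := Fge _ _ hk hm.
  have := nA_dom0 hm; have := nB_domK hm.
  rewrite (FS 0) // (FS K.-1) //; last lia.
  rewrite suf_even //; lia.
have E1 k q : k < K -> q < J -> J - q.+1 <= F k q.*2.+1 <= J - q.
  move=> hk hq; have hm : q.*2.+1 <= N by lia.
  have := Fle _ _ hk hm; have := Fge _ _ hk hm.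
  have := nA_dom0 hm; have := nB_domK hm.
  rewrite (FS 0) // (FS K.-1) //; last lia.
  rewrite suf_odd //; lia.
(* One bit of freedom per pair remains: the suffix from 2q + 1 has its smaller value exactly when
   the negative coordinate is 0. *)
pose X k q := F k q.*2.+1 == J - q.+1.
have nAE k j : k < K -> j < N -> nA k j = S k j + lit (X k) j.
  move=> hk hj; pose q := j./2; have hq : q < J by rewrite /q; lia.
  have := E1 k q hk hq; have := E2 k q hk (ltnW hq); have := E2 k q.+1 hk hq.
  have := FS k j hk (ltnW hj); have := FS k j.+1 hk hj.
  rewrite (suf_rec (nA k) hj) (suf_rec (fun j => S k j) hj) /lit -/q.
  have := odd_double_half j; rewrite -/q; case: (odd j) => /= ej.
    have -> : j.+1 = q.+1.*2 by lia.
    have -> : j = q.*2.+1 by lia.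
    by rewrite /X; case: eqP => /= e; lia.
  have -> : j = q.*2 by lia.
  by rewrite /X; case: eqP => /= e; lia.
exists X; split.
  move=> k q hk hq; rewrite /X => /eqP e; have hm : q.*2.+1 <= N by lia.
  by have := Fdec _ _ hk hm; have := E1 k.+1 q hk hq; lia.
move=> k hk; have i2 : N <= N.+1 < W by lia.
have hs := full_rowA hk N1W; rewrite (test_linkA hk i2) addn0 /rhoA hk in hs.
have e1 : (N.+1 < N) = false by lia.
have e2 : (N.+1 == N) = false by lia.
rewrite e1 e2 in hs; case: (boolP (bex N (fun j => S k j && ~~ lit (X k) j))).
  by case/bexP => j hj h; exists j.
(* If every tested literal were 1, both test rows would be A on all of S, which exceeds the sum of
   the second one. *)
move=> hn; have : clause_size k <= (clause_size k).-1.
  rewrite -hs; apply: leq_nsum => j hj; case e: (S k j) => //.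
  have := nAE k j hk hj; rewrite e.
  have -> : lit (X k) j.
    by apply: contraR hn => hl; apply/bexP; exists j => //; rewrite e hl.
  by rewrite /nA; case: (a k N.+1 k j) => //; case: (a k N k j).
by have := S0 hk; lia.
Qed.

End Soundness.

(** * Completeness: filling the gadget from one assignment, kept constant along the chain *)

Section Completeness.
Variables (X : nat -> bool) (w : nat -> nat).
Hypothesis wP : forall k, k < K -> [/\ w k < N, S k (w k) & ~~ lit X (w k)].

Let v := lit X.

(** At either end no link cell can absorb the choice, so each even row places its extra one in
    column [i] or [i + 1] and thereby selects one coordinate of the pair. *)
Definition edge_block (Y : nat -> bool) i j : bool := (j < i) || ~~ odd i && (j == i + Y i./2).
Definition diag_block (u : nat -> bool) i j : bool := (j < i) || (j == i) && u i.
(** [w k] is a tested coordinate of value 0. Moving it from the second row to the first keeps the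
    column counts at v + S and gives row sums [J.+1] and |S| - 1. *)
Definition testA k i j : bool := if i == N then v j || (j == w k) else S k j && (j != w k).

(** Only the free cells are described here; [gadget_a] adds the staircase. *)
Definition locA k i l j : bool :=
  [&& l == k, k < K &
   if i < N then
     if j < N then if k == 0 then edge_block X i j else diag_block (fun i => ~~ v i) i j
     else [&& j == N, 0 < k & v i]
   else (j < N) && testA k i j].

Definition locB k i l j : bool :=
  if i < N then
    if j < N then [&& 0 < k, l == k.-1 &
      if k == K then edge_block (fun q => ~~ X q) i j else diag_block v i j]
    else [&& j == N, l == k, 0 < k, k < K & ~~ v i]
  else [&& l == k, k < K, j < N & ~~ testA k i j].

Lemma edge_row Y i : i < N -> nsum N (fun j => edge_block Y i j) = i + ~~ odd i.
Proof.
move=> hi; have hp : ~~ odd i -> i + Y i./2 < N by case: (Y _); lia.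
rewrite -[X in X + _](nsum_ltn (ltnW hi)) -(nsum_pred1 hp) -nsumD.
apply: eq_nsum => j _; rewrite /edge_block; case: (ltnP j i) => hj //=.
by case: eqP => [e|_]; [lia|rewrite andbF].
Qed.

Lemma edge_col Y j : j < N -> nsum N (fun i => edge_block Y i j) = N.-1 - j + ~~ lit Y j.
Proof.
move=> hj; rewrite -(nsum_gtn hj).
rewrite -(@nsum_pred1 N (j./2.*2) (~~ lit Y j)) -?nsumD; last by lia.
apply: eq_nsum => i _; rewrite /edge_block /lit.
case: (ltnP j i) => hij /=; first by rewrite andbC; case: eqP => //=; lia.
rewrite add0n; congr nat_of_bool; have ej := odd_double_half j; have ei := odd_double_half i.
case: (i =P j./2.*2) => [e|ne].
  have -> : i./2 = j./2 by lia.
  have -> : odd i = false by lia.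
  by move: ej e; case: (odd j); case: (Y _) => /=; lia.
rewrite andbF; case: (boolP (odd i)) => //= oi; apply/negbTE/negP => /eqP e.
by apply: ne; move: e; case: (Y _); lia.
Qed.

Lemma diag_row u i : i < N -> nsum N (fun j => diag_block u i j) = i + u i.
Proof.
move=> hi; have hp : u i -> i < N by [].
rewrite -[X in X + _](nsum_ltn (ltnW hi)) -(nsum_pred1 hp) -nsumD.
apply: eq_nsum => j _; rewrite /diag_block; case: (ltnP j i) => hj /=.
  by case: eqP => [e|_]; [lia|rewrite andbF].
by rewrite andbC.
Qed.

Lemma diag_col u j : j < N -> nsum N (fun i => diag_block u i j) = N.-1 - j + u j.
Proof.
move=> hj; rewrite -(nsum_gtn hj) -(@nsum_pred1 N j (u j)) // -nsumD.
apply: eq_nsum => i _; rewrite /diag_block; case: (j =P i) => [->|ne] /=.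
  by rewrite ltnn eqxx andbT.
by rewrite orbF [i == j]eq_sym; case: eqP ne => // _ _; rewrite andbF addn0.
Qed.

Lemma nsum_lit : nsum N (fun j => v j) = J.
Proof.
rewrite nsum_double -[RHS]muln1 -nsum_cst; apply: eq_nsum => q _.
rewrite /v /lit /= odd_double /= doubleK uphalf_double.
by case: (X q).
Qed.

Lemma test_row k i : k < K -> nsum N (fun j => testA k i j) =
  if i == N then J.+1 else (clause_size k).-1.
Proof.
move=> hk; have [h1 h2 h3] := wP hk; rewrite /testA; case: ifP => _.
  transitivity (nsum N (fun j => v j) + nsum N (fun j => true && (j == w k))); last first.
    by rewrite nsum_lit nsum_pred1 // addn1.
  rewrite -nsumD; apply: eq_nsum => j _; case: eqP => [->|_] /=; last by rewrite orbF addn0.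
  by rewrite -/v in h3; rewrite (negbTE h3).
have : nsum N (fun j => S k j && (j != w k)) + nsum N (fun j => true && (j == w k)) = clause_size k.
  rewrite -nsumD; apply: eq_nsum => j _.
  by case: eqP => [->|_] /=; rewrite ?h2 ?andbT ?addn0.
by rewrite nsum_pred1 //; lia.
Qed.

Lemma test_sum k j : k < K -> ~~ v j + testA k N j + testA k N.+1 j = 1 + S k j.
Proof.
move=> hk; have [h1 h2 h3] := wP hk; rewrite -/v in h3; rewrite /testA eqxx.
have -> : (N.+1 == N) = false by lia.
by case: eqP => [->|_] /=; rewrite ?(negbTE h3) ?h2 //; case: (v j); case: (S k j).
Qed.

Lemma locA_lab k i l j : locA k i l j -> beA l j = alA k i.
Proof.
rewrite /locA /beA /alA => /and3P[/eqP -> ->]; case: (ltnP j N) => hj /=; first by rewrite (ltnW hj).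
by case: ifP => // _ /andP[/eqP-> _]; rewrite leqnn.
Qed.

Lemma locB_lab k i l j : i < W -> locB k i l j -> beB l j = alB k i.
Proof.
move=> hi; rewrite /locB /beB /alB; case: (ltnP i N) => hiN; case: (ltnP j N) => hj.
- by move=> /and3P[k0 /eqP -> _]; lia.
- by move=> /and5P[/eqP-> /eqP -> k0 _ _]; rewrite eqxx k0.
- by move=> /and3P[/eqP -> -> _].
- by rewrite andbF andbF.
Qed.

Lemma locA_row k i : k <= K -> i < W ->
  nsum K.+1 (fun l => nsum W (fun j => locA k i l j)) = rhoA k i.
Proof.
move=> hk hi; rewrite (@nsum_only K.+1 k) //; last first.
  by move=> l _ /negbTE h; apply: nsum_zero => j _; rewrite /locA h.
rewrite !nsumS /locA /rhoA eqxx ltnn eqxx /=.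
have -> : (N.+1 == N) = false by lia.
have -> : (N.+1 < N) = false by lia.
case: (ltnP k K) => hkK /=; last first.
  rewrite nsum_zero // addn0.
  by case: ifP => //; have -> : (k == 0) = false by lia.
case: (ltnP i N) => hiN; rewrite !addn0; last first.
  by rewrite -(test_row i hkK); apply: eq_nsum => j hj; rewrite hj.
case: (posnP k) => [k0|k0] /=.
  by rewrite addn0 -(edge_row X hiN); apply: eq_nsum => j hj; rewrite hj.
have -> : nsum N (fun j => if j < N then diag_block (fun i => ~~ v i) i j else (j == N) && v i) = i + ~~ v i.
  by have /= <- := diag_row (fun i => ~~ v i) hiN; apply: eq_nsum => j hj; rewrite hj.
by case: (v i); lia.
Qed.

Lemma locA_col l j : l <= K -> j < W ->
  nsum K.+1 (fun k => nsum W (fun i => locA k i l j)) = sigA l j.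
Proof.
move=> hl hj; rewrite (@nsum_only K.+1 l) //; last first.
  by move=> k _ h; apply: nsum_zero => i _; rewrite /locA eq_sym (negbTE h).
rewrite !nsumS /locA /sigA eqxx ltnn /=.
have -> : (N.+1 < N) = false by lia.
case: (ltnP l K) => hlK /=; last by rewrite nsum_zero.
case: (ltnP j N) => hjN /=; last first.
  rewrite !addn0; case: eqP => [ej|nj] /=; last first.
    by apply: nsum_zero => i hi; rewrite hi.
  case: (posnP l) => [l0|l0] /=; first by apply: nsum_zero => i hi; rewrite hi.
  by rewrite -[RHS]nsum_lit; apply: eq_nsum => i hi; rewrite hi.
have -> : nsum N (fun i => if i < N then if l == 0 then edge_block X i j
   else diag_block (fun i => ~~ v i) i j else testA l i j) = N.-1 - j + ~~ v j.
  case: (posnP l) => [l0|l0] /=.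
    by rewrite -(edge_col X hjN); apply: eq_nsum => i hi; rewrite hi.
  by have /= <- := diag_col (fun i => ~~ v i) hjN; apply: eq_nsum => i hi; rewrite hi.
by have := test_sum j hlK; lia.
Qed.

Lemma locB_row k i : k <= K -> i < W ->
  nsum K.+1 (fun l => nsum W (fun j => locB k i l j)) = rhoB k i.
Proof.
move=> hk hi; rewrite nsum3 /locB /rhoB ltnn eqxx /=.
have -> : (N.+1 == N) = false by lia.
have -> : (N.+1 < N) = false by lia.
rewrite [X in _ + X]nsum_zero ?addn0; last by move=> l _; case: ifP => // _; rewrite !andbF.
case: (ltnP i N) => hiN; last first.
  rewrite [X in _ + X]nsum_zero ?addn0; last by move=> l _; rewrite !andbF.
  rewrite (@nsum_only K.+1 k) //; last first.
    by move=> l _ h; apply: nsum_zero => j _; rewrite (negbTE h).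
  case: (ltnP k K) => hkK /=; last by rewrite nsum_zero // => j _; rewrite andbF.
  have -> : nsum N (fun j => [&& k == k, j < N & ~~ testA k i j]) =
      N - nsum N (fun j => testA k i j).
    by rewrite -nsum_neg; apply: eq_nsum => j hj; rewrite hj eqxx.
  by rewrite test_row //; case: ifP => _ //; lia.
case: (posnP k) => [k0|k0] /=.
  rewrite !nsum_zero // => l _; first by rewrite andbF.
  by apply: nsum_zero => j hj; rewrite hj.
rewrite (@nsum_only K.+1 k.-1); [|lia|]; last first.
  by move=> l _ h; apply: nsum_zero => j hj; rewrite hj (negbTE h).
rewrite (@nsum_only K.+1 k) //; last by move=> l _ h; rewrite (negbTE h).
rewrite !eqxx /=; case: (ltnP k K) => hkK /=.
  have -> : nsum N (fun j => if j < N then if k == K then edge_block (fun q => ~~ X q) i j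
     else diag_block v i j else [&& j == N, k.-1 == k & ~~ v i]) = i + v i.
    rewrite -(diag_row v hiN); apply: eq_nsum => j hj; rewrite hj.
    by have -> : (k == K) = false by lia.
  by case: (v i); lia.
have -> : (k == K) = true by lia.
by rewrite addn0 -(edge_row (fun q => ~~ X q) hiN); apply: eq_nsum => j hj; rewrite hj.
Qed.

Lemma lit_neg Y j : lit (fun q => ~~ Y q) j = ~~ lit Y j.
Proof. by rewrite /lit; case: (odd j). Qed.

Lemma locB_col l j : l <= K -> j < W ->
  nsum K.+1 (fun k => nsum W (fun i => locB k i l j)) = sigB l j.
Proof.
move=> hl hj; rewrite nsum3 /locB /sigB ltnn /=.
have -> : (N.+1 < N) = false by lia.
case: (ltnP j N) => hjN /=; last first.
  rewrite [X in _ + X]nsum_zero ?addn0; last by move=> k _; rewrite !andbF.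
  rewrite [X in _ + X]nsum_zero ?addn0; last by move=> k _; rewrite !andbF.
  case: eqP => [ej|nj] /=; last first.
    rewrite if_same; apply: nsum_zero => k _; apply: nsum_zero => i hi; by rewrite hi.
  rewrite (@nsum_only K.+1 l) //; last first.
    by move=> k _ h; apply: nsum_zero => i hi; rewrite hi eq_sym (negbTE h).
  rewrite eqxx /=; case: (ltnP l K) => hlK; last first.
    by apply: nsum_zero => i hi; rewrite hi !andbF.
  case: posnP => [l0|l0] /=; first by apply: nsum_zero => i hi; rewrite hi.
  rewrite -[RHS](_ : N - nsum N (fun j => v j) = J); last by rewrite nsum_lit; lia.
  by rewrite -nsum_neg; apply: eq_nsum => i hi; rewrite hi.
rewrite [X in _ + X + _](@nsum_only K.+1 l) //; last first.
  by move=> k _ h; rewrite eq_sym (negbTE h).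
rewrite [X in _ + _ + X](@nsum_only K.+1 l) //; last first.
  by move=> k _ h; rewrite eq_sym (negbTE h).
rewrite eqxx /=; case: (ltnP l K) => hlK /=; last first.
  rewrite !addn0; apply: nsum_zero => k hk; apply: nsum_zero => i hi; rewrite hi.
  by case: (posnP k) => //= k0; have -> : (l == k.-1) = false by lia.
rewrite (@nsum_only K.+1 l.+1) //; last first.
  move=> k _ h; apply: nsum_zero => i hi; rewrite hi.
  by case: (posnP k) => //= k0; have -> : (l == k.-1) = false by lia.
rewrite /= eqxx /=.
have -> : nsum N (fun i => if i < N then if l.+1 == K then edge_block (fun q => ~~ X q) i j
   else diag_block v i j else [&& l == l.+1, l.+1 < K & ~~ testA l.+1 i j]) = N.-1 - j + v j.
  case: eqP => _.
    rewrite -[v j]negbK -lit_neg -(edge_col (fun q => ~~ X q) hjN).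
    by apply: eq_nsum => i hi; rewrite hi.
  by rewrite -(diag_col v hjN); apply: eq_nsum => i hi; rewrite hi.
have := test_sum j hlK; case: (v j); case: (testA l N j); case: (testA l N.+1 j);
  case: (S l j) => //=; lia.
Qed.

Definition gadget_a (p q : nat) : bool :=
  (flat W alA p < flat W beA q) || locA (p %/ W) (p %% W) (q %/ W) (q %% W).
Definition gadget_b (p q : nat) : bool :=
  (flat W alB p < flat W beB q) || locB (p %/ W) (p %% W) (q %/ W) (q %% W).

Lemma gadget_complete : gadget gadget_a gadget_b.
Proof.
have dv p : p < M -> p %/ W <= K by move=> h; rewrite -ltnS ltn_divLR.
have md p : p %% W < W by exact: ltn_pmod.
have blk f : nsum M (fun q => f (q %/ W) (q %% W)) = nsum K.+1 (fun l => nsum W (f l)).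
  rewrite nsum_block; apply: eq_nsum => l _; apply: eq_nsum => j hj.
  by rewrite divnMDl // divn_small // addn0 modnMDl modn_small.
split.
- move=> p q hp hq; rewrite /gadget_a /gadget_b /flat.
  have := dv _ hp; have := dv _ hq; have := md p; have := md q.
  move: (p %/ W) (p %% W) (q %/ W) (q %% W) => k i l j hj hi hl hk {hp hq}.
  apply/negP => /andP[/orP[hA|hA] /orP[hB|hB]].
  + by move: hA hB; rewrite /alA /beA /alB /beB; do !case: ifP; lia.
  + move: hA hB; rewrite /alA /beA /locB; case: ifP => // _ hkl.
    case: ifP => _; last by case/andP => /eqP; lia.
    case: ifP => _; first by case/and3P => _ /eqP; lia.
    by case/and3P => _ /eqP; lia.
  + move: hA hB; rewrite /alB /beB /locA => /and3P[/eqP -> hkK].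
    case: (ltnP i N) => hiN; case: (ltnP j N) => hjN //=.
    - by move=> _; lia.
    - by case/and3P => /eqP -> k0 _; rewrite eqxx k0 ltnn.
    - by rewrite hkK; lia.
  + move: hA hB; rewrite /locA /locB => /and3P[/eqP -> hkK].
    case: (ltnP i N) => hiN; case: (ltnP j N) => hjN //=.
    - by move=> _ /and3P[k0 /eqP]; lia.
    - by case/and3P => _ _ ->; rewrite !andbF.
    - by move=> ->; rewrite !andbF.
- move=> p hp; split; rewrite /row_sum.
  + rewrite -[flat W rhoA p]/(rhoA (p %/ W) (p %% W)) -(locA_row (dv _ hp) (md p)) -(blk (fun l j => nat_of_bool (locA (p %/ W) (p %% W) l j))) -nsumD.
    apply: eq_nsum => q hq; rewrite /gadget_a; case: ltnP => //= h1.
    case e: (locA _ _ _ _) => //; have := locA_lab e; rewrite /flat in h1 *; lia.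
  + rewrite -[flat W rhoB p]/(rhoB (p %/ W) (p %% W)) -(locB_row (dv _ hp) (md p)) -(blk (fun l j => nat_of_bool (locB (p %/ W) (p %% W) l j))) -nsumD.
    apply: eq_nsum => q hq; rewrite /gadget_b; case: ltnP => //= h1.
    case e: (locB _ _ _ _) => //; have := locB_lab (md _) e; rewrite /flat in h1 *; lia.
- move=> q hq; split; rewrite /col_sum.
  + rewrite -[flat W sigA q]/(sigA (q %/ W) (q %% W)) -(locA_col (dv _ hq) (md q)) -(blk (fun k i => nat_of_bool (locA k i (q %/ W) (q %% W)))) -nsumD.
    apply: eq_nsum => p hp; rewrite /gadget_a; case: ltnP => //= h1.
    case e: (locA _ _ _ _) => //; have := locA_lab e; rewrite /flat in h1 *; lia.
  + rewrite -[flat W sigB q]/(sigB (q %/ W) (q %% W)) -(locB_col (dv _ hq) (md q)) -(blk (fun k i => nat_of_bool (locB k i (q %/ W) (q %% W)))) -nsumD.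
    apply: eq_nsum => p hp; rewrite /gadget_b; case: ltnP => //= h1.
    case e: (locB _ _ _ _) => //; have := locB_lab (md _) e; rewrite /flat in h1 *; lia.
Qed.

End Completeness.

End Gadget.

(** * Constraint systems as gadgets *)

Section Csp.
Variables (ns g nc : nat) (scope : nat -> nat -> nat) (forb : nat -> nat -> bool).
Hypothesis ns0 : 0 < ns.
Hypothesis g0 : 0 < g.
Hypothesis scope_lt : forall c l, c < nc -> scope c l < ns.

Definition digit (l v : nat) : nat := (v %/ g ^ l) %% g.
Definition code4 (v0 v1 v2 v3 : nat) : nat := v0 + g * (v1 + g * (v2 + g * v3)).

Lemma code4_lt v0 v1 v2 v3 : v0 < g -> v1 < g -> v2 < g -> v3 < g ->
  code4 v0 v1 v2 v3 < g ^ 4.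
Proof.
move=> h0 h1 h2 h3; rewrite /code4 !expnS expn0 muln1.
have l a b m : a < g -> b < m -> a + g * b < g * m.
  by move=> ha hb; rewrite (leq_trans (n := g + g * b)) ?ltn_add2r // -mulnS leq_mul2l hb orbT.
by apply: (l _ _ _ h0); apply: (l _ _ _ h1); apply: (l _ _ _ h2).
Qed.

Lemma digit_code4 v0 v1 v2 v3 : v0 < g -> v1 < g -> v2 < g -> v3 < g ->
  [/\ digit 0 (code4 v0 v1 v2 v3) = v0, digit 1 (code4 v0 v1 v2 v3) = v1,
      digit 2 (code4 v0 v1 v2 v3) = v2 & digit 3 (code4 v0 v1 v2 v3) = v3].
Proof.
move=> h0 h1 h2 h3; rewrite /digit /code4.
have d a b : a < g -> (a + g * b) %/ g = b.
  by move=> ha; rewrite addnC mulnC divnMDl // divn_small // addn0.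
have m a b : a < g -> (a + g * b) %% g = a.
  by move=> ha; rewrite addnC mulnC modnMDl modn_small.
by rewrite expn0 divn1 !expnS expn0 muln1 !divnMA !d ?m // modn_small.
Qed.

Definition item (c l v : nat) : nat := scope c l * g + digit l v.

(* Coordinate 2 q holds item q and coordinate 2 q + 1 its negation.  The first
   [ns] clauses give every site a value; the others forbid a tuple, those of
   the admissible tuples being the tautology on the first coordinate pair. *)
Definition csp_clause (k j : nat) : bool :=
  if k < ns then odd j && (j./2 %/ g == k)
  else let c := (k - ns) %/ g ^ 4 in let v := (k - ns) %% g ^ 4 in
    if forb c v then
      ~~ odd j && [|| j./2 == item c 0 v, j./2 == item c 1 v,
                      j./2 == item c 2 v | j./2 == item c 3 v]
    else j < 2.

Definition csp_stages : nat := ns + nc * g ^ 4.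
Definition csp_items : nat := ns * g.

Notation K := csp_stages.
Notation J := csp_items.

Lemma csp_stages_gt0 : 0 < K.
Proof. by rewrite /csp_stages addn_gt0 ns0. Qed.

Lemma csp_items_gt0 : 0 < J.
Proof. by rewrite /csp_items muln_gt0 ns0. Qed.

Lemma item_lt c l v : c < nc -> item c l v < J.
Proof.
move=> hc; have hd : digit l v < g by exact: ltn_pmod.
rewrite /item /J (leq_trans (n := scope c l * g + g)) ?ltn_add2l //.
by rewrite -mulSnr leq_mul2r scope_lt ?orbT.
Qed.

Lemma csp_constr_lt k : ns <= k < K -> (k - ns) %/ g ^ 4 < nc.
Proof.
move=> /andP[h1 h2]; rewrite ltn_divLR ?expn_gt0 ?g0 //.
by rewrite /csp_stages in h2; lia.
Qed.

Lemma csp_clause_gt0 k : k < K -> 0 < clause_size J csp_clause k.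
Proof.
move=> hk; rewrite /clause_size lt0n; apply/negP => /eqP /nsum_eq0 h.
suff [j hj hS] : exists2 j, j < J.*2 & csp_clause k j by have := h j hj; rewrite hS.
rewrite /csp_clause; case: ltnP => hkn.
  exists (k * g).*2.+1 => /=; last by rewrite odd_double uphalf_double mulnK ?eqxx.
  have : k.+1 * g <= ns * g by rewrite leq_mul2r hkn orbT.
  by rewrite /J mulSn; lia.
case: (forb _ _); last by exists 0 => //; have := csp_items_gt0; lia.
exists (item ((k - ns) %/ g ^ 4) 0 ((k - ns) %% g ^ 4)).*2.
  by rewrite ltn_double item_lt // csp_constr_lt // hkn.
by rewrite odd_double doubleK eqxx.
Qed.

Definition csp_sat : Prop := exists tau : nat -> nat,
  (forall s, s < ns -> tau s < g) /\
  (forall c, c < nc -> ~~ forb c (code4 (tau (scope c 0)) (tau (scope c 1))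
                                        (tau (scope c 2)) (tau (scope c 3)))).

(** The assignment is read at stage [ns.-1], where the two kinds of clauses meet: items found true
    at earlier stages are still true there, and items found false at later stages were already false
    there. *)
Lemma csp_gadget : csp_sat <-> exists a b, gadget K J csp_clause a b.
Proof.
split=> [[tau [htau hc]]|[a [b hab]]].
  pose X q := tau (q %/ g) == q %% g.
  have XE s v : v < g -> X (s * g + v) = (tau s == v).
    by move=> hv; rewrite /X divnMDl // divn_small // addn0 modnMDl modn_small.
  have ex k : k < K -> has (fun j => csp_clause k j && ~~ lit X j) (iota 0 J.*2).
    move=> hk; rewrite /csp_clause; apply/bexP; case: ltnP => hkn.
      exists (k * g + tau k).*2.+1.
        have : k.+1 * g <= ns * g by rewrite leq_mul2r hkn orbT.
        by have := htau _ hkn; rewrite /J mulSn; lia.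
      rewrite /lit /= odd_double /= uphalf_double divnMDl // divn_small ?htau //.
      by rewrite addn0 eqxx XE ?htau // eqxx.
    set c := _ %/ _; set v := _ %% _.
    have hcn : c < nc by apply: csp_constr_lt; rewrite hkn.
    case hf: (forb c v); last first.
      (* Of the coordinates 0 and 1 the one with value 0 is number [X 0], read as a natural
         number. *)
      have := csp_items_gt0; exists (X 0); first by case: (X 0); lia.
      by rewrite /lit; case e: (X 0) => /=; rewrite e.
    have dl l : digit l v < g by exact: ltn_pmod.
    case: (boolP [&& tau (scope c 0) == digit 0 v, tau (scope c 1) == digit 1 v,
                     tau (scope c 2) == digit 2 v & tau (scope c 3) == digit 3 v]).
      case/and4P => /eqP e0 /eqP e1 /eqP e2 /eqP e3.
      have := hc c hcn; rewrite e0 e1 e2 e3.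
      suff -> : code4 (digit 0 v) (digit 1 v) (digit 2 v) (digit 3 v) = v by rewrite hf.
      rewrite /code4 /digit expn0 divn1.
      have hv : v < g ^ 4 by rewrite ltn_pmod // expn_gt0 g0.
      rewrite [_ %/ _ %% _ in X in _ + _ * (_ + _ * (_ + _ * X))]modn_small; last first.
        by rewrite ltn_divLR ?expn_gt0 ?g0 // -expnS.
      rewrite [g ^ 3]expnSr divnMA [_ + _ * (_ %/ g)]addnC [g * (_ %/ g)]mulnC -divn_eq.
      rewrite [g ^ 2]expnSr divnMA [_ + _ * (_ %/ g)]addnC [g * (_ %/ g)]mulnC -divn_eq.
      by rewrite expn1 [_ + _ * (_ %/ g)]addnC [g * (_ %/ g)]mulnC -divn_eq.
    have ok l : tau (scope c l) != digit l v -> [|| item c l v == item c 0 v,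
        item c l v == item c 1 v, item c l v == item c 2 v | item c l v == item c 3 v] ->
      exists2 i, i < J.*2 & ~~ odd i && [|| i./2 == item c 0 v, i./2 == item c 1 v,
        i./2 == item c 2 v | i./2 == item c 3 v] && ~~ lit X i.
      move=> hne hit; exists (item c l v).*2; first by rewrite ltn_double item_lt.
      by rewrite odd_double doubleK hit /lit odd_double doubleK XE.
    by rewrite !negb_and => /or4P[] /ok; apply; rewrite eqxx ?orbT.
  pose w k := find (fun j => csp_clause k j && ~~ lit X j) (iota 0 J.*2).
  exists (gadget_a K J csp_clause X w), (gadget_b K J csp_clause X w).
  apply: (@gadget_complete K J csp_clause csp_stages_gt0 csp_items_gt0 X w) => k hk.
  have hw := ex k hk; have lw : w k < J.*2 by move: hw; rewrite has_find size_iota.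
  by have := nth_find 0 hw; rewrite nth_iota // add0n => /andP[].
have [X [mono sel]] := gadget_sound csp_stages_gt0 csp_items_gt0 csp_clause_gt0 hab.
have mono' k k' q : k <= k' -> k' < K -> q < J -> X k q -> X k' q.
  move=> hk hk' hq hX; elim: k' hk hk' => [|k' IH]; first by rewrite leqn0 => /eqP <-.
  rewrite leq_eqVlt => /orP[/eqP <- //|hk] hk'.
  by apply: mono => //; apply: IH => //; exact: ltnW.
(* Several items of a site may be true; any choice will do, because the later clauses exclude every
   forbidden tuple of true items. *)
pose tau s := find (fun v => X ns.-1 (s * g + v)) (iota 0 g).
have nsK : ns.-1 < K by rewrite /csp_stages; lia.
have htau s : s < ns -> has (fun v => X ns.-1 (s * g + v)) (iota 0 g).
  move=> hs; have hsK : s < K by rewrite /csp_stages ltn_addr.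
  have [j hj] := sel s hsK; rewrite /csp_clause hs /lit => /andP[/andP[oj /eqP ej]].
  rewrite oj negbK => hX; apply/bexP; exists (j./2 %% g); first exact: ltn_pmod.
  rewrite -ej -divn_eq; apply: mono' hX => //; first lia.
  by move: hj; rewrite -[J.*2]/(J.*2) => hj; lia.
exists tau; split=> [s hs|c hc].
  by have := htau s hs; rewrite has_find size_iota.
have tl s : s < ns -> tau s < g by move=> hs; have := htau s hs; rewrite has_find size_iota.
have tX s : s < ns -> X ns.-1 (s * g + tau s).
  by move=> hs; have := nth_find 0 (htau s hs); rewrite nth_iota ?tl // add0n.
apply/negP; set v := code4 _ _ _ _ => hf.
have hv : v < g ^ 4 by rewrite code4_lt // tl // scope_lt.
have G0 : 0 < g ^ 4 by rewrite expn_gt0 g0.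
pose k := ns + (c * g ^ 4 + v).
have hk : k < K.
  have : c.+1 * g ^ 4 <= nc * g ^ 4 by rewrite leq_mul2r hc orbT.
  by rewrite /k /csp_stages mulSn; lia.
have [j hj] := sel k hk; rewrite /csp_clause.
have -> : (k < ns) = false by rewrite /k; lia.
have -> : k - ns = c * g ^ 4 + v by rewrite /k; lia.
rewrite divnMDl // (divn_small hv) addn0 modnMDl (modn_small hv) hf /lit.
case/andP => /andP[oj hit]; rewrite (negbTE oj) => /negP; apply.
have [d0 d1 d2 d3] := digit_code4 (tl _ (scope_lt 0 hc)) (tl _ (scope_lt 1 hc))
  (tl _ (scope_lt 2 hc)) (tl _ (scope_lt 3 hc)).
apply: (mono' ns.-1) => //; first by rewrite /k; lia.
  by lia.
by case/or4P: hit => /eqP ->; rewrite /item ?d0 ?d1 ?d2 ?d3; apply: tX; exact: scope_lt.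
Qed.

End Csp.

(** * Computation tableaux *)

Section Tableau.
Variables (Sigma : finType) (M : tm (Sigma + bool)%type bool).

Notation nt := (tm_tapes M).+1.
Notation sym := (symbol M).

(* A tableau cell holds the symbols and the heads of all tapes at one position,
   together with the state and the scanned symbols of the whole configuration. *)
Definition tcell : finType :=
  ({ffun 'I_nt -> (sym * bool)} * (tm_state M * {ffun 'I_nt -> sym}))%type.

Implicit Types (v : tcell) (c : config M).

Definition next_cell v1 v2 v3 : {ffun 'I_nt -> sym * bool} * tm_state M :=
  if tm_delta v2.2.1 v2.2.2 is Some (q, a) then
    ([ffun i => (if (v2.1 i).2 then (a i).1 else (v2.1 i).1,
       match (a i).2 with
       | MoveLeft => (v3.1 i).2 | Stay => (v2.1 i).2 | MoveRight => (v1.1 i).2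
       end)], q)
  else (v2.1, v2.2.1).

(** The heads may be far apart, so the state and scanned symbols are copied along the row and
    checked wherever a head stands. The scanned symbols of [v4] are left open here; the windows of
    its own row determine them when needed. *)
Definition window v1 v2 v3 v4 : bool :=
  [&& v1.2 == v2.2, v3.2 == v2.2,
      [forall i, (v2.1 i).2 ==> (v2.2.2 i == (v2.1 i).1)]
    & (v4.1, v4.2.1) == next_cell v1 v2 v3].

Definition cell_at c (z : int) : tcell :=
  ([ffun i => (cfg_content c i z, cfg_head c i == z)],
   (cfg_state c, [ffun i => cfg_content c i (cfg_head c i)])).

Lemma next_cell_at c z :
  next_cell (cell_at c (z - 1)) (cell_at c z) (cell_at c (z + 1)) =
  ((cell_at (step c) z).1, cfg_state (step c)).
Proof.
rewrite /next_cell /step /action /=; case: tm_delta => [[q a]|] //=.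
congr (_, _); apply/ffunP => i; rewrite !ffunE /= eq_sym; congr (_, _).
by case: (a i).2 => /=; rewrite ?addr0 ?ffunE //=; apply/eqP/eqP; lia.
Qed.

Lemma window_cell_at c z :
  window (cell_at c (z - 1)) (cell_at c z) (cell_at c (z + 1)) (cell_at (step c) z).
Proof.
rewrite /window next_cell_at !eqxx /= andbT; apply/forallP => i.
by rewrite !ffunE /=; apply/implyP => /eqP ->.
Qed.

Definition blank_cell v : bool := v.1 == [ffun=> (None, false)].

(* [None]: blank; [Some None]: certificate; [Some (Some a)]: the letter a. *)
Definition start_cell (kd : option (option Sigma)) (h : bool) v v' : bool :=
  [&& v.2.1 == tm_start M, [forall i, (v.1 i).2 == h],
      [forall i, (i != ord0) ==> ((v.1 i).1 == None)]
    & match kd with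
      | None => (v.1 ord0).1 == None
      | Some (Some a) => (v.1 ord0).1 == input_symbol M (inl a)
      | Some None => [|| (v.1 ord0).1 == None, (v.1 ord0).1 == input_symbol M (inr true)
                       | (v.1 ord0).1 == input_symbol M (inr false)]
                     && (((v.1 ord0).1 == None) ==> ((v'.1 ord0).1 == None))
      end].

Definition accept_cell v : bool := (v.1 ord_max).1 == output_symbol M true.

Variables (x : seq Sigma) (T Q : nat).

(** The argument [y] is the left cell of a window; the cell it describes is the middle one, at tape
    position y - T. *)
Definition start_kind (y : nat) : option (option Sigma) :=
  if y < T then None else
  if onth x (y - T) is Some a then Some (Some a) else
  if y - T < size x + Q then Some None else None.

(** A row spans the positions from -T - 1 to T + 1. The two outermost cells have no window of their
    own and must be blank, and acceptance is read at position 0 at time [T]. *)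
Definition tableau_ok (t y : nat) v1 v2 v3 v4 : bool :=
  [&& window v1 v2 v3 v4, (y == 0) ==> blank_cell v1, (y == T.*2) ==> blank_cell v3,
      (t == 0) ==> start_cell (start_kind y) (y == T) v2 v3
    & ((t.+1 == T) && (y == T)) ==> accept_cell v4].

Definition tableau : Prop := exists tau : nat -> nat -> tcell,
  forall t y, t < T -> y < T.*2.+1 ->
    tableau_ok t y (tau t y) (tau t y.+1) (tau t y.+2) (tau t.+1 y.+1).

Variables (V : seq (Sigma + bool) -> bool) (p : {poly nat}).
Hypothesis MV : forall w, computes_within M w [:: V w] p.[size w]%R.
Hypothesis T0 : 0 < T.
Hypothesis TQ : size x + Q <= T.
Hypothesis Tp : forall u : seq bool, size u <= Q -> p.[size x + size u]%R <= T.

(** * Runs of the verifier and tableaux for a fixed certificate *)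

Section Run.
Variable u : seq bool.
Hypothesis hu : size u <= Q.
Let w := pair_word x u.
Let conf t := iter t (@step _ _ M) (init M w).

Let sw : size w = size x + size u.
Proof. by rewrite /w /pair_word size_cat !size_map. Qed.

Lemma head_bound t i : (`|cfg_head (conf t) i| <= t)%N.
Proof.
elim: t => [|t IH] //=; rewrite -/(conf t) /step; case: action => [[q a]|] /=; last by lia.
by case: (a i).2 => /=; lia.
Qed.

Lemma content_far t i z : t <= T -> (T < `|z|)%N -> cfg_content (conf t) i z = None.
Proof.
elim: t => [_|t IH ht] hz /=.
  case: ifP => _; case: z hz => //= n hz; rewrite ?nth_nil // nth_default //.
  by rewrite size_map sw; lia.
rewrite -/(conf t) /step; case: action => [[q a]|] /=; last by apply: IH => //; exact: ltnW.
case: eqP => [e|_]; last by apply: IH => //; exact: ltnW.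
by have := head_bound t i; rewrite -e; lia.
Qed.

Lemma final_content : cfg_content (conf T) ord_max 0%R = output_symbol M (V w).
Proof.
have [hh ho] := MV w; rewrite -/(conf _) in hh ho.
have le : p.[size w]%R <= T by rewrite sw; exact: Tp.
have -> : conf T = conf p.[size w]%R.
  rewrite /conf -(subnK le) iterD -/(conf _); elim: (T - _) => //= n ->.
  by rewrite /step hh.
by rewrite ho.
Qed.

Lemma start_content n : nth None (map (@input_symbol _ _ M) w) n =
  if onth x n is Some a then input_symbol M (inl a)
  else if onth u (n - size x) is Some b then input_symbol M (inr b) else None.
Proof.
rewrite /w /pair_word map_cat nth_cat !size_map -!map_comp.
have nE (A : Type) (f : A -> sym) (s : seq A) k : (forall a, f a <> None) ->
  nth None (map f s) k = if onth s k is Some a then f a else None.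
  by elim: s k => [|a s IH] [|k] h //=; exact: IH.
rewrite !nE //; case: ltnP => h; last by rewrite [onth x n]onth_default.
by have := h; rewrite -onthTE; case: (onth x n).
Qed.

Lemma start_cell_at y : y < T.*2.+1 ->
  start_cell (start_kind y) (y == T) (cell_at (conf 0) (Posz y - Posz T)%R)
             (cell_at (conf 0) (Posz y - Posz T + 1)%R).
Proof.
move=> hy; rewrite /start_cell /= eqxx /=; apply/and3P; split.
- by apply/forallP => i; rewrite ffunE /=; apply/eqP; apply/eqP/eqP; lia.
- apply/forallP => i; apply/implyP => hi; rewrite ffunE /= (negbTE hi).
  by case: (_ - _)%R => // n /=; rewrite nth_nil.
rewrite !ffunE /= /start_kind; case: (ltnP y T) => hyT.
  by have -> : (Posz y - Posz T)%R = Negz (T - y).-1 by lia.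
have -> : (Posz y - Posz T)%R = Posz (y - T) by lia.
have -> : (Posz (y - T) + 1)%R = Posz (y - T).+1 by lia.
rewrite /= !start_content; case e: (onth x (y - T)) => [a|] //.
have hsx : size x <= y - T by rewrite leqNgt -onthTE e.
have -> : onth x (y - T).+1 = None by rewrite onth_default //; lia.
case: ltnP => hq; last by rewrite onth_default //; lia.
case e2: (onth u _) => [b|]; first by case: b {e2} => /=; rewrite ?eqxx ?orbT.
by rewrite onth_default //; have := onthNE u (y - T - size x); rewrite e2 /= => /esym; lia.
Qed.

Lemma tableau_of_run : V w -> tableau.
Proof.
move=> hV; pose z (y : nat) : int := (Posz y - Posz T.+1)%R.
exists (fun t y => cell_at (conf t) (z y)) => t y ht hy.
have z1 : z y = (z y.+1 - 1)%R by rewrite /z; lia.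
have z3 : z y.+2 = (z y.+1 + 1)%R by rewrite /z; lia.
have far (s : int) : (T < `|s|)%N -> blank_cell (cell_at (conf t) s).
  move=> hv; apply/eqP/ffunP => i; rewrite !ffunE content_far //; last exact: ltnW.
  by congr (_, _); apply/negbTE/eqP => e; have := head_bound t i; rewrite e; lia.
rewrite /tableau_ok; apply/and5P; split.
- rewrite z1 z3; exact: window_cell_at.
- by apply/implyP => /eqP e; apply: far; rewrite /z e; lia.
- by apply/implyP => /eqP e; apply: far; rewrite /z e; lia.
- apply/implyP => /eqP ->; have := start_cell_at hy.
  have -> : (Posz y - Posz T)%R = z y.+1 by rewrite /z; lia.
  by rewrite -z3.
- apply/implyP => /andP[/eqP -> /eqP ->]; rewrite /accept_cell ffunE /=.
  have -> : z T.+1 = 0%R by rewrite /z; lia.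
  by rewrite final_content hV.
Qed.

(** Induction on time recovers only tapes, heads and state. The scanned symbols of a row then follow
    inside the row: they are constant along it, and each head lies within distance [T], in the
    middle of some window that checks its symbol. *)
Lemma run_of_tableau (tau : nat -> nat -> tcell) :
  (forall t y, t < T -> y < T.*2.+1 ->
    tableau_ok t y (tau t y) (tau t y.+1) (tau t y.+2) (tau t.+1 y.+1)) ->
  (forall y, y < T.*2.+1 ->
    ((tau 0 y.+1).1 ord0).1 = cfg_content (conf 0) ord0 (Posz y - Posz T)%R) ->
  V w.
Proof.
move=> ok start; pose z (y : nat) : int := (Posz y - Posz T.+1)%R.
have row t : t <= T -> forall y, y < T.*2.+1 ->
    (tau t y.+1).1 = (cell_at (conf t) (z y.+1)).1 /\ (tau t y.+1).2.1 = cfg_state (conf t).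
  elim: t => [_|t IH ht] y hy.
    have /and5P[_ _ _ /implyP /(_ (eqxx _))] := ok 0 y T0 hy.
    case/and4P => /eqP hq /forallP hh /forallP hn _ _; split=> //.
    apply/ffunP => i; rewrite [RHS]ffunE [LHS]surjective_pairing (eqP (hh i)); congr (_, _).
      have -> : z y.+1 = (Posz y - Posz T)%R by rewrite /z; lia.
      case: (boolP (i == ord0)) => [/eqP ->|ni]; first exact: start.
      rewrite (eqP (implyP (hn i) ni)) /= (negbTE ni).
      by case: (_ - _)%R => // n /=; rewrite nth_nil.
    by apply/eqP/eqP; rewrite /z /=; lia.
  have {}IH := IH (ltnW ht).
  have far (s : int) : (T < `|s|)%N -> (cell_at (conf t) s).1 = [ffun=> (None, false)].
    move=> hv; apply/ffunP => i; rewrite !ffunE content_far //; last exact: ltnW.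
    by congr (_, _); apply/negbTE/eqP => e; have := head_bound t i; rewrite e; lia.
  have cells k : k <= T.*2.+2 -> (tau t k).1 = (cell_at (conf t) (z k)).1.
    case: k => [_|k hk].
      have /and5P[_ /implyP /(_ (eqxx _)) /eqP -> _ _ _] := ok t 0 ht isT.
      by rewrite far // /z; lia.
    case: (ltnP k T.*2.+1) => hk1; first by case: (IH k hk1).
    have -> : k = T.*2.+1 by lia.
    have /and5P[_ _ /implyP /(_ (eqxx _)) /eqP -> _ _] := ok t T.*2 ht (ltnSn _).
    by rewrite far // /z; lia.
  have glob k : k <= T.*2.+2 -> (tau t k).2 = (tau t 1).2.
    elim: k => [_|k IHk hk].
      by have /and5P[/and4P[/eqP -> _ _ _] _ _ _ _] := ok t 0 ht isT.
    case: k IHk hk => // k IHk hk.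
    have /and5P[/and4P[_ /eqP -> _ _] _ _ _ _] := ok t k ht hk.
    by apply: IHk; exact: ltnW.
  have scan : (tau t 1).2 = (cfg_state (conf t), [ffun i => cfg_content (conf t) i (cfg_head (conf t) i)]).
    rewrite [LHS]surjective_pairing; congr (_, _); first by case: (IH 0 isT).
    apply/ffunP => i; rewrite ffunE.
    have hb := head_bound t i; pose k := `|(cfg_head (conf t) i + Posz T)%R|%N.
    have hk : k < T.*2.+1 by rewrite /k; lia.
    have zk : z k.+1 = cfg_head (conf t) i by rewrite /z /k; lia.
    have /and5P[/and4P[_ _ /forallP hs _] _ _ _ _] := ok t k ht hk.
    have hk' : k.+1 <= T.*2.+2 by lia.
    have := hs i; rewrite (cells _ hk') (glob _ hk') ffunE zk eqxx /= => /eqP.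
    exact.
  have full k : k <= T.*2.+2 -> tau t k = cell_at (conf t) (z k).
    by move=> hk; rewrite [LHS]surjective_pairing cells // glob // scan.
  have /and5P[/and4P[_ _ _ /eqP hw] _ _ _ _] := ok t y ht hy; move: hw.
  rewrite (full y) ?(full y.+1) ?(full y.+2); try lia.
  have -> : z y = (z y.+1 - 1)%R by rewrite /z; lia.
  have -> : z y.+2 = (z y.+1 + 1)%R by rewrite /z; lia.
  by rewrite next_cell_at => -[h1 h2].
have hT : T.-1 < T by rewrite prednK.
have hy : T < T.*2.+1 by lia.
have /and5P[_ _ _ _] := ok T.-1 T hT hy; rewrite prednK // !eqxx /= /accept_cell.
have [-> _] := row T (leqnn _) T hy; rewrite ffunE /=.
have -> : z T.+1 = 0%R by rewrite /z; lia.
by rewrite final_content => /eqP[->].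
Qed.

End Run.

Lemma tableauP : tableau <-> exists u : seq bool, size u <= Q /\ V (pair_word x u).
Proof.
split=> [[tau ok]|[u [hu hV]]]; last exact: tableau_of_run hV.
pose f i := ((tau 0 (T + (size x + i)).+1).1 ord0).1.
have cert i : i < Q -> [|| f i == None, f i == input_symbol M (inr true)
    | f i == input_symbol M (inr false)] && ((f i == None) ==> (f i.+1 == None)).
  move=> hi; have hy : T + (size x + i) < T.*2.+1 by lia.
  have /and5P[_ _ _ /implyP /(_ (eqxx _))] := ok 0 _ T0 hy.
  case/and4P => _ _ _; rewrite /start_kind ltnNge leq_addr /= addKn onth_default ?leq_addr //.
  by rewrite ltn_add2l hi /f !addnS.
have fQ : f Q = None.
  have hy : T + (size x + Q) < T.*2.+1 by lia.
  have /and5P[_ _ _ /implyP /(_ (eqxx _))] := ok 0 _ T0 hy.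
  case/and4P => _ _ _; rewrite /start_kind ltnNge leq_addr /= addKn onth_default ?leq_addr //.
  by rewrite ltnn => /eqP h _.
(* The certificate ends at the first blank of its zone; blanks propagate to the right, so nothing
   follows it. *)
pose n := find (fun i => f i == None) (iota 0 Q.+1).
have hn : has (fun i => f i == None) (iota 0 Q.+1).
  by apply/hasP; exists Q; rewrite ?mem_iota ?fQ //= ltnSn.
have nQ : n <= Q by move: hn; rewrite has_find size_iota.
have fn : f n = None by have /eqP := nth_find 0 hn; rewrite nth_iota.
have fafter i : n <= i -> i <= Q -> f i = None.
  elim: i => [|i IH]; first by rewrite leqn0 => /eqP <-.
  rewrite leq_eqVlt => /orP[/eqP <- //|hi] hiQ.
  have /andP[_ /implyP h] := cert i hiQ.
  by apply/eqP/h/eqP; apply: IH => //; exact: ltnW.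
pose u := [seq f i == input_symbol M (inr true) | i <- iota 0 n].
have su : size u = n by rewrite size_map size_iota.
have fbefore i : i < n -> f i = input_symbol M (inr (f i == input_symbol M (inr true))).
  move=> hi; have hiQ : i < Q by exact: leq_trans nQ.
  have /andP[/or3P[/eqP h|/eqP->|/eqP->] _] := cert i hiQ; last by [].
    by have := before_find 0 hi; rewrite nth_iota ?h // (leq_trans hiQ).
  by rewrite eqxx.
exists u; rewrite su; split=> //.
have hu : size u <= Q by rewrite su.
apply: (run_of_tableau hu ok) => y hy; have /and5P[_ _ _ /implyP /(_ (eqxx _))] := ok 0 y T0 hy.
case/and4P => _ _ _; rewrite /start_kind /=; case: (ltnP y T) => hyT.
  move=> /eqP h _.
  have -> : (Posz y - Posz T)%R = Negz (T - y).-1 by lia.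
  by rewrite h.
have -> : (Posz y - Posz T)%R = Posz (y - T) by lia.
rewrite /= start_content; case e: (onth x (y - T)) => [a|]; first by move/eqP.
have hsx : size x <= y - T by rewrite leqNgt -onthTE e.
have fE : ((tau 0 y.+1).1 ord0).1 = f (y - T - size x).
  by rewrite /f; have -> : T + (size x + (y - T - size x)) = y by lia.
case: ltnP => hq; last first.
  by move=> /eqP -> _; rewrite onth_default // su; lia.
move=> _; rewrite fE onth_map onthE; case: (ltnP (y - T - size x) n) => hi.
  by rewrite (nth_map 0) ?size_iota // nth_iota //= add0n -fbefore.
rewrite nth_default ?size_map ?size_iota //= fafter //; lia.
Qed.

End Tableau.

(** * Encodings as definable words *)

(** The powers of two are the positive numbers without an odd divisor other than 1. Bits are indexed
    by powers instead of exponents, as 2 ^ i exceeds the polynomial bound on values of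
    expressions. *)
Definition pow2 (y : nat) : bool :=
  (0 < y) && ball y.+1 (fun d => (odd d && (y %% d == 0)) ==> (d == 1)).

Lemma pow2P y : reflect (exists i, y = 2 ^ i) (pow2 y).
Proof.
apply: (iffP andP) => [[y0 /ballP hd]|[i ->]]; last first.
  split; first by rewrite expn_gt0.
  apply/ballP => d _; apply/implyP => /andP[od dv].
  have : gcdn d (2 ^ i) = d by apply/gcdn_idPl.
  have := @coprimeXr i d 2; rewrite coprime_sym prime_coprime // dvdn2 od /= => /(_ isT).
  by rewrite /coprime => /eqP -> <-.
have hd' d : odd d -> d %| y -> d = 1.
  move=> od dv; have := hd d; rewrite ltnS dvdn_leq // od -/(d %| y) dv => /(_ isT) /implyP.
  by move=> /(_ isT) /eqP.
elim/ltn_ind: y y0 hd' {hd} => y IH y0 hd.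
case: (boolP (odd y)) => oy; first by exists 0; rewrite (hd y).
have ey : y = y./2 * 2 by rewrite muln2 even_halfK.
have [i ei] : exists i, y./2 = 2 ^ i.
  apply: IH; [lia|lia|] => d od dv; apply: hd => //; by rewrite ey dvdn_mulr.
by exists i.+1; rewrite expnS mulnC -ei -ey.
Qed.

Lemma filter_pow2 m : 0 < m ->
  [seq y <- iota 0 m.+1 | pow2 y] = [seq 2 ^ i | i <- iota 0 (trunc_log 2 m).+1].
Proof.
move=> m0; apply: (irr_sorted_eq ltn_trans ltnn).
- by apply: sorted_filter; [exact: ltn_trans | exact: iota_ltn_sorted].
- apply: (homo_sorted (e := ltn)) (iota_ltn_sorted _ _) => i j /= h.
  by rewrite ltn_exp2l.
move=> y; rewrite mem_filter mem_iota leq0n add0n ltnS andTb; apply/andP/mapP.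
  case=> /pow2P [i ->] hi; exists i => //.
  by rewrite mem_iota /= add0n ltnS trunc_log_max.
case=> i; rewrite mem_iota /= add0n ltnS => hi ->; split; first by apply/pow2P; exists i.
by apply: leq_trans (trunc_logP (isT : 1 < 2) m0); rewrite leq_exp2l.
Qed.

Definition encnum (m : nat) : seq (option bool) := rcons (map Some (binary m)) None.

Definition bit_at (m y : nat) : seq (option bool) :=
  if pow2 y then if odd (m %/ y) then [:: Some true] else [:: Some false] else [::].

(** The [maxn] accounts for 0, which is written with one bit. Searching all [y] up to [m] is
    affordable because every number written is a value of an expression, hence polynomially
    bounded. *)
Lemma encnumE m : encnum m = nflat (maxn m 1).+1 (bit_at m) ++ [:: None].
Proof.
rewrite /encnum -cats1; congr (_ ++ _); rewrite /nflat /binary.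
have -> : trunc_log 2 m = trunc_log 2 (maxn m 1) by case: m => [|[|m]].
have := @filter_pow2 (maxn m 1); rewrite leq_maxr => /(_ isT) e.
rewrite -map_comp -[map (_ \o _) _]/(map (fun i => (fun y => Some (odd (m %/ y))) (2 ^ i)) _).
rewrite [LHS](map_comp (fun y => Some (odd (m %/ y))) (fun i => 2 ^ i)) -e.
elim: (iota 0 _) => //= y s IH; rewrite /bit_at; case: (pow2 y) => //=; rewrite IH.
by case: (odd _).
Qed.

Definition encw (n : nat) (fr fc : nat -> nat -> nat) : seq (option bool) :=
  encnum n ++ nflat n (fun i => nflat 2 (fun k => encnum (fr i k)))
           ++ nflat n (fun i => nflat 2 (fun k => encnum (fc i k))).

Lemma encodeE n (r c : 'M[nat]_(n, 2)) (fr fc : nat -> nat -> nat) :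
  (forall i k, r i k = fr i k) -> (forall i k, c i k = fc i k) ->
  encode r c = encw n fr fc.
Proof.
move=> hr hc; rewrite /encode /encw /= map_cat flatten_cat.
have e (A : 'M[nat]_(n, 2)) (f : nat -> nat -> nat) : (forall i k, A i k = f i k) ->
   flatten [seq encnum m | m <- entries A] = nflat n (fun i => nflat 2 (fun k => encnum (f i k))).
  move=> hA; rewrite /entries /nflat -!val_enum_ord.
  move: (enum 'I_n) (enum 'I_2) => s t; elim: s => //= i s IH.
  rewrite map_cat flatten_cat IH; congr (flatten _ ++ _).
  by elim: t {IH} => //= k t ->; rewrite hA.
by rewrite -!/(encnum _) -(e r fr hr) -(e c fc hc).
Qed.

(** Every entry costs at least its separator. This bounds both the search for [n] and the length of
    the certificate. *)
Lemma leq_size_encw n fr fc : n <= size (encw n fr fc).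
Proof.
rewrite /encw !size_cat (leq_trans _ (leq_addl _ _)) // (leq_trans _ (leq_addr _ _)) //.
rewrite size_nflat -[X in X <= _]muln1 -nsum_cst; apply: leq_nsum => i _.
by rewrite size_nflat !nsumS nsum0 /encnum !size_rcons; lia.
Qed.

Lemma cnat_bool (Sigma : finType) (B : seq Sigma -> seq nat -> bool) :
  cbool B -> cnat (fun x r => nat_of_bool (B x r)).
Proof. by []. Qed.

Lemma cbool_eqb (Sigma : finType) (A B : seq Sigma -> seq nat -> bool) :
  cbool A -> cbool B -> cbool (fun x r => A x r == B x r).
Proof.
move=> hA hB; apply: cbool_ext (cbool_eq hA hB) => x r.
by case: (A x r); case: (B x r).
Qed.

Ltac cvar := eexists (Var _ _ _) => ? ?; rewrite ?nth_behead; reflexivity.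

Ltac cstep0 := cbv beta; first
  [ assumption | exact: cnat_cst | exact: cbool_cst | exact: cnat_size | cvar
  | lazymatch goal with |- cnat _ => apply: cnat_bool end | apply: cbool_ball | apply: cbool_bex | apply: cbool_and
  | apply: cbool_or | apply: cbool_imp | apply: cbool_neg | apply: cbool_odd
  | apply: cbool_in | apply: cbool_eq | apply: cbool_leq | apply: cnat_sum
  | apply: cnat_succ | apply: cnat_add | apply: cnat_sub | apply: cnat_mul
  | apply: cnat_div | apply: cnat_mod | apply: cnat_poly | apply: cbool_if | apply: cnat_if ].

Section EncodingWords.
Variable Sigma : finType.
Implicit Types A B C F : seq Sigma -> seq nat -> nat.

Lemma cbool_pow2 F : cnat F -> cbool (fun x r => pow2 (F x r)).
Proof.
move=> hF; rewrite /pow2; have hF' := cnat_lift hF; repeat cstep0.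
Qed.

Lemma cword_encnum F : cnat F -> cword (fun x r => encnum (F x r)).
Proof.
move=> hF; have hF' := cnat_lift hF.
have h : cword (fun x r => nflat (maxn (F x r) 1).+1 (bit_at (F x r)) ++ [:: None]).
  apply: cword_cat; last exact: cword_emit.
  apply: (cword_flat (W := fun x r y => bit_at (F x r) y)).
    apply: cnat_succ.
    have h : cnat (fun x r => if F x r <= 1 then 1 else F x r) by repeat cstep0.
    by apply: cnat_ext h => x r; case: (leqP (F x r) 1) => h; lia.
  rewrite /bit_at; apply: cword_if; first by apply: cbool_pow2; cvar.
    apply: cword_if; [|exact: cword_emit|exact: cword_emit].
    by repeat cstep0.
  have := cword_flat (W := fun x r i => [:: Some true]) (@cnat_cst Sigma 0) (@cword_emit Sigma _ _).
  exact: cword_ext.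
by apply: cword_ext h => x r; rewrite encnumE.
Qed.

Lemma cword_encw (fr fc : seq Sigma -> nat -> nat -> nat -> nat) :
  (forall A B C, cnat A -> cnat B -> cnat C -> cnat (fun x r => fr x (A x r) (B x r) (C x r))) ->
  (forall A B C, cnat A -> cnat B -> cnat C -> cnat (fun x r => fc x (A x r) (B x r) (C x r))) ->
  forall A, cnat A -> cword (fun x r => encw (A x r) (fr x (A x r)) (fc x (A x r))).
Proof.
move=> hr hc A hA; rewrite /encw.
have hA2 : cnat (fun x r => A x (behead (behead r))).
  exact: (cnat_lift (F := fun x r => A x (behead r))) (cnat_lift hA).
apply: cword_cat; first exact: cword_encnum.
apply: cword_cat.
  apply: (cword_flat (W := fun x r i => nflat 2 (fun k => encnum (fr x (A x r) i k)))) => //.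
  apply: (cword_flat (W := fun x r k => encnum (fr x (A x (behead r)) (nth 0 r 0) k))); first exact: cnat_cst.
  by apply: cword_encnum; apply: hr => //; cvar.
apply: (cword_flat (W := fun x r i => nflat 2 (fun k => encnum (fc x (A x r) i k)))) => //.
apply: (cword_flat (W := fun x r k => encnum (fc x (A x (behead r)) (nth 0 r 0) k))); first exact: cnat_cst.
by apply: cword_encnum; apply: hc => //; cvar.
Qed.

End EncodingWords.

(** * Membership in NP *)

Section Verifier.
Notation letter := (option bool + bool)%type.
Implicit Type w : seq letter.

Definition prefix_len w : nat :=
  nsum (size w) (fun p => [|| onth w p == Some (inl None), onth w p == Some (inl (Some true))
                          | onth w p == Some (inl (Some false))]).

Definition tile_bit w (n i j k : nat) : bool :=
  onth w (prefix_len w + ((i * n + j) * 2 + k)) == Some (inr true).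

(** A tile of type [k] occupies rows [i] to [i + k] and columns [j] to [j + k], and two such squares
    are disjoint exactly when some coordinate separates them. *)
Definition tiling_ok w n : bool :=
  ball n (fun i => ball n (fun j => ball 2 (fun k => tile_bit w n i j k ==>
    [&& i + k < n, j + k < n &
      ball n (fun i' => ball n (fun j' => ball 2 (fun k' =>
        (tile_bit w n i' j' k' && ~~ [&& i == i', j == j' & k == k']) ==>
          [|| i + k < i', i' + k' < i, j + k < j' | j' + k' < j])))]))).

Definition vrow w n i k : nat := nsum n (fun j => tile_bit w n i j k).
Definition vcol w n j k : nat := nsum n (fun i => tile_bit w n i j k).
Definition vword w n := encw n (vrow w n) (vcol w n).

(** The input is never parsed: the projections of the guessed tiling are encoded anew and compared
    letter by letter. Certificate letters count as absent letters, and the length test prevents the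
    new word from running past [w]. *)
Definition word_ok w n : bool :=
  (size (vword w n) <= size w) &&
  ball (size w) (fun p => all (fun a =>
    (onth w p == Some (inl a)) == (onth (vword w n) p == Some a)) [:: None; Some true; Some false]).

Definition verifier w : bool := bex (size w).+1 (fun n => tiling_ok w n && word_ok w n).

Lemma cnat_prefix_len : cnat (fun w _ => prefix_len w).
Proof. rewrite /prefix_len; repeat cstep0. Qed.

Lemma cbool_tile_bit (A B C D : seq letter -> seq nat -> nat) :
  cnat A -> cnat B -> cnat C -> cnat D ->
  cbool (fun w r => tile_bit w (A w r) (B w r) (C w r) (D w r)).
Proof.
move=> hA hB hC hD; rewrite /tile_bit; have hp := cnat_prefix_len; repeat cstep0.
Qed.

Lemma cbool_verifier : cbool (fun w _ => verifier w).
Proof.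
have ht := cbool_tile_bit.
have hr A B C : cnat A -> cnat B -> cnat C -> cnat (fun w r => vrow w (A w r) (B w r) (C w r)).
  move=> hA hB hC; rewrite /vrow; apply: cnat_sum => //; apply: ht; try exact: cnat_lift; cvar.
have hc A B C : cnat A -> cnat B -> cnat C -> cnat (fun w r => vcol w (A w r) (B w r) (C w r)).
  move=> hA hB hC; rewrite /vcol; apply: cnat_sum => //; apply: ht; try exact: cnat_lift; cvar.
have hw := cword_encw hr hc.
rewrite /verifier; apply: cbool_bex; first by repeat cstep0.
apply: cbool_and.
  by rewrite /tiling_ok; repeat first [apply: ht | cstep0].
rewrite /word_ok; apply: cbool_and.
  apply: cbool_leq; last exact: cnat_size.
  by apply: (cnat_size_word (W := fun w r => vword w (nth 0 r 0))); apply: hw; cvar.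
apply: (cbool_ball (P := fun w r p => all (fun a => (onth w p == Some (inl a)) ==
  (onth (vword w (nth 0 r 0)) p == Some a)) _)); first exact: cnat_size.
apply: cbool_all => a; apply: cbool_eqb; first by apply: cbool_in; cvar.
apply: (cbool_onth_word (W := fun w r => vword w (nth 0 (behead r) 0))); last by cvar.
by apply: hw; cvar.
Qed.

Lemma polytime_verifier : polytime (fun w => [:: verifier w]).
Proof.
have := cword_if cbool_verifier (@cword_emit _ _ true) (@cword_emit _ _ false).
move=> /polytime_cword [M [p h]]; exists M, p => x.
by have := h x; case: (verifier x).
Qed.

End Verifier.

Lemma onth_map_pair (x : seq (option bool)) u p :
  onth (pair_word x u) p =
  if p < size x then omap inl (onth x p) else omap inr (onth u (p - size x)).
Proof. by rewrite /pair_word onth_cat size_map !onth_map. Qed.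

Lemma prefix_len_pair (x : seq (option bool)) u : prefix_len (pair_word x u) = size x.
Proof.
have sx : size x <= size (pair_word x u) by rewrite size_cat !size_map leq_addr.
rewrite /prefix_len -[RHS](nsum_ltn sx); apply: eq_nsum => p _; congr nat_of_bool.
rewrite onth_map_pair; case: ltnP => h; last by case: (onth u _).
by have := h; rewrite -onthTE; case: (onth x p) => [[[]|]|].
Qed.

Lemma tile_bit_pair (x : seq (option bool)) u n i j k :
  tile_bit (pair_word x u) n i j k = (onth u ((i * n + j) * 2 + k) == Some true).
Proof.
rewrite /tile_bit prefix_len_pair onth_map_pair ltnNge leq_addr /= addKn.
by case: (onth u _) => [[]|].
Qed.

Definition tiles_of w n : {set 'I_n * 'I_n * 'I_2} :=
  [set q : 'I_n * 'I_n * 'I_2 | tile_bit w n q.1.1 q.1.2 q.2].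

Lemma tiling_okP w n : reflect (is_tiling tiles (tiles_of w n)) (tiling_ok w n).
Proof.
apply: (iffP idP) => [ok|[dis grid]].
  have ok' (q : 'I_n * 'I_n * 'I_2) : q \in tiles_of w n -> [/\ q.1.1 + q.2 < n, q.1.2 + q.2 < n &
      forall q', q' \in tiles_of w n -> q != q' -> [|| q.1.1 + q.2 < q'.1.1, q'.1.1 + q'.2 < q.1.1,
         q.1.2 + q.2 < q'.1.2 | q'.1.2 + q'.2 < q.1.2]].
    rewrite inE => hq; have := ballP _ _ ok _ (ltn_ord q.1.1).
    move=> /ballP /(_ _ (ltn_ord q.1.2)) /ballP /(_ _ (ltn_ord q.2)) /implyP /(_ hq).
    case/and3P => h1 h2 h3; split=> // q'; rewrite inE => hq' ne.
    move/ballP: h3 => /(_ _ (ltn_ord q'.1.1)) /ballP /(_ _ (ltn_ord q'.1.2)).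
    move=> /ballP /(_ _ (ltn_ord q'.2)) /implyP; apply; rewrite hq' /=.
    apply: contra ne => /and3P[/eqP e1 /eqP e2 /eqP e3].
    case: q q' e1 e2 e3 {hq hq' h1 h2} => [[i j] k] [[i' j'] k'] /= e1 e2 e3.
    by rewrite (val_inj e1) (val_inj e2) (val_inj e3).
  split=> [q q' hq hq' ne|q p hq /placedP [u [v [hu hv ->]]]].
    have [_ _ /(_ q' hq' ne) h] := ok' _ hq.
    apply/fdisjointP => p /placedP [u [v [hu hv ->]]]; apply/negP => /placedP.
    case=> u' [v' [hu' hv' [e1 e2]]].
    case: q q' {hq hq' ne} h hu hv hu' hv' e1 e2 => [[i j] k] [[i' j'] k'] /=.
    by move=> /or4P[]; lia.
  have [h1 h2 _] := ok' _ hq; case: q {hq} hu hv h1 h2 => [[i j] k] /= *.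
  by rewrite /in_grid /= !ltz_nat; lia.
apply/ballP => i hi; apply/ballP => j hj; apply/ballP => k hk; apply/implyP => h.
pose q := (Ordinal hi, Ordinal hj, Ordinal hk).
have hq : q \in tiles_of w n by rewrite inE.
have := grid q (Posz (i + k), Posz (j + k)) hq.
have -> : (Posz (i + k), Posz (j + k)) \in placed tiles q by apply/placedP; exists k, k.
move=> /(_ isT) /and4P[_ /= g1 _ g2]; rewrite !ltz_nat in g1 g2; rewrite g1 g2 /=.
apply/ballP => i' hi'; apply/ballP => j' hj'; apply/ballP => k' hk'; apply/implyP => /andP[h' ne].
pose q' := (Ordinal hi', Ordinal hj', Ordinal hk').
have hq' : q' \in tiles_of w n by rewrite inE.
have nq : q != q' by rewrite /q /q' !xpair_eqE -!val_eqE /= -andbA.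
(* Two squares that no coordinate separates share the point given by the maxima of their corners. *)
have /fdisjointP /(_ (Posz (maxn i i'), Posz (maxn j j'))) H := dis _ _ hq hq' nq.
apply: contraT => no; move: (H).
have p1 : (Posz (maxn i i'), Posz (maxn j j')) \in placed tiles q.
  by apply/placedP; exists (maxn i i' - i), (maxn j j' - j); rewrite /=; split; try lia; congr (Posz _, Posz _); lia.
have p2 : (Posz (maxn i i'), Posz (maxn j j')) \in placed tiles q'.
  by apply/placedP; exists (maxn i i' - i'), (maxn j j' - j'); rewrite /=; split; try lia; congr (Posz _, Posz _); lia.
by rewrite p2 => /(_ p1).
Qed.

Lemma encode_tiles_of w n :
  encode (row_projection (tiles_of w n)) (col_projection (tiles_of w n)) = vword w n.
Proof.
apply: encodeE => i k; rewrite mxE -sum1dep_card big_mkcond /vrow /vcol /nsum;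
  by apply: eq_bigr => j _; rewrite inE /=; case: (tile_bit _ _ _ _ _).
Qed.

Lemma word_okP (x : seq (option bool)) u n :
  reflect (x = vword (pair_word x u) n) (word_ok (pair_word x u) n).
Proof.
set w := pair_word x u; have sw : size w = size x + size u by rewrite size_cat !size_map.
apply: (iffP andP) => [[sz /ballP h]|e].
  apply: eq_from_onth => p; case: (ltnP p (size w)) => hp; last first.
    by rewrite !onth_default //; [exact: leq_trans hp|lia].
  have hxa a : (onth x p == Some a) = (onth (vword w n) p == Some a).
    have -> : (onth x p == Some a) = (onth w p == Some (inl a)).
      rewrite onth_map_pair; case: ltnP => hx; first by case: (onth x p).
      by rewrite onth_default //; case: (onth u _).
    by have /allP /(_ a) := h p hp; case: a => [[]|]; rewrite !inE => /(_ isT) /eqP.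
  case e: (onth x p) => [a|]; first by have := hxa a; rewrite e eqxx => /esym/eqP.
  by case e2: (onth (vword w n) p) => [a|] //; have := hxa a; rewrite e e2 eqxx.
rewrite -e sw leq_addr; split=> //; apply/ballP => p hp; apply/allP => a _.
rewrite onth_map_pair; case: ltnP => hx; first by case: (onth x p) => [b|].
by rewrite [onth x p]onth_default //; case: (onth u _).
Qed.

Lemma consistency_in_NP : in_NP (consistency_problem tiles).
Proof.
exists verifier, ('X * 'X * 2%:P)%R; split; first exact: polytime_verifier.
move=> x0; split=> [[n [r [c [-> [T [hT <- <-]]]]]]|[u [_ /bexP [n _ /andP[/tiling_okP ok /word_okP e]]]]]; last first.
  exists n, (row_projection (tiles_of (pair_word x0 u) n)), (col_projection (tiles_of (pair_word x0 u) n)).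
  by rewrite encode_tiles_of -e; split=> //; exists (tiles_of (pair_word x0 u) n).
set x := encode _ _.
(* The certificate is the bit table of the tiling, with 2 n^2 entries indexed by row, column and
   type. *)
pose u := mkseq (fun m => [exists q in T, (q.1.1 * n + q.1.2) * 2 + q.2 == m]) (n * n * 2).
have TE : tiles_of (pair_word x u) n = T.
  apply/setP => -[[i j] k]; rewrite inE tile_bit_pair /=.
  have hm : (i * n + j) * 2 + k < n * n * 2.
    have hi := ltn_ord i; have hj := ltn_ord j; have hk := ltn_ord k.
    have : i.+1 * n <= n * n by rewrite leq_mul2r hi orbT.
    by rewrite mulSn; lia.
  have -> : onth u ((i * n + j) * 2 + k) = Some [exists q in T, (q.1.1 * n + q.1.2) * 2 + q.2 == (i * n + j) * 2 + k].
    by rewrite onthE (nth_map false) ?size_mkseq // nth_mkseq.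
  apply/eqP/idP => [[/exists_inP [[[i' j'] k'] hq /= /eqP e]]|hq].
    have n0 : 0 < n by exact: leq_trans (ltn_ord i).
    have ek : k' = k :> nat by have := ltn_ord k; have := ltn_ord k'; lia.
    have e2 : i' * n + j' = i * n + j by lia.
    have ei : i' = i :> nat.
      by rewrite -[LHS](flatE (fun a _ => a) i' (ltn_ord j')) e2 flatE.
    have ej : j' = j :> nat by move: e2; rewrite ei; lia.
    by rewrite -(val_inj ei) -(val_inj ej) -(val_inj ek).
  by congr Some; apply/exists_inP; exists (i, j, k).
have ex : x = vword (pair_word x u) n by rewrite -encode_tiles_of TE.
have nx : n <= size x by rewrite ex leq_size_encw.
exists u; split.
  rewrite size_mkseq !hornerM hornerX hornerC -![(_ * _)%R]/(_ * _)%N.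
  by rewrite leq_mul2r leq_mul.
apply/bexP; exists n; first by rewrite ltnS size_cat size_map (leq_trans nx) ?leq_addr.
by apply/andP; split; [apply/tiling_okP; rewrite TE | apply/word_okP].
Qed.

(** * Injectivity of the encoding *)

Lemma cat_encnum_inj b b' (s s' : seq (option bool)) :
  rcons (map Some b) None ++ s = rcons (map Some b') None ++ s' -> b = b' /\ s = s'.
Proof.
elim: b b' => [|a b IH] [|a' b'] //=; first by case=> ->.
by case=> <- /IH [-> ->].
Qed.

Fixpoint of_binary (b : seq bool) : nat := if b is a :: b' then a + (of_binary b').*2 else 0.

Lemma binaryK : cancel binary of_binary.
Proof.
move=> m; rewrite /binary; have := trunc_log_ltn m (isT : 1 < 2).
move: (trunc_log 2 m).+1 => L; elim: L m => [|L IH] m; first by rewrite expn0 ltnS leqn0 => /eqP ->.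
move=> hm; rewrite -[L.+1]add1n iotaD /= expn0 divn1.
have -> : [seq odd (m %/ 2 ^ i) | i <- iota (0 + 1) L] = [seq odd (m./2 %/ 2 ^ i) | i <- iota 0 L].
  rewrite add0n -[1]addn0 iotaDl -map_comp; apply: eq_map => i /=.
  by rewrite add1n expnS divnMA divn2.
rewrite IH ?odd_double_half //; rewrite expnS mul2n in hm.
by rewrite -ltn_double (leq_ltn_trans _ hm) // -[X in _ <= X]odd_double_half leq_addl.
Qed.

Lemma encode_seq_inj (s s' : seq nat) :
  flatten (map encnum s) = flatten (map encnum s') -> s = s'.
Proof.
have fE m t : flatten (map encnum (m :: t)) = encnum m ++ flatten (map encnum t) by [].
elim: s s' => [|m s IH] [|m' s'] //; rewrite !fE.
by case/cat_encnum_inj => /(can_inj binaryK) -> /IH ->.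
Qed.

Lemma entriesE n h (A : 'M[nat]_(n, h)) :
  entries A = map (fun q => A q.1 q.2) [seq (i, k) | i <- enum 'I_n, k <- enum 'I_h].
Proof. by rewrite map_allpairs. Qed.

Lemma entries_inj n h (A B : 'M[nat]_(n, h)) : entries A = entries B -> A = B.
Proof.
rewrite !entriesE => /eq_in_map e; apply/matrixP => i k; apply: (e (i, k)).
by apply: allpairs_f; rewrite mem_enum.
Qed.

Lemma size_entries n h (A : 'M[nat]_(n, h)) : size (entries A) = n * h.
Proof. by rewrite size_allpairs !size_enum_ord. Qed.

(** The language accepts a word through any instance with that code, so a reduction needs codes to
    determine their instance. *)
Lemma encode_consistent n n' (r c : 'M[nat]_(n, 2)) (r' c' : 'M[nat]_(n', 2)) :
  encode r c = encode r' c' -> consistent tiles r' c' -> consistent tiles r c.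
Proof.
move=> /(@encode_seq_inj (n :: entries r ++ entries c) (n' :: entries r' ++ entries c')).
case=> en; subst n' => e.
have := e => /eqP; rewrite eqseq_cat ?size_entries // => /andP[/eqP /entries_inj -> /eqP /entries_inj ->].
by [].
Qed.

(** * The reduction *)

Section MoreClosure.
Variable Sigma : finType.
Implicit Types F : seq Sigma -> seq nat -> nat.

Lemma cnat_double F : cnat F -> cnat (fun x r => (F x r).*2).
Proof. by move=> h; apply: cnat_ext (cnat_add h h) => x r; rewrite addnn. Qed.

Lemma cnat_half F : cnat F -> cnat (fun x r => (F x r)./2).
Proof. by move=> h; apply: cnat_ext (cnat_div h (cnat_cst _ 2)) => x r; rewrite divn2. Qed.

Lemma cnat_pred F : cnat F -> cnat (fun x r => (F x r).-1).
Proof. by move=> h; apply: cnat_ext (cnat_sub h (cnat_cst _ 1)) => x r; rewrite subn1. Qed.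

End MoreClosure.

Ltac cstep := cbv beta zeta; first
  [ assumption | apply: cnat_double | apply: cnat_half | apply: cnat_pred | cstep0 ].

Section GadgetClosure.
Variables (Sigma : finType) (K J : seq Sigma -> nat) (S : seq Sigma -> nat -> nat -> bool).
Hypothesis hK : cnat (fun x _ => K x).
Hypothesis hJ : cnat (fun x _ => J x).
Hypothesis hS : forall A B, cnat A -> cnat B -> cbool (fun x r => S x (A x r) (B x r)).

Definition c2 (f : seq Sigma -> nat -> nat -> nat) : Prop :=
  forall A B, cnat A -> cnat B -> cnat (fun x r => f x (A x r) (B x r)).

Lemma c2_alA : c2 (fun _ => alA).
Proof. by move=> A B hA hB; rewrite /alA; repeat cstep. Qed.

Lemma c2_beA : c2 (fun x => beA (K x) (J x)).
Proof. by move=> A B hA hB; rewrite /beA; repeat cstep. Qed.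

Lemma cnat_clause_size A : cnat A -> cnat (fun x r => clause_size (J x) (S x) (A x r)).
Proof.
by move=> hA; have hA' := cnat_lift hA; rewrite /clause_size; repeat first [apply: hS | cstep].
Qed.

Lemma c2_rhoA : c2 (fun x => rhoA (K x) (J x) (S x)).
Proof.
by move=> A B hA hB; have hc := cnat_clause_size hA; rewrite /rhoA; repeat cstep.
Qed.

Lemma c2_sigA : c2 (fun x => sigA (K x) (J x) (S x)).
Proof. by move=> A B hA hB; rewrite /sigA; repeat first [apply: hS | cstep]. Qed.

Lemma c2_alB : c2 (fun x => alB (K x) (J x)).
Proof. by move=> A B hA hB; rewrite /alB; repeat cstep. Qed.

Lemma c2_beB : c2 (fun x => beB (K x) (J x)).
Proof. by move=> A B hA hB; rewrite /beB; repeat cstep. Qed.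

Lemma c2_rhoB : c2 (fun x => rhoB (K x) (J x) (S x)).
Proof.
by move=> A B hA hB; have hc := cnat_clause_size hA; rewrite /rhoB; repeat cstep.
Qed.

Lemma c2_sigB : c2 (fun x => sigB (K x) (J x) (S x)).
Proof. by move=> A B hA hB; rewrite /sigB; repeat first [apply: hS | cstep]. Qed.

Lemma cnat_row_sum (al be rho : seq Sigma -> nat -> nat -> nat) A :
  c2 al -> c2 be -> c2 rho -> cnat A ->
  cnat (fun x r => row_sum (K x) (J x) (al x) (be x) (rho x) (A x r)).
Proof.
move=> hal hbe hrho hA; have hA' := cnat_lift hA; rewrite /row_sum /flat.
apply: cnat_add; last by apply: hrho; repeat cstep.
apply: cnat_sum; first by repeat cstep.
by apply: cnat_bool; apply: cbool_leq; [apply: cnat_succ; apply: hal|apply: hbe]; repeat cstep.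
Qed.

Lemma cnat_col_sum (al be sig : seq Sigma -> nat -> nat -> nat) A :
  c2 al -> c2 be -> c2 sig -> cnat A ->
  cnat (fun x r => col_sum (K x) (J x) (al x) (be x) (sig x) (A x r)).
Proof.
move=> hal hbe hsig hA; have hA' := cnat_lift hA; rewrite /col_sum /flat.
apply: cnat_add; last by apply: hsig; repeat cstep.
apply: cnat_sum; first by repeat cstep.
by apply: cnat_bool; apply: cbool_leq; [apply: cnat_succ; apply: hal|apply: hbe]; repeat cstep.
Qed.

Definition coarse_entry (f g : nat -> nat) (i k : nat) : nat :=
  if odd i then 0 else if k == 0 then g i./2 else f i./2.

Definition instance_word (x : seq Sigma) : seq (option bool) :=
  encw ((K x).+1 * (J x).*2.+2).*2
    (coarse_entry (row_sum (K x) (J x) alA (beA (K x) (J x)) (rhoA (K x) (J x) (S x)))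
                  (row_sum (K x) (J x) (alB (K x) (J x)) (beB (K x) (J x)) (rhoB (K x) (J x) (S x))))
    (coarse_entry (col_sum (K x) (J x) alA (beA (K x) (J x)) (sigA (K x) (J x) (S x)))
                  (col_sum (K x) (J x) (alB (K x) (J x)) (beB (K x) (J x)) (sigB (K x) (J x) (S x)))).

Lemma polytime_instance_word : polytime instance_word.
Proof.
have hM : cnat (fun x (r : seq nat) => ((K x).+1 * (J x).*2.+2).*2) by repeat cstep.
have h : cword (fun x _ => instance_word x).
  apply: (cword_encw (fr := fun x _ => coarse_entry _ _) (fc := fun x _ => coarse_entry _ _) _ _ hM).
    move=> A B C hA hB hC; rewrite /coarse_entry.
    apply: cnat_if; [by repeat cstep | exact: cnat_cst |].
    apply: cnat_if; first by repeat cstep.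
      by apply: cnat_row_sum; [exact: c2_alB|exact: c2_beB|exact: c2_rhoB|repeat cstep].
    by apply: (cnat_row_sum (al := fun=> alA)); [exact: c2_alA|exact: c2_beA|exact: c2_rhoA|repeat cstep].
  move=> A B C hA hB hC; rewrite /coarse_entry.
  apply: cnat_if; [by repeat cstep | exact: cnat_cst |].
  apply: cnat_if; first by repeat cstep.
    by apply: cnat_col_sum; [exact: c2_alB|exact: c2_beB|exact: c2_sigB|repeat cstep].
  by apply: (cnat_col_sum (al := fun=> alA)); [exact: c2_alA|exact: c2_beA|exact: c2_sigA|repeat cstep].
exact: polytime_cword h.
Qed.

Lemma instance_wordP x : consistency_problem tiles (instance_word x) <->
  exists a b, gadget (K x) (J x) (S x) a b.
Proof.
rewrite /gadget -consistent_coarse.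
set r := coarse_sums _ _ _; set c := coarse_sums _ _ _.
have e : instance_word x = encode r c.
  by symmetry; apply: encodeE => i k; rewrite mxE /coarse_entry.
split=> [[n [r' [c' [e' h]]]]|h]; last by exists _, r, c.
by apply: encode_consistent h; rewrite -e -e'.
Qed.

End GadgetClosure.

Section Reduction.
Variables (Sigma : finType) (M : tm (Sigma + bool)%type bool) (V : seq (Sigma + bool) -> bool).
Variables (pm pq : {poly nat}).
Hypothesis MV : forall w, computes_within M w [:: V w] pm.[size w]%R.
Implicit Type x : seq Sigma.

Definition cert_len x : nat := pq.[size x]%R.
(** One number serves as time and as tape radius: it covers the running time and the length of input
    plus certificate, and the successor makes it positive. *)
Definition run_len x : nat := pm.[size x + cert_len x]%R + (size x + cert_len x).+1.

Notation T := run_len.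
Notation Q := cert_len.
Notation cells := #|tcell M|.

Definition cell0 : tcell M := ([ffun=> (None, false)], (tm_start M, [ffun=> None])).
Definition cell_of (v : nat) : tcell M := nth cell0 (enum (tcell M)) v.

Lemma cells_gt0 : 0 < cells.
Proof. by apply/card_gt0P; exists cell0. Qed.

Lemma index_cell_lt v : index v (enum (tcell M)) < cells.
Proof. by rewrite cardE index_mem mem_enum. Qed.

Lemma cell_ofK v : cell_of (index v (enum (tcell M))) = v.
Proof. by rewrite /cell_of nth_index // mem_enum. Qed.

Definition nsites x : nat := (T x).+1 * (T x).*2.+3.
Definition nconstr x : nat := T x * (T x).*2.+1.
Definition ctime x c : nat := c %/ (T x).*2.+1.
Definition cpos x c : nat := c %% (T x).*2.+1.
Definition cscope x c l : nat :=
  if l < 3 then ctime x c * (T x).*2.+3 + (cpos x c + l)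
  else (ctime x c).+1 * (T x).*2.+3 + (cpos x c).+1.

Definition vcell l v : tcell M := cell_of (digit cells l v).

(** The bound on [v] loses nothing, since codes of actual tuples stay below it, and it turns each
    condition on the tuple into a finite table. *)
Definition cforb x c v : bool :=
  (v < cells ^ 4) && ~~ tableau_ok x (T x) (Q x) (ctime x c) (cpos x c)
     (vcell 0 v) (vcell 1 v) (vcell 2 v) (vcell 3 v).

Lemma cscope_lt x c l : c < nconstr x -> cscope x c l < nsites x.
Proof.
move=> hc; have ht : ctime x c < T x by rewrite /ctime ltn_divLR.
have hp : cpos x c < (T x).*2.+1 by rewrite /cpos ltn_pmod.
rewrite /cscope /nsites; case: (ltnP l 3) => hl.
  by apply: (@ltn_block (T x) (T x).*2.+3 (ctime x c)); lia.
by apply: (@ltn_block (T x) (T x).*2.+3 (ctime x c).+1); lia.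
Qed.

Lemma csp_tableau x :
  csp_sat (nsites x) cells (nconstr x) (cscope x) (cforb x) <-> tableau M x (T x) (Q x).
Proof.
have sE t y : y < (T x).*2.+1 -> ctime x (t * (T x).*2.+1 + y) = t /\ cpos x (t * (T x).*2.+1 + y) = y.
  move=> hy; split; first exact: (flatE (fun a _ => a)).
  by rewrite /cpos modnMDl modn_small.
split=> [[tau [ht hc]]|[tau ok]].
  exists (fun t y => cell_of (tau (t * (T x).*2.+3 + y))) => t y htT hy.
  have hcn : t * (T x).*2.+1 + y < nconstr x.
    have : t.+1 * (T x).*2.+1 <= T x * (T x).*2.+1 by rewrite leq_mul2r htT orbT.
    by rewrite /nconstr mulSn; lia.
  have sl l := cscope_lt l hcn.
  have := hc _ hcn; rewrite /cforb code4_lt ?ht //= negbK /vcell.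
  have [-> -> -> ->] := digit_code4 cells_gt0 (ht _ (sl 0)) (ht _ (sl 1)) (ht _ (sl 2)) (ht _ (sl 3)).
  by rewrite /cscope /=; have [-> ->] := sE t y hy; rewrite addn0 addn1 addn2.
exists (fun s => index (flat (T x).*2.+3 tau s) (enum (tcell M))); split.
  by move=> s _; exact: index_cell_lt.
move=> c hc; rewrite /cforb negb_and negbK; apply/orP; right; rewrite /vcell.
have [-> -> -> ->] := digit_code4 cells_gt0 (index_cell_lt (flat (T x).*2.+3 tau (cscope x c 0)))
  (index_cell_lt (flat (T x).*2.+3 tau (cscope x c 1)))
  (index_cell_lt (flat (T x).*2.+3 tau (cscope x c 2)))
  (index_cell_lt (flat (T x).*2.+3 tau (cscope x c 3))).
have ht : ctime x c < T x by rewrite /ctime ltn_divLR.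
have hp : cpos x c < (T x).*2.+1 by rewrite /cpos ltn_pmod.
rewrite !cell_ofK /cscope /= !flatE; try lia.
by rewrite addn0 addn1 addn2; exact: ok.
Qed.

Definition red_stages x := csp_stages (nsites x) cells (nconstr x).
Definition red_items x := csp_items (nsites x) cells.
Definition red_clause x := csp_clause (nsites x) cells (cscope x) (cforb x).
Definition reduction : seq Sigma -> seq (option bool) :=
  instance_word red_stages red_items red_clause.

Lemma cnat_Q : cnat (fun x _ => Q x).
Proof. by rewrite /cert_len; repeat cstep. Qed.

Lemma cnat_T : cnat (fun x _ => T x).
Proof. by have hQ := cnat_Q; rewrite /run_len; repeat cstep. Qed.

Lemma cbool_start_kind kd A : cnat A ->
  cbool (fun x r => start_kind x (T x) (Q x) (A x r) == kd).
Proof.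
move=> hA; have hT := cnat_T; have hQ := cnat_Q.
case: kd => [[a|]|].
- have h : cbool (fun x r => ~~ (A x r < T x) && (onth x (A x r - T x) == Some a)) by repeat cstep.
  apply: cbool_ext h => x r; rewrite /start_kind; case: ltnP => //= _.
  by case: (onth _ _) => //=; case: ltnP.
- have h : cbool (fun x r => [&& ~~ (A x r < T x), onth x (A x r - T x) == None
    & A x r - T x < size x + Q x]) by repeat cstep.
  apply: cbool_ext h => x r; rewrite /start_kind; case: ltnP => //= _.
  by case: (onth _ _) => //=; case: ltnP.
have h : cbool (fun x r => (A x r < T x) || (onth x (A x r - T x) == None)
    && ~~ (A x r - T x < size x + Q x)) by repeat cstep.
apply: cbool_ext h => x r; rewrite /start_kind; case: ltnP => //= _.
by case: (onth _ _) => //=; case: ltnP.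
Qed.

(** The input enters only through comparisons of time and position and through [start_kind], which
    has finitely many values. For each of them a predicate in [v] alone remains, which [cbool_table]
    handles. *)
Lemma cbool_forb A B : cnat A -> cnat B -> cbool (fun x r => cforb x (A x r) (B x r)).
Proof.
move=> hA hB; have hT := cnat_T.
have tab (h : nat -> bool) := cbool_table h (cells ^ 4) hB.
have ht : cnat (fun x r => ctime x (A x r)) by rewrite /ctime; repeat cstep.
have hp : cnat (fun x r => cpos x (A x r)) by rewrite /cpos; repeat cstep.
have hst : cbool (fun x r => all (fun kh : option (option Sigma) * bool =>
    ((start_kind x (T x) (Q x) (cpos x (A x r)) == kh.1) && ((cpos x (A x r) == T x) == kh.2))
    ==> ((B x r < cells ^ 4) && start_cell kh.1 kh.2 (vcell 1 (B x r)) (vcell 2 (B x r))))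
    (enum {: option (option Sigma) * bool})).
  apply: cbool_all => kh; apply: cbool_imp; last exact: (tab (fun v => start_cell kh.1 kh.2 (vcell 1 v) (vcell 2 v))).
  apply: cbool_and; first exact: cbool_start_kind.
  by apply: cbool_eqb; repeat cstep.
have h : cbool (fun x r => (B x r < cells ^ 4) && ~~
  [&& (B x r < cells ^ 4) && window (vcell 0 (B x r)) (vcell 1 (B x r)) (vcell 2 (B x r)) (vcell 3 (B x r)),
   (cpos x (A x r) == 0) ==> ((B x r < cells ^ 4) && blank_cell (vcell 0 (B x r))),
   (cpos x (A x r) == (T x).*2) ==> ((B x r < cells ^ 4) && blank_cell (vcell 2 (B x r))),
   (ctime x (A x r) == 0) ==> all (fun kh : option (option Sigma) * bool =>
    ((start_kind x (T x) (Q x) (cpos x (A x r)) == kh.1) && ((cpos x (A x r) == T x) == kh.2))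
    ==> ((B x r < cells ^ 4) && start_cell kh.1 kh.2 (vcell 1 (B x r)) (vcell 2 (B x r))))
    (enum {: option (option Sigma) * bool})
   & (((ctime x (A x r)).+1 == T x) && (cpos x (A x r) == T x)) ==>
        ((B x r < cells ^ 4) && accept_cell (vcell 3 (B x r)))]).
  repeat first [ exact: hst
   | exact: (tab (fun v => window (vcell 0 v) (vcell 1 v) (vcell 2 v) (vcell 3 v)))
   | exact: (tab (fun v => blank_cell (vcell 0 v)))
   | exact: (tab (fun v => blank_cell (vcell 2 v)))
   | exact: (tab (fun v => accept_cell (vcell 3 v)))
   | cstep ].
apply: cbool_ext h => x r; rewrite /cforb; case: ltnP => //= _.
rewrite /tableau_ok; congr (~~ [&& _, _, _, _ ==> _ & _]).
apply/allP/idP => [h|h [kd b] _ /=].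
  by have /implyP := h (start_kind x (T x) (Q x) (cpos x (A x r)), cpos x (A x r) == T x)
    (mem_enum _ _); rewrite /= !eqxx => /(_ isT).
by apply/implyP => /andP[/eqP <- /eqP <-].
Qed.

Lemma polytime_reduction : polytime reduction.
Proof.
have hT := cnat_T; have hf := cbool_forb.
have hns : cnat (fun x _ => nsites x) by rewrite /nsites; repeat cstep.
have hnc : cnat (fun x _ => nconstr x) by rewrite /nconstr; repeat cstep.
have hsc l A : cnat A -> cnat (fun x r => cscope x (A x r) l).
  by move=> hA; rewrite /cscope /ctime /cpos; repeat cstep.
apply: polytime_instance_word.
- by rewrite /red_stages /csp_stages; repeat cstep.
- by rewrite /red_items /csp_items; repeat cstep.
move=> A B hA hB; rewrite /red_clause /csp_clause /item /digit.
by repeat first [apply: hf | apply: hsc | cstep].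
Qed.

Lemma reductionP x : consistency_problem tiles (reduction x) <->
  exists u : seq bool, size u <= pq.[size x]%R /\ V (pair_word x u).
Proof.
have ns0 : 0 < nsites x by rewrite /nsites muln_gt0.
rewrite /reduction instance_wordP.
rewrite -(csp_gadget (cforb x) ns0 cells_gt0 (@cscope_lt x)) csp_tableau.
apply: (tableauP MV); rewrite /run_len; [lia|lia|] => u hu.
(* Natural coefficients make [pm] monotone, so a time bound for the longest certificates covers the
   shorter ones. *)
have mono := @is_poly_mono (fun m => pm.[m]%R) (ex_intro _ pm (fun=> erefl)).
by apply: leq_trans (leq_addr _ _); apply: mono; rewrite leq_add2l.
Qed.

End Reduction.

Lemma consistency_NP_hard : NP_hard (consistency_problem tiles).
Proof.
move=> Sigma L [V [pq [[M [pm MV]] hL]]].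
exists (reduction M pm pq); split; first exact: polytime_reduction.
by move=> x; rewrite hL (reductionP pq MV).
Qed.

Theorem theorem5 :
  NP_complete (consistency_problem [tuple cell_tile; square_tile]).
Proof. by split; [exact: consistency_in_NP | exact: consistency_NP_hard]. Qed.
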